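(* Let $0\le\alpha<d$, $1<p<\infty$, $\frac1q=\frac1p-\frac\alpha d>0$, and assume $p\le r\le s\le q$. Let $w$ be a weight on $\mathbb R^d$. Then the following are equivalent: (i) $w\in A_{(p,r),(q,s)}$; (ii) $w\in A_{p,q}$; (iii) $M_\alpha:L^{p,r}_w\to L^{q,s}_w$ is bounded.
   Context: A weight is a measurable function on $\mathbb R^d$ with values in $(0,\infty)$ almost everywhere; cubes have sides parallel to the axes. For a measurable $f$ on $\mathbb R^d$ with decreasing rearrangement $f^*$, $\|f\|_{L^{a,b}}:=\big(\frac ba\int_0^\infty[t^{1/a}f^*(t)]^b\frac{dt}t\big)^{1/b}$ for $0<a,b<\infty$, and $\|f\|_{L^{a,\infty}}:=\sup_{t>0}t^{1/a}f^*(t)$. $L^{a,b}_w:=\{f: fw\in L^{a,b}(\mathbb R^d)\}$ with $\|f\|_{L^{a,b}_w}:=\|fw\|_{L^{a,b}}$. For a cube $Q$, $\|h\|_{L^{a,b}(Q)}:=|Q|^{-1/a}\|h\mathbf 1_Q\|_{L^{a,b}}$. Primes denote conjugate exponents. $M_\alpha f(x)=\sup_{Q\ni x}|Q|^{\alpha/d}\frac1{|Q|}\int_Q|f|$, the supremum over cubes containing $x$. A weight $w$ belongs to $A_{(p,r),(q,s)}$ if $\sup_Q\|w\|_{L^{q,s}(Q)}\|w^{-1}\|_{L^{p',r'}(Q)}<\infty$, and to $A_{p,q}$ if $\sup_Q\big(\frac1{|Q|}\int_Qw^q\big)^{1/q}\big(\frac1{|Q|}\int_Qw^{-p'}\big)^{1/p'}<\infty$.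 *)

(* Defs.v *)
From HB Require Import structures.
From mathcomp Require Import all_boot all_order all_algebra.
From mathcomp Require Import all_classical all_reals all_analysis.
From mathcomp Require Import measurable_realfun.

Set Implicit Arguments.
Unset Strict Implicit.
Unset Printing Implicit Defensive.
Import Order.TTheory GRing.Theory Num.Theory.
Import numFieldNormedType.Exports.

Local Open Scope classical_set_scope.
Local Open Scope ring_scope.

(* Lebesgue measure on the Borel sets of R^d is built by recursion on d: in
   dimension 0 it is the unit mass at the only point, in dimension d + 1 it is
   the image of the product of the measures in dimensions 1 and d under
   (x, y) |-> x :: y. *)
Section borel_lebesgue_step.
Local Open Scope ereal_scope.
Context {R : realType} (n : nat).
Variable mu :
  {sigma_finite_measure set (n.-tuple (measurableTypeR R)) -> \bar R}.

Definition cons_point (z : measurableTypeR R * n.-tuple (measurableTypeR R)) :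
  n.+1.-tuple (measurableTypeR R) := [tuple of z.1 :: z.2].

Lemma measurable_cons_point : measurable_fun [set: _] cons_point.
Proof.
by apply: measurable_cons => /=; [exact: measurable_fst|exact: measurable_snd].
Qed.

Definition borel_lebesgue_step :
    set (n.+1.-tuple (measurableTypeR R)) -> \bar R :=
  pushforward (lebesgue_measure \x mu) cons_point.

Let step0 : borel_lebesgue_step set0 = 0.
Proof. by rewrite /borel_lebesgue_step /pushforward preimage_set0 measure0. Qed.

Let step_ge0 A : 0 <= borel_lebesgue_step A.
Proof. by rewrite /borel_lebesgue_step /pushforward measure_ge0. Qed.

Let step_sigma_additive : semi_sigma_additive borel_lebesgue_step.
Proof.
have mpre A : measurable A -> measurable (cons_point @^-1` A).
  by move=> mA; rewrite -[X in measurable X]setTI; exact: measurable_cons_point.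
move=> F mF tF mUF; rewrite /borel_lebesgue_step /pushforward preimage_bigcup.
apply: measure_semi_sigma_additive.
- by move=> i; exact: mpre.
- apply/trivIsetP => /= i j _ _ ij; rewrite -preimage_setI.
  by move/trivIsetP : tF => /(_ _ _ _ _ ij) ->//; rewrite preimage_set0.
- by rewrite -preimage_bigcup; exact: mpre.
Qed.

HB.instance Definition _ := isMeasure.Build _ _ _ borel_lebesgue_step
  step0 step_ge0 step_sigma_additive.

Let step_sigma_finite : sigma_finite setT borel_lebesgue_step.
Proof.
have /sigma_finiteP[F [TF ndF Foo]] := sigma_finiteT (@lebesgue_measure R).
have /sigma_finiteP[G [TG ndG Goo]] := sigma_finiteT mu.
pose split (x : n.+1.-tuple (measurableTypeR R)) :
    measurableTypeR R * n.-tuple (measurableTypeR R) :=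
  (thead x, [tuple of behead x]).
have msplit : measurable_fun setT split.
  apply: measurable_fun_pair; first exact: measurable_tnth.
  exact: measurable_behead.
have consK : cancel cons_point split.
  move=> [x y]; rewrite /split /cons_point theadE; congr (_, _).
  exact/val_inj.
exists (fun i => split @^-1` (F i `*` G i)).
  apply/seteqP; split => // x _.
  have [i _ Fi] : (\bigcup_i F i) (split x).1 by rewrite -TF.
  have [j _ Gj] : (\bigcup_i G i) (split x).2 by rewrite -TG.
  exists (maxn i j) => //; split.
    by move: Fi; exact/subsetPset/ndF/leq_maxl.
  by move: Gj; exact/subsetPset/ndG/leq_maxr.
move=> k; have [mF Fk] := Foo k; have [mG Gk] := Goo k.
have mFG : measurable (F k `*` G k) by exact: measurableX.
split; first by rewrite -[X in measurable X]setTI; exact: msplit.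
rewrite /borel_lebesgue_step /pushforward -comp_preimage.
rewrite (_ : split \o cons_point = id); last by apply/funext => z; exact: consK.
by rewrite preimage_id product_measure1E// lte_mul_pinfty// ge0_fin_numE.
Qed.

HB.instance Definition _ := Measure_isSigmaFinite.Build _ _ _
  borel_lebesgue_step step_sigma_finite.

End borel_lebesgue_step.

Fixpoint borel_lebesgue (R : realType) (d : nat) :
    {sigma_finite_measure set (d.-tuple (measurableTypeR R)) -> \bar R} :=
  match d with
  | 0 => \d_([tuple])
  | d'.+1 => borel_lebesgue_step (borel_lebesgue R d')
  end.

(* R^d with the sigma-algebra of Lebesgue measurable sets (Caratheodory
   measurability for the outer measure of [borel_lebesgue]), on which Lebesgue
   measure is complete. *)
Definition Rd (R : realType) (d : nat) :=
  caratheodory_type (mu_ext (borel_lebesgue R d)).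
HB.instance Definition _ (R : realType) (d : nat) := Measurable.on (Rd R d).

Definition lebesgue (R : realType) (d : nat) : set (Rd R d) -> \bar R :=
  @completed_measure_extension _ _ _ (borel_lebesgue R d).
HB.instance Definition _ (R : realType) (d : nat) := Measure.on (@lebesgue R d).

Section weighted_lorentz.
Local Open Scope ereal_scope.
Context {R : realType} {d : nat}.
Notation T := (Rd R d).
Notation mu := (@lebesgue R d).
Implicit Types (f h w : T -> \bar R) (Q : set T) (a p q alpha : R).
Implicit Types (b r s : \bar R).

(* The closed cube with smallest vertex c and side length l. *)
Definition cube (c : T) (l : R) : set T :=
  [set x | forall i, (tnth c i <= tnth x i <= tnth c i + l)%R].

Definition is_cube Q := exists c l, (0 < l)%R /\ Q = cube c l.

Definition is_weight w :=
  measurable_fun setT w /\ {ae mu, forall x, 0 < w x < +oo}.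

(* inf {u >= 0 : |{|f| > u}| <= t}, equal to +oo when there is no such u. *)
Definition rearrangement f (t : R) : \bar R :=
  ereal_inf [set u%:E | u in
    [set u : R | (0 <= u)%R /\ mu [set x | u%:E < `|f x|] <= t%:E]].

(* Meant for a in ]0, +oo[ and b in ]0, +oo]; b = -oo is a junk case. *)
Definition lorentz_norm a b f : \bar R :=
  match b with
  | b'%:E => ((b' / a)%:E * \int[lebesgue_measure]_(t in `]0%R, +oo[)
               (((t `^ a^-1)%:E * rearrangement f t) `^ b' * (t^-1)%:E))
             `^ b'^-1
  | +oo => ereal_sup [set (t `^ a^-1)%:E * rearrangement f t |
                       t in [set t : R | (0 < t)%R]]
  | -oo => 0
  end.

Definition weighted_lorentz_norm a b w f := lorentz_norm a b (f \* w).

Definition weighted_lorentz a b w : set (T -> \bar R) :=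
  [set f | measurable_fun setT f /\ weighted_lorentz_norm a b w f < +oo].

Definition cube_lorentz_norm a b Q h :=
  mu Q `^ (- a^-1) * lorentz_norm a b (h \_ Q).

Definition cube_average Q f : \bar R := (mu Q)^-1 * \int[mu]_(x in Q) f x.

Definition fractional_maximal alpha f (x : T) : \bar R :=
  ereal_sup [set mu Q `^ (alpha / d%:R) * cube_average Q (abse \o f) |
              Q in [set Q | is_cube Q /\ Q x]].

(* The conjugate exponent as a real number; meant for p > 1. *)
Definition conj_exp p : R := fine (hoelder_conjugate p%:E).

Definition lorentz_A p r q s w :=
  ereal_sup [set cube_lorentz_norm q s Q w *
                 cube_lorentz_norm (conj_exp p) (hoelder_conjugate r) Q
                   (fun x => (w x)^-1) | Q in is_cube] < +oo.

Definition muckenhoupt_A p q w :=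
  ereal_sup [set cube_average Q (fun x => w x `^ q) `^ q^-1 *
                 cube_average Q (fun x => w x `^ (- conj_exp p))
                   `^ (conj_exp p)^-1 | Q in is_cube] < +oo.

Definition bounded_weighted_lorentz p r q s w
    (F : (T -> \bar R) -> T -> \bar R) :=
  exists C : R, forall f, weighted_lorentz p r w f ->
    weighted_lorentz q s w (F f) /\
    weighted_lorentz_norm q s w (F f) <= C%:E * weighted_lorentz_norm p r w f.

End weighted_lorentz.

(* Main.v *)
Require Import Defs.
From HB Require Import structures.
From mathcomp Require Import all_boot all_order all_algebra.
From mathcomp Require Import all_classical all_reals all_analysis.
From mathcomp Require Import measurable_realfun ring lra.
Set Implicit Arguments.
Unset Strict Implicit.
Unset Printing Implicit Defensive.
Import Order.TTheory GRing.Theory Num.Theory.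
Import numFieldNormedType.Exports.
Local Open Scope classical_set_scope.
Local Open Scope ring_scope.

(** Everything is compared with (ii). Norms, averages and boundedness do not see null sets, so the
    weight may be taken real and positive everywhere ([is_weight_representative]). Two facts take
    care of the second Lorentz exponents: the $L^{a,b}$ norm decreases in $b$ up to a constant
    ([lorentz_norm_embedding]), and on a cube the normalised $L^{a_1}$ norm dominates every
    normalised $L^{a,b}$ norm with $a < a_1$ ([cube_lorentz_norm_le]).

    Since $s \le q$ and $r' \le p'$, the first fact gives (i) $\Rightarrow$ (ii). Since $p \le r$
    and $s \le q$, it also turns (iii) into a bound $L^p_w \to L^q_w$; testing this bound on
    $w^{-p'}$ restricted to parts of a cube gives (iii) $\Rightarrow$ (ii) ([bounded_muckenhoupt]).

    The other two implications rest on the openness of (ii): if $w \in A_{p,q}$, the cube norms with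
    exponents $q(1+e)$ and $p'(1+e)$ are still controlled for some $e > 0$
    ([muckenhoupt_bound_open]). This comes from a reverse Hölder inequality for $u = w^q$ and
    $\sigma = w^{-p'}$ ([weight_pair_reverse_hoelder]). Behind it is a Calderon-Zygmund stopping
    argument: a set filling less than $\eta^k$ of a cube carries at most $\beta^k$ of its weighted
    mass ([weight_pair_abs_cont]). With the second Lorentz fact, openness gives (ii) $\Rightarrow$
    (i).

    For (ii) $\Rightarrow$ (iii), openness puts $w$ in $A_{P,Q}$ for two pairs $(P,Q)$, one on each
    side of $(p,q)$, with the same difference $1/P - 1/Q$. For each pair $M_\alpha$ maps $L^P_w$ to
    $L^Q_w$ ([off_diag_strong_type]): it is dominated pointwise by two nested maximal operators, one
    for the measure $u\,dx$ and one for $\sigma\,dx$, and each is bounded because its measure is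
    doubling. The conjugated operator $F \mapsto w M_\alpha(F/w)$ acts between unweighted spaces, so
    Marcinkiewicz interpolation, carried out on rearrangements with Hardy inequalities
    ([lorentz_interpolation]), yields $L^{p,r} \to L^{q,r}$; as $r \le s$, the target embeds in
    $L^{q,s}$. *)

(** * Measures with a density *)

Section density_measure.
Local Open Scope ereal_scope.
Context d (T : measurableType d) (R : realType).
Variables (mu : {measure set T -> \bar R}) (u : T -> R).
Hypotheses (mu_u : measurable_fun setT u) (u_ge0 : forall x, (0 <= u x)%R).

(** The two proofs are arguments of the function, so that the term itself carries what its measure
    structure requires. *)
Definition density of measurable_fun setT u & (forall x, (0 <= u x)%R) :=
  fun A : set T => \int[mu]_(x in A) (u x)%:E.

Let density0 : density mu_u u_ge0 set0 = 0.
Proof. by rewrite /density integral_set0. Qed.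

Let density_ge0 A : 0 <= density mu_u u_ge0 A.
Proof. by apply: integral_ge0 => x _; rewrite lee_fin. Qed.

Let density_sigma_additive : semi_sigma_additive (density mu_u u_ge0).
Proof.
move=> F mF tF mUF; rewrite /density ge0_integral_bigcup//.
- by apply: is_cvg_nneseries => n _ _; apply: integral_ge0 => x _; rewrite lee_fin.
- exact/measurable_funTS/measurable_EFinP.
- by move=> x _; rewrite lee_fin.
Qed.

HB.instance Definition _ := isMeasure.Build _ _ _ (density mu_u u_ge0)
  density0 density_ge0 density_sigma_additive.

Import HBNNSimple.

(** Monotone convergence on both sides along simple approximations of [f]; for a simple function the
    identity is linearity over its finitely many values. *)
Let ge0_integral_densityT (f : T -> \bar R) : measurable_fun setT f ->
  (forall x, 0 <= f x) ->
  \int[density mu_u u_ge0]_x f x = \int[mu]_x (f x * (u x)%:E).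
Proof.
move=> mf f0; pose g := nnsfun_approx measurableT mf.
have mg n : measurable_fun setT (fun x => (g n x * u x)%:E).
  by apply/measurable_EFinP; exact: measurable_funM.
transitivity (limn (fun n => \int[density mu_u u_ge0]_x (g n x)%:E)).
  apply/esym/cvg_lim => //.
  rewrite [X in _ --> X](_ : _ =
      \int[density mu_u u_ge0]_x limn (EFin \o g ^~ x)); last first.
    apply: eq_integral => x _; apply/esym/cvg_lim => //.
    exact: cvg_nnsfun_approx.
  apply: cvg_monotone_convergence => //.
  - by move=> n; exact/measurable_EFinP.
  - by move=> n x _; rewrite lee_fin.
  - by move=> x _ a b ab; rewrite lee_fin; exact/lefP/nd_nnsfun_approx.
transitivity (limn (fun n => \int[mu]_x (g n x * u x)%:E)).
  congr (limn _); apply/funext => n.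
  rewrite integralT_nnsfun sintegralE.
  under [RHS]eq_integral => x _.
    rewrite fimfunE EFinM -fsumEFin// ge0_mule_fsuml; last first.
      by move=> r; rewrite EFinM; exact: nnfun_muleindic_ge0.
    over.
  rewrite ge0_integral_fsum//=; last 2 first.
  - move=> r; apply: emeasurable_funM; last exact/measurable_EFinP.
    by apply/measurable_EFinP; apply: measurable_funM.
  - move=> r x _; apply: mule_ge0; last by rewrite lee_fin.
    by rewrite EFinM; exact: nnfun_muleindic_ge0.
  apply: eq_fsbigr => r /[!inE] -[x _ <-{r}].
  rewrite /density integral_mkcond.
  rewrite -ge0_integralZl//; last 3 first.
  - by apply/(measurable_restrictT _ _).1 => //; exact/measurable_funTS/measurable_EFinP.
  - by move=> y _; apply: erestrict_ge0 => z _; rewrite lee_fin.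
  - by rewrite lee_fin.
  apply: eq_integral => y _; rewrite patchE indicE.
  by case: ifPn => _; rewrite ?mule0 ?mulr0 ?mul0e// mulr1.
apply/cvg_lim => //.
rewrite [X in _ --> X](_ : _ = \int[mu]_x limn (fun n => (g n x * u x)%:E));
    last first.
  apply: eq_integral => x _; apply/esym/cvg_lim => //.
  under eq_fun do rewrite EFinM.
  have [->|ux] := eqVneq (u x) 0%R.
    by rewrite mule0; under eq_fun do rewrite mule0; exact: cvg_cst.
  by apply: cvgeZr => //; exact: cvg_nnsfun_approx.
apply: cvg_monotone_convergence => //.
- by move=> n x _; rewrite lee_fin mulr_ge0.
- move=> x _ a b ab; rewrite lee_fin ler_wpM2r//.
  exact/lefP/nd_nnsfun_approx.
Qed.

Lemma ge0_integral_density D (f : T -> \bar R) : measurable D ->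
  measurable_fun D f -> (forall x, D x -> 0 <= f x) ->
  \int[density mu_u u_ge0]_(x in D) f x = \int[mu]_(x in D) (f x * (u x)%:E).
Proof.
move=> mD mf f0; rewrite [LHS]integral_mkcond [LHS]ge0_integral_densityT//; last 2 first.
- exact/(measurable_restrictT _ _).1.
- by apply: erestrict_ge0.
rewrite [RHS]integral_mkcond; apply: eq_integral => x _.
by rewrite !patchE; case: ifPn; rewrite ?mul0e.
Qed.

End density_measure.

(** * The layer cake formula *)

Section layer_cake.
Local Open Scope ereal_scope.
Context d (T : measurableType d) (R : realType).
Variable m : {sigma_finite_measure set T -> \bar R}.

Lemma measurable_strict_subgraph (F : T -> \bar R) : measurable_fun setT F ->
  measurable [set z : T * measurableTypeR R | (0 < z.2)%R /\ z.2%:E < F z.1].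
Proof.
move=> mF.
have mFz : measurable_fun setT (fun z : T * measurableTypeR R => F z.1).
  exact: measurableT_comp.
have m2 : measurable_fun setT (fun z : T * measurableTypeR R => z.2%:E : \bar R).
  by apply/measurable_EFinP; exact: measurable_snd.
rewrite (_ : [set _ | _] =
   [set z : T * measurableTypeR R | 0%:E < z.2%:E] `&`
   [set z : T * measurableTypeR R | z.2%:E < F z.1]); last first.
  by apply/seteqP; split => z /=; rewrite lte_fin.
apply: measurableI.
- by rewrite -[X in measurable X]setTI; exact: emeasurable_fun_o_infty.
- rewrite -[X in measurable X]setTI.
  exact: emeasurable_fun_lt.
Qed.

(** Tonelli for the indicator of the region $0 < t < F(x)$: its sections at fixed [x] have length
    [F x], those at fixed [t] are superlevel sets. *)
Lemma layer_cake (F : T -> \bar R) : measurable_fun setT F ->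
  (forall x, 0 <= F x) ->
  \int[m]_x F x =
  \int[lebesgue_measure]_(t in `]0%R, +oo[) m [set x | t%:E < F x].
Proof.
move=> mF F0.
pose S := [set z : T * measurableTypeR R | (0 < z.2)%R /\ z.2%:E < F z.1].
have mS : measurable S by exact: measurable_strict_subgraph.
transitivity (\int[m]_x \int[lebesgue_measure]_t (\1_S (x, t))%:E).
  apply: eq_integral => x _.
  rewrite (_ : (fun t => _) = (fun t => (\1_(xsection S x) t)%:E)); last first.
    apply/funext => t; rewrite !indicE; congr (_%:R%:E); congr nat_of_bool.
    by apply/idP/idP; rewrite !inE /xsection /=; rewrite inE.
  rewrite integral_indic ?setIT//; last exact: measurable_xsection.
  case Fx : (F x) (F0 x) => [r| |//] => [r0|_].
  - rewrite (_ : xsection S x = `]0%R, r[%classic).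
      rewrite [RHS]lebesgue_measure_itv/= lte_fin.
      by move: r0; rewrite lee_fin le_eqVlt => /orP[/eqP <-|->];
        rewrite ?ltxx// oppr0 adde0.
    apply/seteqP; split => t; rewrite /xsection/= inE /S/= Fx lte_fin in_itv/=.
      by move=> [-> ->].
    by move=> /andP[-> ->].
  - rewrite (_ : xsection S x = `]0%R, +oo[%classic).
    by rewrite [RHS]lebesgue_measure_itv/= ltry.
    apply/seteqP; split => t; rewrite /xsection/= inE /S/= Fx in_itv/= andbT.
      by case.
    by move=> ->; rewrite ltry.
rewrite (fubini_tonelli (fun z : T * measurableTypeR R => (\1_S z)%:E))//.
  rewrite [RHS]integral_mkcond; apply: eq_integral => t _; rewrite patchE.
  case: ifPn => [|/negP]; rewrite inE/= in_itv/= andbT => t0.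
    pose A : set T := [set x | ((t : R)%:E < F x)%E].
    rewrite (_ : (fun x => _) = (fun x => (\1_A x)%:E)).
      rewrite integral_indic ?setIT// -[X in measurable X]setTI.
      exact: emeasurable_fun_o_infty.
    apply/funext => x; rewrite !indicE; congr (_%:R%:E); congr nat_of_bool.
    by apply/idP/idP; rewrite !inE /S/= => //; case.
  apply: integral0_eq => x _; rewrite indicE memNset//= /S/=; tauto.
by apply/measurable_EFinP; exact: measurable_indic.
Qed.

End layer_cake.

(** * Powers of extended reals and monotonicity of integrals *)

Section poweR_complements.
Local Open Scope ereal_scope.
Context {R : realType}.
Implicit Types (x y : \bar R) (r : R).

Lemma lee_poweR r x y : (0 <= r)%R -> 0 <= x -> x <= y -> x `^ r <= y `^ r.
Proof.
move=> r0 x0 xy; apply: gt0_ler_poweR => //.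
- by rewrite in_itv/= x0 leey.
- by rewrite in_itv/= (le_trans x0 xy) leey.
Qed.

Lemma lte_poweR r x y : (0 < r)%R -> 0 <= x -> x < y -> x `^ r < y `^ r.
Proof.
move=> r0 x0 xy; rewrite ltNge; apply/negP => yx.
have := lee_poweR (r := r^-1) _ (poweR_ge0 _ _) yx.
rewrite -!poweRrM mulfV ?gt_eqF// !poweRe1// ?(le_trans x0 (ltW xy))//.
by rewrite invr_ge0 ltW// => /(_ isT); rewrite leNgt xy.
Qed.

Lemma lee_poweRE r x y : (0 < r)%R -> 0 <= x -> 0 <= y ->
  (x `^ r <= y `^ r) = (x <= y).
Proof.
move=> r0 x0 y0; apply/idP/idP; last by apply: lee_poweR => //; exact: ltW.
by apply: contraLR; rewrite -!ltNge; exact: lte_poweR.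
Qed.

Lemma poweRK r x : r != 0%R -> 0 <= x -> (x `^ r) `^ r^-1 = x.
Proof. by move=> r0 x0; rewrite -poweRrM mulfV// poweRe1. Qed.

Lemma poweRVK r x : r != 0%R -> 0 <= x -> (x `^ r^-1) `^ r = x.
Proof. by move=> r0 x0; rewrite -poweRrM mulVf// poweRe1. Qed.

Lemma poweRD_gt0 x r s : (0 < r)%R -> (0 < s)%R ->
  x `^ (r + s) = x `^ r * x `^ s.
Proof.
by move=> r0 s0; rewrite poweRD// add_neq0_poweRD_def// gt_eqF// addr_gt0.
Qed.

Lemma measurable_poweR r : measurable_fun setT (fun x => x `^ r).
Proof.
have mf : measurable_fun setT (fun x => (fine x `^ r)%:E : \bar R).
  apply/measurable_EFinP; apply: (measurableT_comp (measurable_powR _)).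
  exact: fine_measurable.
rewrite (_ : (fun x => x `^ r) = (fun x => if x \is a fin_num
    then (fine x `^ r)%:E else if x == +oo then +oo `^ r else -oo `^ r)).
  apply: measurable_fun_ifT => //; last first.
    by apply: measurable_fun_ifT => //; exact: measurable_fun_eqe.
  apply: (measurable_fun_bool true).
  by rewrite [X in measurable X](_ : _ = setT `&` [set x : \bar R | x \is a fin_num]);
    [exact: emeasurable_fin_num|rewrite setTI].
by apply/funext => -[].
Qed.

Lemma measurable_fun_poweR d (T : measurableType d) D (f : T -> \bar R) r :
  measurable_fun D f -> measurable_fun D (fun t => f t `^ r).
Proof. by move=> mf; exact: (measurableT_comp (measurable_poweR r) mf). Qed.

End poweR_complements.

Section chebyshev.
Local Open Scope ereal_scope.
Context d (T : measurableType d) (R : realType).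
Variable m : {measure set T -> \bar R}.

Lemma ge0_chebyshev (F : T -> \bar R) (a : R) : measurable_fun setT F ->
  (forall x, 0 <= F x) -> (0 <= a)%R ->
  a%:E * m [set x | a%:E < F x] <= \int[m]_x F x.
Proof.
move=> mF F0 a0.
have mA : measurable [set x | a%:E < F x].
  by rewrite -[X in measurable X]setTI; exact: emeasurable_fun_o_infty.
rewrite -integral_cst//.
apply: (@le_trans _ _ (\int[m]_(x in [set x | a%:E < F x]) F x)).
  apply: ge0_le_integral => //; last by move=> x /ltW.
  exact: measurable_funTS.
by apply: ge0_subset_integral.
Qed.

End chebyshev.

Section monotone_integral.
Local Open Scope ereal_scope.
Context d (T : measurableType d) (R : realType).
Variable m : {measure set T -> \bar R}.

(* The integral of a nonnegative function is a supremum over simple functions,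
   hence it is monotone without any measurability assumption. *)
Lemma le_integral_nonneg (D E : set T) (f g : T -> \bar R) : D `<=` E ->
  (forall x, D x -> 0 <= f x <= g x) -> (forall x, E x -> 0 <= g x) ->
  \int[m]_(x in D) f x <= \int[m]_(x in E) g x.
Proof.
move=> DE fg g0; rewrite integral_mkcond [leRHS]integral_mkcond.
have f0 x : 0 <= (f \_ D) x.
  by rewrite patchE; case: ifPn => // /set_mem /fg /andP[].
have g0' x : 0 <= (g \_ E) x.
  by rewrite patchE; case: ifPn => // /set_mem /g0.
rewrite !ge0_integralTE//; apply: ereal_sup_le => _ [h hf <-]; exists h => //=.
move=> x; rewrite (le_trans (hf x))// !patchE.
case: ifPn => [/set_mem Dx|_].
  by rewrite mem_set; [case/andP: (fg _ Dx)|exact: DE].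
by have := g0' x; rewrite patchE.
Qed.

End monotone_integral.

(** * Integrals of power functions near zero and near infinity *)

Section power_integrals.
Context {R : realType}.
Implicit Types c t : R.

Lemma powR_continuous_within c (A : interval R) : {subset A <= `]0, +oo[} ->
  {within [set` A], continuous (@powR R ^~ c)}.
Proof.
move=> A0; apply: derivable_within_continuous => x xA.
by apply: derivable_powR; exact: A0.
Qed.

Let cvg_powR c t : 0 < t -> (@powR R ^~ c) x @[x --> t] --> t `^ c.
Proof.
move=> t0; have /derivable1_diffP/differentiable_continuous : derivable (@powR R ^~ c) t 1.
  by apply: derivable_powR; rewrite in_itv/= t0.
exact.
Qed.

Lemma integral_powR_cc c s t : 0 < c -> 0 < s -> s < t ->
  (\int[lebesgue_measure]_(x in `[s, t]) (x `^ (c - 1))%:E =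
   ((t `^ c - s `^ c) / c)%:E)%E.
Proof.
move=> c0 s0 st; have t0 := lt_trans s0 st.
rewrite (@continuous_FTC2 _ _ (fun x => c^-1 * x `^ c))//.
- by rewrite -EFinB -mulrBr mulrC.
- apply: powR_continuous_within => x; rewrite !in_itv/= andbT => /andP[sx _].
  exact: lt_le_trans sx.
- split.
  + move=> x; rewrite in_itv/= => /andP[sx _].
    apply: derivableM => //; apply: derivable_powR.
    by rewrite in_itv/= andbT (lt_trans s0).
  + by apply: cvg_at_right_filter; apply: cvgMr; exact: cvg_powR.
  + by apply: cvg_at_left_filter; apply: cvgMr; exact: cvg_powR.
- move=> x; rewrite in_itv/= => /andP[sx _].
  have x0 : x \in `]0, +oo[ by rewrite in_itv/= andbT (lt_trans s0).
  rewrite derive1Ml; last exact: derivable_powR.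
  by rewrite powR_derive1// mulrA mulVf ?gt_eqF// mul1r.
Qed.

Lemma integral_powR_0t c t : 0 < c -> 0 < t ->
  (\int[lebesgue_measure]_(x in `]0%R, t]) (x `^ (c - 1))%:E <= (t `^ c / c)%:E)%E.
Proof.
move=> c0 t0.
pose F n : set R := `[t / n.+2%:R, t]%classic.
have -> : `]0, t]%classic = \bigcup_n F n.
  apply/seteqP; split => x /=; rewrite in_itv/=.
    move=> /andP[x0 xt].
    exists (Num.truncn (t / x)) => //; rewrite /F/= in_itv/= xt andbT.
    rewrite ler_pdivrMr// mulrC -ler_pdivrMr//.
    by rewrite (le_trans (ltW (truncnS_gt _)))// ler_nat.
  move=> [n _]; rewrite /F/= in_itv/= => /andP[nx ->]; rewrite andbT.
  by rewrite (lt_le_trans _ nx)// divr_gt0.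
have mF c' A : measurable A -> measurable_fun A (fun x : R => (x `^ c')%:E).
  by move=> mA; apply/measurable_EFinP/measurable_funTS; exact: measurable_powR.
have cv := @ge0_nondecreasing_set_cvg_integral _ (measurableTypeR R) _ F
   (fun x : R => (x `^ (c - 1))%:E) lebesgue_measure.
have cvF : (\int[lebesgue_measure]_(x in F i) (x `^ (c - 1))%:E)%E @[i --> \oo] -->
    (\int[lebesgue_measure]_(x in \bigcup_i F i) (x `^ (c - 1))%:E)%E.
  apply: cv.
  - move=> n k nk; apply/subsetPset; apply: subset_itvr; rewrite bnd_simp.
    by rewrite ler_pM2l// lef_pV2 ?posrE// ler_nat.
  - by move=> n; exact: measurable_itv.
  - by move=> n; apply: mF; exact: measurable_itv.
  - by move=> n x _; rewrite lee_fin powR_ge0.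
rewrite -(cvg_lim _ cvF)//; apply: lime_le; first exact: cvgP cvF.
apply: nearW => n; rewrite integral_powR_cc//.
- by rewrite lee_fin ler_pM2r ?invr_gt0// gerBl// powR_ge0.
- by rewrite divr_gt0.
- by rewrite ltr_pdivrMr// ltr_pMr// ltr1n.
Qed.

Lemma integral_powR_ty c t : 0 < c -> 0 < t ->
  (\int[lebesgue_measure]_(x in `[t, +oo[) (x `^ (- c - 1))%:E <=
   (t `^ (- c) / c)%:E)%E.
Proof.
move=> c0 t0.
rewrite (@ge0_continuous_FTC2y _ _ (fun x => - c^-1 * x `^ (- c)) _ 0)//.
- by rewrite sub0e -EFinN mulNr opprK mulrC.
- by move=> x _; rewrite powR_ge0.
- apply: powR_continuous_within => x; rewrite !in_itv/= !andbT.
  exact: lt_le_trans.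
- rewrite -[X in _ --> X](mulr0 (- c^-1)); apply: cvgMr.
  under eq_fun do rewrite powRN.
  apply/gtr0_cvgV0; first by near=> x; rewrite powR_gt0.
  apply/cvgryPge => A; near=> x.
  rewrite (@le_trans _ _ (`|A| `^ c^-1 `^ c))//.
    by rewrite -powRrM mulVf ?gt_eqF// powRr1// ler_norm.
  have Ax : `|A| `^ c^-1 <= x by near: x; apply: nbhs_pinfty_ge; rewrite num_real.
  rewrite ge0_ler_powR ?nnegrE ?(le_trans _ Ax) ?powR_ge0//; exact: ltW.
- move=> x tx; apply: derivableM => //; apply: derivable_powR.
  by rewrite in_itv/= andbT (lt_trans t0).
- by apply: cvg_at_right_filter; apply: cvgMr; exact: cvg_powR.
- move=> x; rewrite in_itv/= andbT => tx.
  have x0 : x \in `]0, +oo[ by rewrite in_itv/= andbT (lt_trans t0).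
  rewrite derive1Ml; last exact: derivable_powR.
  by rewrite powR_derive1// mulrA mulNr mulrN opprK mulVf ?gt_eqF// mul1r.
Unshelve. all: by end_near. Qed.

End power_integrals.

(** * Decreasing rearrangements and equimeasurability *)

Section monotone_measurable.
Local Open Scope ereal_scope.
Context {R : realType}.
Implicit Types phi : R -> \bar R.

Lemma nonincreasing_emeasurable phi : {homo phi : s t / (s <= t)%R >-> t <= s} ->
  measurable_fun setT phi.
Proof.
move=> hphi; apply: (measurability _ (ErealGenOInfty.measurableE R)).
move=> _ [_ [y ->] <-]; rewrite setTI; apply: is_interval_measurable.
move=> s t /=; rewrite !in_itv/= !andbT => ys yt u /andP[_ ut].
by rewrite in_itv/= andbT (lt_le_trans yt)// hphi.
Qed.

Lemma nondecreasing_emeasurable phi : {homo phi : s t / (s <= t)%R >-> s <= t} ->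
  measurable_fun setT phi.
Proof.
move=> hphi; apply: (measurability _ (ErealGenOInfty.measurableE R)).
move=> _ [_ [y ->] <-]; rewrite setTI; apply: is_interval_measurable.
move=> s t /=; rewrite !in_itv/= !andbT => ys yt u /andP[su _].
by rewrite in_itv/= andbT (lt_le_trans ys)// hphi.
Qed.

End monotone_measurable.

Section rearrangement.
Local Open Scope ereal_scope.
Context d (T : measurableType d) (R : realType).

(** The formula of [rearrangement] for an arbitrary measure: weighted measures are rearranged as
    well, and for [lebesgue] the two are convertible. *)
Definition rearr (m : set T -> \bar R) (f : T -> \bar R) (t : R) : \bar R :=
  ereal_inf [set u%:E | u in
    [set u : R | (0 <= u)%R /\ m [set x | u%:E < `|f x|] <= t%:E]].

Lemma rearr_ge0 m f t : 0 <= rearr m f t.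
Proof. by apply: le_ereal_inf_tmp => _ [u [u0 _] <-]; rewrite lee_fin. Qed.

Lemma rearr_nonincreasing m f :
  {homo rearr m f : s t / (s <= t)%R >-> t <= s}.
Proof.
move=> s t st; apply: ereal_inf_le_tmp => _ [u [u0 mu] <-]; exists u => //.
by split=> //; rewrite (le_trans mu).
Qed.

Lemma measurable_rearr m f : measurable_fun setT (rearr m f).
Proof. by apply: nonincreasing_emeasurable; exact: rearr_nonincreasing. Qed.

Variable m : {measure set T -> \bar R}.
Implicit Types f g : T -> \bar R.

Lemma measurable_superlevel f (y : \bar R) : measurable_fun setT f ->
  measurable [set x | y < `|f x|].
Proof.
move=> mf; rewrite -[X in measurable X]setTI.
by apply: emeasurable_fun_o_infty => //; exact: measurableT_comp.
Qed.

Lemma le_superlevel f (u v : R) : measurable_fun setT f -> (u <= v)%R ->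
  m [set x | v%:E < `|f x|] <= m [set x | u%:E < `|f x|].
Proof.
move=> mf uv; apply: le_measure; rewrite ?inE; try exact: measurable_superlevel.
by move=> x; apply: le_lt_trans; rewrite lee_fin.
Qed.

(** The infimum is attained because the distribution function is right-continuous: the set where
    $|f| > u$ is the increasing union of those where $|f| > u + 1/(n+1)$. Rearrangements are handled
    mostly through this equivalence. *)
Lemma rearr_le f (t u : R) : measurable_fun setT f -> (0 <= u)%R ->
  (rearr m f t <= u%:E) = (m [set x | u%:E < `|f x|] <= t%:E).
Proof.
move=> mf u0; apply/idP/idP => [fu|mt]; last by apply: ereal_inf_lbound; exists u.
pose F n := [set x | (u + n.+1%:R^-1)%:E < `|f x|].
have mF n : m (F n) <= t%:E.
  have : rearr m f t < (u + n.+1%:R^-1)%:E.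
    by rewrite (le_lt_trans fu)// lte_fin ltrDl invr_gt0.
  move=> /ereal_inf_lt[_ [v [v0 mv] <-]]; rewrite lte_fin => /ltW vu.
  by rewrite (le_trans _ mv)//; exact: le_superlevel.
have -> : [set x | u%:E < `|f x|] = \bigcup_n F n.
  apply/seteqP; split => x /=.
    case fx : `|f x| => [r| |//]; last first.
      by exists 0%N => //; rewrite /F/= fx ltry.
    rewrite lte_fin => ur; have [n nr] := ltr_add_invr ur.
    by exists n => //; rewrite /F/= fx lte_fin.
  by move=> [n _]; apply: le_lt_trans; rewrite lee_fin lerDl invr_ge0.
have cF : m (F n) @[n --> \oo] --> m (\bigcup_n F n).
  apply: nondecreasing_cvg_mu.
  - by move=> n; exact: measurable_superlevel.
  - by apply: bigcup_measurable => n _; exact: measurable_superlevel.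
  - move=> n k nk; apply/subsetPset => x; apply: le_lt_trans.
    by rewrite lee_fin lerD2l lef_pV2 ?posrE// ler_nat.
rewrite -(cvg_lim _ cF)//; apply: lime_le; first exact: cvgP cF.
exact: nearW.
Qed.

Lemma rearr_gt f (t u : R) : measurable_fun setT f -> (0 <= u)%R ->
  (u%:E < rearr m f t) = (t%:E < m [set x | u%:E < `|f x|]).
Proof. by move=> mf u0; rewrite !ltNge rearr_le. Qed.

Lemma le_rearr f g : measurable_fun setT f -> measurable_fun setT g ->
  (forall x, `|f x| <= `|g x|) -> forall t, rearr m f t <= rearr m g t.
Proof.
move=> mf mg fg t; apply: ereal_inf_le_tmp => _ [u [u0 mu] <-]; exists u => //.
split=> //; rewrite (le_trans _ mu)//; apply: le_measure; rewrite ?inE;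
  try exact: measurable_superlevel.
by move=> x /lt_le_trans; apply.
Qed.

Lemma ae_eq_rearr f g : measurable_fun setT f -> measurable_fun setT g ->
  {ae m, forall x, f x = g x} -> rearr m f = rearr m g.
Proof.
suff le h k t : measurable_fun setT h -> measurable_fun setT k ->
    {ae m, forall x, h x = k x} -> rearr m h t <= rearr m k t.
  move=> mf mg fg; apply/funext => t; apply/eqP; rewrite eq_le !le//.
  by apply: filterS fg => x ->.
move=> mh mk [N [mN N0 hkN]].
apply: ereal_inf_le_tmp => _ [u [u0 mu] <-]; exists u => //.
split=> //; rewrite (le_trans _ mu)//.
have mS := measurable_superlevel u%:E.
rewrite (@le_trans _ _ (m ([set x | u%:E < `|k x|] `|` N)))//.
  apply: le_measure; rewrite ?inE; [exact: mS|exact: measurableU (mS _ _) _|].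
  move=> x ux; have [hk|hk] := pselect (h x = k x); last by right; exact: hkN.
  by left; rewrite /= -hk.
by rewrite measureU0//; exact: mS.
Qed.

End rearrangement.

Section equimeasurability.
Local Open Scope ereal_scope.
Context d (T : measurableType d) (R : realType).
Variable m : {sigma_finite_measure set T -> \bar R}.

Lemma lebesgue_measure_lt (y : \bar R) : 0 <= y ->
  lebesgue_measure [set t : R | (0 < t)%R /\ t%:E < y] = y.
Proof.
case: y => [r| |//]; rewrite ?lee_fin => r0.
- rewrite (_ : [set _ | _] = `]0%R, r[%classic).
    rewrite lebesgue_measure_itv/= lte_fin.
    by move: r0; rewrite le_eqVlt => /orP[/eqP <-|->]; rewrite ?ltxx// oppr0 adde0.
  by apply/seteqP; split => t /=; rewrite in_itv/= lte_fin => /andP.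
- rewrite (_ : [set _ | _] = `]0%R, +oo[%classic).
    by rewrite lebesgue_measure_itv/= ltry.
  by apply/seteqP; split => t /=; rewrite in_itv/= andbT ltry => // -[].
Qed.

(** Layer cake on both sides. By [rearr_gt] the positive $t$ with $f^*(t) > u$ are those below the
    measure of the set where $|f| > u$, so [f] and its rearrangement are equimeasurable. *)
Lemma integral_rearr (f : T -> \bar R) (a : R) : measurable_fun setT f ->
  (0 < a)%R ->
  \int[m]_x `|f x| `^ a =
  \int[lebesgue_measure]_(t in `]0%R, +oo[) rearr m f t `^ a.
Proof.
move=> mf a0.
rewrite layer_cake; last 2 first.
- by apply: measurable_fun_poweR; exact: measurableT_comp.
- by move=> x; exact: poweR_ge0.
rewrite [RHS]integral_mkcond layer_cake; last 2 first.
- apply/(measurable_restrictT _ _).1 => //; apply: measurable_funTS.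
  by apply: measurable_fun_poweR; exact: measurable_rearr.
- by apply: erestrict_ge0 => t _; exact: poweR_ge0.
have powlt (l : R) (y : \bar R) : (0 < l)%R -> 0 <= y ->
    (l%:E < y `^ a) = ((l `^ a^-1)%:E < y).
  move=> l0 y0; rewrite !ltNge; congr negb.
  rewrite -[in RHS](lee_poweRE a0)// ?lee_fin ?powR_ge0//.
  by rewrite -poweR_EFin poweRVK ?gt_eqF// lee_fin ltW.
apply: eq_integral => l; rewrite inE/= in_itv/= andbT => l0.
transitivity (m [set x | (l `^ a^-1)%:E < `|f x|]).
  by congr (m _); apply/funext => x /=; rewrite powlt.
rewrite -[LHS]lebesgue_measure_lt//; congr (lebesgue_measure _).
apply/funext => t /=; apply/propext; rewrite patchE; split.
  move=> [t0 tm]; rewrite mem_set/= ?in_itv/= ?t0//.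
  by rewrite powlt ?rearr_ge0// rearr_gt// powR_ge0.
case: ifPn => [|_]; last by rewrite ltNge lee_fin (ltW l0).
rewrite inE/= in_itv/= andbT => t0.
by rewrite powlt ?rearr_ge0// rearr_gt// powR_ge0.
Qed.

End equimeasurability.

(** * Lorentz integrals of nonincreasing functions *)

Section lorentz_integral.
Local Open Scope ereal_scope.
Context {R : realType}.
Notation leb := (@lebesgue_measure R).
Implicit Types (phi : R -> \bar R) (a b p r s t e : R).

(** The $b$-th power of the Lorentz norm without its factor $b/a$, with [phi] in the role of the
    rearrangement. *)
Definition lorentz_int a b phi : \bar R :=
  \int[leb]_(t in `]0%R, +oo[)
    (((t `^ a^-1)%:E * phi t) `^ b * (t^-1)%:E).

Lemma measurable_inv_gt0 : measurable_fun (`]0%R, +oo[%classic : set R) (fun t : R => t^-1)%R.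
Proof.
apply: (eq_measurable_fun (fun t : R => t `^ (- 1)))%R.
  move=> t; rewrite inE/= in_itv/= andbT => t0.
  by rewrite powR_inv1// ltW.
by apply: measurable_funTS; exact: measurable_powR.
Qed.

Lemma measurable_lorentz_base a b phi : measurable_fun setT phi ->
  measurable_fun setT (fun t => ((t `^ a^-1)%:E * phi t) `^ b).
Proof.
move=> mphi; apply: measurable_fun_poweR; apply: emeasurable_funM => //.
by apply/measurable_EFinP; exact: measurable_powR.
Qed.

Lemma measurable_lorentz_integrand a b phi : measurable_fun setT phi ->
  measurable_fun (`]0%R, +oo[%classic : set R)
    (fun t => ((t `^ a^-1)%:E * phi t) `^ b * (t^-1)%:E).
Proof.
move=> mphi; apply: emeasurable_funM.
  by apply: measurable_funTS; exact: measurable_lorentz_base.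
by apply/measurable_EFinP; exact: measurable_inv_gt0.
Qed.

Lemma lorentz_integrand_ge0 a b phi t : (0 < t)%R ->
  0 <= ((t `^ a^-1)%:E * phi t) `^ b * (t^-1)%:E.
Proof. by move=> t0; rewrite mule_ge0 ?poweR_ge0// lee_fin invr_ge0 ltW. Qed.

Lemma lorentz_int_ge0 a b phi : 0 <= lorentz_int a b phi.
Proof.
apply: integral_ge0 => t /=; rewrite in_itv/= andbT => t0.
exact: lorentz_integrand_ge0.
Qed.

Section nonincreasing.
Variable phi : R -> \bar R.
Hypotheses (phi_ge0 : forall t, 0 <= phi t)
  (phi_homo : {homo phi : s t / (s <= t)%R >-> t <= s}).

Let mphi : measurable_fun setT phi.
Proof. exact: nonincreasing_emeasurable. Qed.

(** On $(s/2, s)$ the integrand is at least $((s/2)^{1/a}\phi(s))^b/s$, as [phi] is nonincreasing,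
    and the interval has length $s/2$. The local form matters in the Hardy inequalities, where only
    a part of the Lorentz integral is available. *)
Lemma lorentz_base_le_dyadic a b s : (0 < a)%R -> (0 < b)%R -> (0 < s)%R ->
  ((s `^ a^-1)%:E * phi s) `^ b <=
  (2 `^ (b / a) * 2)%:E * \int[leb]_(t in `](s / 2)%R, s[)
    (((t `^ a^-1)%:E * phi t) `^ b * (t^-1)%:E).
Proof.
move=> a0 b0 s0; have s20 : (0 < s / 2)%R by rewrite divr_gt0.
have subI : `](s / 2)%R, s[%classic `<=` (`]0%R, +oo[%classic : set R).
  move=> t /=; rewrite !in_itv/= andbT => /andP[st _]; exact: lt_trans st.
set c := (((s / 2) `^ a^-1)%:E * phi s) `^ b.
have c0 : 0 <= c by exact: poweR_ge0.
have -> : ((s `^ a^-1)%:E * phi s) `^ b = (2 `^ (b / a))%:E * c.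
  rewrite (_ : 2 `^ (b / a) = (2 `^ a^-1) `^ b)%R; last by rewrite -powRrM mulrC.
  rewrite -[((_ `^ b)%R)%:E]poweR_EFin -poweRM ?mule_ge0 ?lee_fin ?powR_ge0//.
  rewrite muleA -EFinM -powRM// ?(ltW s20)//.
  by rewrite (_ : 2 * (s / 2) = s)%R// mulrC divfK.
rewrite EFinM -muleA; apply: lee_pmul => //.
have -> : c = 2%:E * \int[leb]_(t in `](s / 2)%R, s[) ((s^-1)%:E * c).
  rewrite integral_cst//= lebesgue_measure_itv/= lte_fin ifT; last first.
    by rewrite ltr_pdivrMr// ltr_pMr// ltr1n.
  rewrite -EFinB muleAC -EFinM muleA -EFinM.
  by rewrite (_ : 2 * _ = 1)%R ?mul1e//; field; rewrite gt_eqF.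
rewrite lee_pmul2l// ?lte_fin//.
apply: ge0_le_integral => //.
- by move=> t _; rewrite mule_ge0// lee_fin invr_ge0 ltW.
- by apply: measurable_funS (measurable_lorentz_integrand a b mphi).
- move=> t /=; rewrite in_itv/= => /andP[st ts].
  have t0 : (0 < t)%R by exact: lt_trans st.
  rewrite muleC; apply: lee_pmul => //.
  + by rewrite lee_fin invr_ge0 ltW.
  + apply: lee_poweR; first exact: ltW.
      by rewrite mule_ge0// lee_fin powR_ge0.
    apply: lee_pmul => //; first by rewrite lee_fin powR_ge0.
    * by rewrite lee_fin ge0_ler_powR ?nnegrE ?invr_ge0// ltW.
    * by apply: phi_homo; exact: ltW.
  + by rewrite lee_fin lef_pV2 ?posrE// ltW.
Qed.

Lemma lorentz_base_le a b s : (0 < a)%R -> (0 < b)%R -> (0 < s)%R ->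
  ((s `^ a^-1)%:E * phi s) `^ b <=
  (2 `^ (b / a) * 2)%:E * lorentz_int a b phi.
Proof.
move=> a0 b0 s0; rewrite (le_trans (lorentz_base_le_dyadic a0 b0 s0))//.
apply: lee_pmul => //.

- apply: integral_ge0 => t /=; rewrite in_itv/= => /andP[st _].
  by apply: lorentz_integrand_ge0; apply: lt_trans st; rewrite divr_gt0.
apply: ge0_subset_integral => //.
- exact: measurable_lorentz_integrand.
- by move=> t /=; rewrite in_itv/= andbT; exact: lorentz_integrand_ge0.
- move=> t /=; rewrite !in_itv/= andbT => /andP[+ _]; apply: lt_trans.
  by rewrite divr_gt0.
Qed.

(** Of the power [b2] in the integrand, [b1] is kept and integrated, while the excess is bounded
    uniformly by [lorentz_base_le]. *)
Lemma lorentz_int_embedding a b1 b2 : (0 < a)%R -> (0 < b1)%R -> (b1 <= b2)%R ->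
  lorentz_int a b2 phi <=
  ((2 `^ (b1 / a) * 2) `^ ((b2 - b1) / b1))%:E * (lorentz_int a b1 phi) `^ (b2 / b1).
Proof.
move=> a0 b10; rewrite le_eqVlt => /orP[/eqP <-|b12].
  rewrite subrr mul0r powRr0 mul1e divff ?gt_eqF// poweRe1//.
  exact: lorentz_int_ge0.
have b20 : (0 < b2)%R by exact: lt_trans b12.
set L := lorentz_int a b1 phi; set K := (2 `^ (b1 / a) * 2)%R.
have K0 : (0 <= K)%R by rewrite mulr_ge0 ?powR_ge0.
have L0 : 0 <= L by exact: lorentz_int_ge0.
set c := ((b2 - b1) / b1)%R.
have c0 : (0 < c)%R by rewrite divr_gt0// subr_gt0.
have -> : (b2 / b1 = c + 1)%R by rewrite /c mulrBl divff ?gt_eqF// subrK.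
rewrite poweRD_gt0// poweRe1// muleA -poweR_EFin -poweRM ?lee_fin//.
rewrite -ge0_integralZl//; last 3 first.
- exact: measurable_lorentz_integrand.
- by move=> t /=; rewrite in_itv/= andbT; exact: lorentz_integrand_ge0.
- exact: poweR_ge0.
apply: ge0_le_integral => //.
- by move=> t /=; rewrite in_itv/= andbT; exact: lorentz_integrand_ge0.
- exact: measurable_lorentz_integrand.
- by apply: emeasurable_funM => //; exact: measurable_lorentz_integrand.
- move=> t /=; rewrite in_itv/= andbT => t0.
  rewrite muleA; apply: lee_pmul => //; [exact: poweR_ge0| |].
    by rewrite lee_fin invr_ge0 ltW.
  rewrite (_ : b2 = b1 * c + b1)%R; last first.
    by rewrite /c mulrC divfK ?gt_eqF// subrK.
  rewrite poweRD_gt0 ?(mulr_gt0 b10 c0)// poweRrM; apply: lee_pmul => //; try exact: poweR_ge0.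
  by apply: lee_poweR; [exact: ltW|exact: poweR_ge0|exact: lorentz_base_le].
Qed.

End nonincreasing.
End lorentz_integral.

(** * Hardy inequalities for nonincreasing functions *)

Section hardy.
Local Open Scope ereal_scope.
Context {R : realType}.
Notation leb := (@lebesgue_measure R).
Notation mR := (measurableTypeR R).
Implicit Types (phi g : R -> \bar R) (p r s t e : R).

Lemma fubini_kernel (k : R -> R) (S : set (mR * mR)) g :
  measurable_fun setT k -> (forall t, 0 <= k t)%R -> measurable S ->
  measurable_fun setT g -> (forall s, 0 <= g s) ->
  \int[leb]_t ((k t)%:E * \int[leb]_(s in xsection S t) g s) =
  \int[leb]_s (g s * \int[leb]_(t in ysection S s) (k t)%:E).
Proof.
move=> mk k0 mS mg g0.
have mk1 : measurable_fun setT (fun z : mR * mR => (k z.1)%:E : \bar R).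
  by apply/measurable_EFinP; apply: (@measurableT_comp _ _ _ _ _ _ k).
have mg2 : measurable_fun setT (fun z : mR * mR => g z.2).
  exact: (@measurableT_comp _ _ _ _ _ _ g).
have mS1 : measurable_fun setT (fun z : mR * mR => (\1_S z : R)%:E).
  by apply/measurable_EFinP; exact: measurable_indic.
pose F := fun z : mR * mR => (k z.1)%:E * (g z.2 * (\1_S z : R)%:E).
have mF : measurable_fun setT F.
  by apply: emeasurable_funM => //; exact: emeasurable_funM.
have F0 z : 0 <= F z by rewrite !mule_ge0// lee_fin.
transitivity (\int[leb]_t \int[leb]_s F (t, s)).
  apply: eq_integral => t _; rewrite /F/= ge0_integralZl//; last 3 first.
  - apply: emeasurable_funM => //.
    by apply/measurable_EFinP; apply: measurableT_comp => //; exact: pair1_measurable.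
  - by move=> s _; rewrite mule_ge0// lee_fin.
  - by rewrite lee_fin.
  congr (_ * _); rewrite [LHS]integral_mkcond; apply: eq_integral => s _.
  rewrite patchE indicE mem_xsection.
  by case: ifPn => _; rewrite ?mule1 ?mule0.
rewrite fubini_tonelli//; apply: eq_integral => s _.
transitivity (\int[leb]_t (g s * ((k t)%:E * (\1_S (t, s) : R)%:E))).
  by apply: eq_integral => t _; rewrite /F/= muleCA.
rewrite ge0_integralZl//; last 2 first.
  - apply: emeasurable_funM; first exact/measurable_EFinP.
    by apply/measurable_EFinP; apply: measurableT_comp => //; exact: pair2_measurable.
  - by move=> t _; rewrite mule_ge0// lee_fin.
congr (_ * _); rewrite [RHS]integral_mkcond; apply: eq_integral => t _.
rewrite patchE indicE mem_ysection.
by case: ifPn => _; rewrite ?mule1 ?mule0.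
Qed.

Let measurable_lt_triangle c : (0 < c)%R ->
  measurable [set z : mR * mR | (0 < z.2)%R /\ (z.2 < c * z.1)%R].
Proof.
move=> c0; have m1 : measurable_fun setT (fun z : mR * mR => (c * z.1)%R : R).
  by apply: measurable_funM => //; exact: measurable_fst.
have m2 : measurable_fun setT (fun z : mR * mR => z.2 : R).
  exact: measurable_snd.
rewrite (_ : [set _ | _] = [set z : mR * mR | (0 < (z.2 : R)%:E)%E] `&`
    [set z | ((z.2 : R)%:E < (c * z.1)%:E)%E]); last first.
  by apply/seteqP; split => z /=; rewrite !lte_fin.
apply: measurableI; rewrite -[X in measurable X]setTI.
- by apply: emeasurable_fun_o_infty => //; exact/measurable_EFinP.
- by apply: emeasurable_fun_lt => //; exact/measurable_EFinP.
Qed.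

(** After Tonelli the inner integral is that of $t^{-e-1}$ over $t > s$, at most $s^{-e}/e$, which
    cancels the factor $s^e$. *)
Lemma hardy_kernel_low e (psi : R -> \bar R) : (0 < e)%R ->
  measurable_fun (`]0%R, +oo[%classic : set R) psi ->
  (forall s, (0 < s)%R -> 0 <= psi s) ->
  \int[leb]_(t in `]0%R, +oo[) ((t `^ (- e - 1))%:E *
    \int[leb]_(s in `]0%R, t[) ((s `^ e)%:E * psi s)) <=
  (e^-1)%:E * \int[leb]_(s in `]0%R, +oo[) psi s.
Proof.
move=> e0 mpsi psi0.
pose P : set R := `]0%R, +oo[%classic.
have mP : measurable P by exact: measurable_itv.
have mpsiP : measurable_fun setT (psi \_ P) by apply/(measurable_restrictT _ _).1.
have psiP0 s : 0 <= (psi \_ P) s.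
  rewrite patchE; case: ifPn => //; rewrite inE /P/= in_itv/= andbT.
  exact: psi0.
pose S := [set z : mR * mR | (0 < z.2)%R /\ (z.2 < 1 * z.1)%R].
pose g := (fun s => (s `^ e)%:E * psi s) \_ P.
have g0 s : 0 <= g s.
  apply: erestrict_ge0 => {}s; rewrite /P/= in_itv/= andbT => s0.
  by rewrite mule_ge0 ?psi0// lee_fin powR_ge0.
apply: (@le_trans _ _ (\int[leb]_t ((t `^ (- e - 1))%:E *
    \int[leb]_(s in xsection S t) g s))).
  apply: le_integral_nonneg => // [t _|t _]; last first.
    by rewrite mule_ge0 ?lee_fin ?powR_ge0// integral_ge0.
  apply/andP; split.
    rewrite mule_ge0 ?lee_fin ?powR_ge0// integral_ge0// => s/=.
    by rewrite in_itv/= => /andP[s0 _]; rewrite mule_ge0 ?psi0// lee_fin powR_ge0.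
  apply: lee_pmul; rewrite ?lee_fin ?powR_ge0//.
    apply: integral_ge0 => s/=.
    by rewrite in_itv/= => /andP[s0 _]; rewrite mule_ge0 ?psi0// lee_fin powR_ge0.
  apply: le_integral_nonneg => // s /=; rewrite in_itv/= => /andP[s0 st].
    by rewrite /xsection/= inE /S/= mul1r.
  rewrite mule_ge0 ?psi0 ?lee_fin ?powR_ge0//=.
  by rewrite /g patchE mem_set// /P/= in_itv/= s0.
rewrite fubini_kernel//; last 3 first.
- by move=> t; exact: powR_ge0.
- exact: measurable_lt_triangle.
- apply/(measurable_restrictT _ _).1 => //; apply: emeasurable_funM => //.
  by apply/measurable_EFinP/measurable_funTS; exact: measurable_powR.
rewrite [X in _ <= _ * X]integral_mkcond -ge0_integralZl//; last first.
  by rewrite lee_fin invr_ge0 ltW.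
apply: le_integral_nonneg => // [s _|s _]; last first.
  by apply: mule_ge0; [rewrite lee_fin invr_ge0 ltW|exact: psiP0].
rewrite mule_ge0 ?integral_ge0//=; last by move=> t _; rewrite lee_fin powR_ge0.
rewrite /g !patchE -/P; case: ifPn => [|_]; last by rewrite mul0e mule0.
rewrite inE /P/= in_itv/= andbT => s0.
have le_inner : \int[leb]_(t in ysection S s) (t `^ (- e - 1))%:E <=
    (s `^ (- e) / e)%:E.
  apply: (le_trans _ (integral_powR_ty e0 s0)).
  apply: le_integral_nonneg => [t /=|t _|t _]; rewrite ?lee_fin ?powR_ge0 ?lexx//.
  by rewrite /ysection/= inE /S/= mul1r in_itv/= andbT => -[_ /ltW].
apply: (le_trans (lee_pmul _ _ (lexx _) le_inner)).
- by rewrite mule_ge0 ?psi0// lee_fin powR_ge0.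
- by apply: integral_ge0 => t _; rewrite lee_fin powR_ge0.
rewrite muleAC -EFinM mulrA -powRD ?subrr ?powRr0 ?mul1r//.
by apply/implyP => _; rewrite gt_eqF.
Qed.

(** After Tonelli the inner integral is that of $t^{e-1}$ over $0 < t < 2s$, at most $(2s)^e/e$,
    which cancels $s^{-e}$ and leaves $2^e/e$. *)
Lemma hardy_kernel_high e (psi : R -> \bar R) : (0 < e)%R ->
  measurable_fun (`]0%R, +oo[%classic : set R) psi ->
  (forall s, (0 < s)%R -> 0 <= psi s) ->
  \int[leb]_(t in `]0%R, +oo[) ((t `^ (e - 1))%:E *
    \int[leb]_(s in `](t / 2)%R, +oo[) ((s `^ (- e))%:E * psi s)) <=
  (2 `^ e / e)%:E * \int[leb]_(s in `]0%R, +oo[) psi s.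
Proof.
move=> e0 mpsi psi0.
pose P : set R := `]0%R, +oo[%classic.
have mP : measurable P by exact: measurable_itv.
have mpsiP : measurable_fun setT (psi \_ P) by apply/(measurable_restrictT _ _).1.
have psiP0 s : 0 <= (psi \_ P) s.
  rewrite patchE; case: ifPn => //; rewrite inE /P/= in_itv/= andbT.
  exact: psi0.
pose S := [set z : mR * mR | (0 < z.1)%R /\ (z.1 < 2 * z.2)%R].
have mS : measurable S.
  have : measurable ((fun z : mR * mR => (z.2, z.1)) @^-1`
      [set z : mR * mR | (0 < z.2)%R /\ (z.2 < 2 * z.1)%R]).
    rewrite -[X in measurable X]setTI; apply: measurable_swap => //.
    exact: measurable_lt_triangle.
  by [].
pose g := (fun s => (s `^ (- e))%:E * psi s) \_ P.
have g0 s : 0 <= g s.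
  apply: erestrict_ge0 => {}s; rewrite /P/= in_itv/= andbT => s0.
  by rewrite mule_ge0 ?psi0// lee_fin powR_ge0.
have h0 t s : (0 < t)%R -> `](t / 2)%R, +oo[%classic s ->
    (0 < s)%R /\ 0 <= (s `^ (- e))%:E * psi s.
  move=> t0 /=; rewrite in_itv/= andbT => ts.
  have s0 : (0 < s)%R by apply: lt_trans ts; rewrite divr_gt0.
  by rewrite mule_ge0 ?psi0// lee_fin powR_ge0.
apply: (@le_trans _ _ (\int[leb]_t ((t `^ (e - 1))%:E *
    \int[leb]_(s in xsection S t) g s))).
  apply: le_integral_nonneg => // [t|t _]; last first.
    by rewrite mule_ge0 ?lee_fin ?powR_ge0// integral_ge0.
  rewrite /= in_itv/= andbT => t0; apply/andP; split.
    rewrite mule_ge0 ?lee_fin ?powR_ge0// integral_ge0// => s /(h0 _ _ t0).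
    by case.
  apply: lee_pmul; rewrite ?lee_fin ?powR_ge0//.
    by apply: integral_ge0 => s /(h0 _ _ t0)[].
  apply: le_integral_nonneg => // s /[dup] /(h0 _ _ t0)[s0 hs]/=.
    rewrite in_itv/= andbT ltr_pdivrMr// => ts.
    by rewrite /xsection/= inE /S/=; split=> //; rewrite mulrC.
  by rewrite hs/= /g patchE mem_set// /P/= in_itv/= s0.
rewrite fubini_kernel//; last 2 first.
- by move=> t; exact: powR_ge0.
- apply/(measurable_restrictT _ _).1 => //; apply: emeasurable_funM => //.
  by apply/measurable_EFinP/measurable_funTS; exact: measurable_powR.
rewrite [X in _ <= _ * X]integral_mkcond -ge0_integralZl//; last first.
  by rewrite lee_fin divr_ge0 ?powR_ge0 ?ltW.
apply: le_integral_nonneg => // [s _|s _]; last first.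
  by apply: mule_ge0; [rewrite lee_fin divr_ge0 ?powR_ge0 ?ltW|exact: psiP0].
rewrite mule_ge0 ?integral_ge0//=; last by move=> t _; rewrite lee_fin powR_ge0.
rewrite /g !patchE -/P; case: ifPn => [|_]; last by rewrite mul0e mule0.
rewrite inE /P/= in_itv/= andbT => s0.
have le_inner : \int[leb]_(t in ysection S s) (t `^ (e - 1))%:E <=
    ((2 * s) `^ e / e)%:E.
  have s20 : (0 < 2 * s)%R by rewrite mulr_gt0.
  apply: (le_trans _ (integral_powR_0t e0 s20)).
  apply: le_integral_nonneg => [t /=|t _|t _]; rewrite ?lee_fin ?powR_ge0 ?lexx//.
  by rewrite /ysection/= inE /S/= in_itv/= => -[-> /ltW].
apply: (le_trans (lee_pmul _ _ (lexx _) le_inner)).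
- by rewrite mule_ge0 ?psi0// lee_fin powR_ge0.
- by apply: integral_ge0 => t _; rewrite lee_fin powR_ge0.
rewrite muleAC -EFinM powRM// ?(ltW s0)//.
rewrite (_ : s `^ (- e) * (2 `^ e * s `^ e / e) =
  2 `^ e / e * (s `^ (- e) * s `^ e))%R; last by ring.
rewrite -powRD ?addNr ?powRr0 ?mulr1//.
by apply/implyP => _; rewrite gt_eqF.
Qed.

End hardy.

Section hardy_lorentz.
Local Open Scope ereal_scope.
Context {R : realType}.
Notation leb := (@lebesgue_measure R).
Implicit Types (phi : R -> \bar R) (p r s t e : R).

Let integral_poweR_bound (A : set R) phi (k a p v : R) (B : \bar R) :
  measurable A -> (forall s, A s -> (0 < s)%R) -> (forall s, 0 <= phi s) ->
  (0 <= k)%R -> (0 < p)%R -> 0 <= B ->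
  (forall s, A s -> phi s <= (k * s `^ a)%:E * B) ->
  \int[leb]_(s in A) (s `^ (a * p))%:E <= v%:E ->
  (\int[leb]_(s in A) phi s `^ p) `^ p^-1 <= (k * v `^ p^-1)%:E * B.
Proof.
move=> mA A0 phi0 k0 p0 B0 phiB lev.
have v0 : (0 <= v)%R.
  by rewrite -lee_fin (le_trans _ lev)// integral_ge0// => s _; rewrite lee_fin powR_ge0.
have -> : (k * v `^ p^-1)%:E * B = ((k `^ p)%:E * B `^ p * v%:E) `^ p^-1.
  rewrite !poweRM ?mule_ge0 ?poweR_ge0 ?lee_fin ?powR_ge0//.
  rewrite poweRK ?gt_eqF// !poweR_EFin -powRrM mulfV ?gt_eqF// powRr1//.
  by rewrite muleAC EFinM.
apply: lee_poweR; first by rewrite invr_ge0 ltW.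
  by apply: integral_ge0 => s _; exact: poweR_ge0.
apply: (@le_trans _ _ ((k `^ p)%:E * B `^ p * \int[leb]_(s in A) (s `^ (a * p))%:E)).
  rewrite -ge0_integralZl//; last 3 first.
  - by apply/measurable_EFinP/measurable_funTS; exact: measurable_powR.
  - by move=> s _; rewrite lee_fin powR_ge0.
  - by rewrite mule_ge0 ?poweR_ge0// lee_fin powR_ge0.
  apply: le_integral_nonneg => // s As; last first.
    by rewrite !mule_ge0 ?poweR_ge0// lee_fin powR_ge0.
  rewrite poweR_ge0/=.
  apply: (le_trans (lee_poweR (ltW p0) (phi0 s) (phiB s As))).
  rewrite poweRM//; last by rewrite lee_fin mulr_ge0 ?powR_ge0.
  by rewrite poweR_EFin powRM ?powR_ge0// -powRrM EFinM muleAC.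
by apply: lee_pmul => //; rewrite ?mule_ge0 ?poweR_ge0 ?integral_ge0// => *;
  rewrite lee_fin powR_ge0.
Qed.

Let poweR_split (s a r k : R) (x J : \bar R) : (0 < s)%R -> (0 < r)%R ->
  (0 <= k)%R -> 0 <= x -> 0 <= J -> ((s `^ a)%:E * x) `^ r <= k%:E * J ->
  x <= (s `^ (- a) * k `^ r^-1)%:E * J `^ r^-1.
Proof.
move=> s0 r0 k0 x0 J0 h.
have sa0 : 0 <= (s `^ a)%:E * x by rewrite mule_ge0// lee_fin powR_ge0.
have := lee_poweR (r := r^-1) _ (poweR_ge0 _ _) h.
rewrite invr_ge0 (ltW r0) poweRK ?gt_eqF// => /(_ isT).
rewrite poweRM// poweR_EFin => {}h.
rewrite EFinM -muleA.
have -> : x = (s `^ (- a))%:E * ((s `^ a)%:E * x).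
  rewrite muleA -EFinM -powRD ?addNr ?powRr0 ?mul1e//.
  by apply/implyP => _; rewrite gt_eqF.
by apply: lee_pmul => //; rewrite lee_fin powR_ge0.
Qed.

(** For $s < t$, monotonicity bounds $\phi(s)$ by a power of $s$ times $J(t)^{1/r}$, with $J(t)$ a
    weighted part of the Lorentz integral. Inserted in the inner integral and raised to the power
    $r$, this becomes linear in $J$, and [hardy_kernel_low] concludes. No Minkowski inequality
    enters, so every $r > 0$ is covered, whatever its position relative to $p_0$. *)
Lemma hardy_low (p p0 r : R) : (0 < p0)%R -> (p0 < p)%R -> (0 < r)%R ->
  exists2 C : R, (0 < C)%R & forall phi, (forall t, 0 <= phi t) ->
    {homo phi : s t / (s <= t)%R >-> t <= s} ->
    \int[leb]_(t in `]0%R, +oo[)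
      (((t `^ (p^-1 - p0^-1))%:E *
        (\int[leb]_(s in `]0%R, t[) phi s `^ p0) `^ p0^-1) `^ r * (t^-1)%:E) <=
    C%:E * lorentz_int p r phi.
Proof.
move=> p00 p0p r0.
have pp : (0 < p)%R by exact: lt_trans p0p.
(* Half of the gap between the exponents is spent on [e], for convergence of the outer kernel; the
   other half leaves [c] positive, where $(-1/p - e/r)\,p_0 = c - 1$ is the exponent in the inner
   integral. *)
pose e : R := (r * (p0^-1 - p^-1) / 2)%R.
pose c : R := ((1 - p0 / p) / 2)%R.
have e0 : (0 < e)%R.
  by rewrite divr_gt0// mulr_gt0// subr_gt0 ltf_pV2 ?posrE.
have c0 : (0 < c)%R by rewrite divr_gt0// subr_gt0 ltr_pdivrMr// mul1r.
pose K : R := (2 `^ (r / p) * 2 * 2 `^ e)%R.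
have K0 : (0 < K)%R by rewrite !mulr_gt0// powR_gt0.
pose C : R := ((K `^ r^-1 * c^-1 `^ p0^-1) `^ r)%R.
have C0 : (0 < C)%R by rewrite powR_gt0// mulr_gt0// powR_gt0// invr_gt0.
exists (C * e^-1)%R; first by rewrite mulr_gt0// invr_gt0.
move=> phi phi0 phih.
pose psi t := ((t `^ p^-1)%:E * phi t) `^ r * (t^-1)%:E.
have psi0 t : (0 < t)%R -> 0 <= psi t by exact: lorentz_integrand_ge0.
have mpsi : measurable_fun (`]0%R, +oo[%classic : set R) psi.
  by apply: measurable_lorentz_integrand; exact: nonincreasing_emeasurable.
pose J t := \int[leb]_(s in `]0%R, t[) ((s `^ e)%:E * psi s).
have J0 t : 0 <= J t.
  apply: integral_ge0 => s /=; rewrite in_itv/= => /andP[s0 _].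
  by rewrite mule_ge0 ?psi0// lee_fin powR_ge0.
rewrite EFinM -muleA.
apply: (@le_trans _ _ (C%:E * \int[leb]_(t in `]0%R, +oo[)
    ((t `^ (- e - 1))%:E * J t))); last first.
  by rewrite lee_pmul2l ?lte_fin//; exact: hardy_kernel_low.
have mJ : measurable_fun setT J.
  apply: nondecreasing_emeasurable => t u tu.
  apply: le_integral_nonneg => s /=; rewrite !in_itv/= => /andP[s0 st].
  - by rewrite s0 (lt_le_trans st).
  - by rewrite mule_ge0 ?psi0 ?lexx// lee_fin powR_ge0.
  - by rewrite mule_ge0 ?psi0// lee_fin powR_ge0.
rewrite -ge0_integralZl//; last 3 first.
- apply: emeasurable_funM; last exact: measurable_funTS.
  by apply/measurable_EFinP/measurable_funTS; exact: measurable_powR.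
- by move=> t _; rewrite mule_ge0// lee_fin powR_ge0.
- by rewrite lee_fin ltW.
apply: le_integral_nonneg => // t /=; rewrite in_itv/= andbT => t0; last first.
  by rewrite !mule_ge0// lee_fin ?powR_ge0// ltW.
apply/andP; split.
  by rewrite mule_ge0 ?poweR_ge0// lee_fin invr_ge0 ltW.
(* The dyadic bound at [s], into which the weight of [J] is inserted: for $u$ in $(s/2, s)$ one has
   $(2u/s)^e \ge 1$, and this interval lies in $(0, t)$. *)
have phiB s : `]0%R, t[%classic s ->
    phi s <= (K `^ r^-1 * s `^ (- p^-1 - e / r))%:E * (J t) `^ r^-1.
  rewrite /= in_itv/= => /andP[s0 st].
  have := @poweR_split s p^-1 r (K * s `^ (- e))%R (phi s) (J t) s0 r0.
  rewrite mulr_ge0 ?powR_ge0 ?(ltW K0)// => /(_ isT (phi0 s) (J0 t)) H.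
  have {H} := H _.
  rewrite powRM ?powR_ge0 ?(ltW K0)// -powRrM mulNr mulrCA -powRD; last first.
    by apply/implyP => _; rewrite gt_eqF.
  apply.
  apply: (le_trans (lorentz_base_le_dyadic phi0 phih pp r0 s0)).
  rewrite /K -[(_ * s `^ _)%R]mulrA [in leRHS]EFinM -[leRHS]muleA.
  apply: lee_pmul => //; rewrite ?lee_fin ?mulr_ge0 ?powR_ge0//.
    by apply: integral_ge0 => u/=; rewrite in_itv/= => /andP[su _];
      apply: psi0; apply: lt_trans su; rewrite divr_gt0.
  rewrite -ge0_integralZl//; last 3 first.
  - apply: measurable_funS (emeasurable_funM _ mpsi) => //; last first.
      by apply/measurable_EFinP/measurable_funTS; exact: measurable_powR.
    by move=> u /=; rewrite !in_itv/= => /andP[->].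
  - move=> u /=; rewrite in_itv/= => /andP[u0 _].
    by rewrite mule_ge0 ?psi0// lee_fin powR_ge0.
  - by rewrite lee_fin mulr_ge0 ?powR_ge0.
  have s20 : (0 < s / 2)%R by rewrite divr_gt0.
  apply: le_integral_nonneg => u /=; rewrite !in_itv/= => /andP[su us].
  - by rewrite (lt_trans s20 su) (lt_trans us st).
  - have u0 : (0 < u)%R by exact: lt_trans su.
    rewrite [X in X && _]psi0//= muleA -EFinM -[leLHS]mul1e.
    apply: lee_pmul => //; first exact: psi0.
    rewrite lee_fin mulrAC -powRM ?(ltW u0)// powRN ler_pdivlMr ?powR_gt0//.
    rewrite mul1r ge0_ler_powR ?nnegrE ?(ltW e0) ?(ltW s0) ?mulr_ge0 ?(ltW u0)//.
    by rewrite mulrC -ler_pdivrMr// ltW.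
  - apply: mule_ge0; first by rewrite lee_fin mulr_ge0 ?powR_ge0.
    by apply: mule_ge0; [rewrite lee_fin powR_ge0|exact: psi0].
have t0' s : `]0%R, t[%classic s -> (0 < s)%R.
  by rewrite /= in_itv/= => /andP[].
have vt : \int[leb]_(s in `]0%R, t[) (s `^ ((- p^-1 - e / r) * p0))%:E <=
    (t `^ c / c)%:E.
  rewrite (_ : (- p^-1 - e / r) * p0 = c - 1)%R; last first.
    by rewrite /e /c; field; rewrite !gt_eqF.
  apply: (le_trans _ (integral_powR_0t c0 t0)).
  apply: le_integral_nonneg => s /=; rewrite ?in_itv/= ?lee_fin ?powR_ge0 ?lexx//.
  by move=> /andP[-> /ltW].
have H := integral_poweR_bound (measurable_itv _) t0' phi0 (powR_ge0 K r^-1) p00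
  (poweR_ge0 (J t) r^-1) phiB vt.
rewrite [leLHS]muleC (_ : (t `^ (- e - 1))%:E = (t^-1)%:E * (t `^ (- e))%:E); last first.
  rewrite -EFinM -[(t^-1)%R]powR_inv1 ?ltW// -powRD; last by apply/implyP => _; rewrite gt_eqF.
  by rewrite addrC.
rewrite -[((t^-1)%:E * _ * J t)]muleA [leRHS]muleCA; apply: lee_pmul => //.
- by rewrite lee_fin invr_ge0 ltW.
- exact: poweR_ge0.
apply: (@le_trans _ _ (((t `^ (p^-1 - p0^-1))%:E *
    ((K `^ r^-1 * (t `^ c / c) `^ p0^-1)%:E * J t `^ r^-1)) `^ r)).
  apply: lee_poweR; first exact: ltW.
    by rewrite mule_ge0 ?poweR_ge0// lee_fin powR_ge0.
  by apply: lee_pmul => //; rewrite ?poweR_ge0 ?lee_fin ?powR_ge0.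
rewrite [X in X `^ r]muleA poweRM ?poweR_ge0//; last first.
  by rewrite -EFinM lee_fin !mulr_ge0 ?powR_ge0.
rewrite poweRVK ?gt_eqF// [leRHS]muleA; apply: lee_pmul => //; first exact: poweR_ge0.
rewrite -EFinM poweR_EFin -EFinM lee_fin /C.
have -> : ((t `^ c / c) `^ p0^-1 = t `^ (c / p0) * c^-1 `^ p0^-1)%R.
  by rewrite powRM ?powR_ge0 ?invr_ge0 ?(ltW c0)// -powRrM.
have -> : (t `^ (p^-1 - p0^-1) * (K `^ r^-1 * (t `^ (c / p0) * c^-1 `^ p0^-1)) =
  (K `^ r^-1 * c^-1 `^ p0^-1) * t `^ (- e / r))%R.
  have -> : (t `^ (- e / r) = t `^ (p^-1 - p0^-1) * t `^ (c / p0))%R.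
    rewrite -powRD; last by apply/implyP => _; rewrite gt_eqF.
    by congr (_ `^ _)%R; rewrite /e /c; field; rewrite !gt_eqF.
  by ring.
rewrite powRM ?mulr_ge0 ?powR_ge0// -[(t `^ _ `^ _)%R]powRrM.
by rewrite divfK ?gt_eqF.
Qed.

(** The mirror image of [hardy_low] at infinity: here the inner exponent is $(-1/p + e/r)\,p_1 = -c
    - 1$. *)
Lemma hardy_high (p p1 r : R) : (0 < p)%R -> (p < p1)%R -> (0 < r)%R ->
  exists2 C : R, (0 < C)%R & forall phi, (forall t, 0 <= phi t) ->
    {homo phi : s t / (s <= t)%R >-> t <= s} ->
    \int[leb]_(t in `]0%R, +oo[)
      (((t `^ (p^-1 - p1^-1))%:E *
        (\int[leb]_(s in `[t, +oo[) phi s `^ p1) `^ p1^-1) `^ r * (t^-1)%:E) <=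
    C%:E * lorentz_int p r phi.
Proof.
move=> pp pp1 r0.
have p10 : (0 < p1)%R by exact: lt_trans pp1.
pose e : R := (r * (p^-1 - p1^-1) / 2)%R.
pose c : R := ((p1 / p - 1) / 2)%R.
have e0 : (0 < e)%R.
  by rewrite divr_gt0// mulr_gt0// subr_gt0 ltf_pV2 ?posrE.
have c0 : (0 < c)%R by rewrite divr_gt0// subr_gt0 ltr_pdivlMr// mul1r.
pose K : R := (2 `^ (r / p) * 2)%R.
have K0 : (0 < K)%R by rewrite !mulr_gt0// powR_gt0.
pose C : R := ((K `^ r^-1 * c^-1 `^ p1^-1) `^ r)%R.
have C0 : (0 < C)%R by rewrite powR_gt0// mulr_gt0// powR_gt0// invr_gt0.
exists (C * (2 `^ e / e))%R; first by rewrite mulr_gt0// divr_gt0// powR_gt0.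
move=> phi phi0 phih.
pose psi t := ((t `^ p^-1)%:E * phi t) `^ r * (t^-1)%:E.
have psi0 t : (0 < t)%R -> 0 <= psi t by exact: lorentz_integrand_ge0.
have mpsi : measurable_fun (`]0%R, +oo[%classic : set R) psi.
  by apply: measurable_lorentz_integrand; exact: nonincreasing_emeasurable.
(* Only positive s contribute, so that J is nonincreasing on the whole line. *)
pose J t := \int[leb]_(s in `](Num.max 0 (t / 2))%R, +oo[)
  ((s `^ (- e))%:E * psi s).
have psie0 s : (0 < s)%R -> 0 <= (s `^ (- e))%:E * psi s.
  by move=> s0; rewrite mule_ge0 ?psi0// lee_fin powR_ge0.
have J0 t : 0 <= J t.
  apply: integral_ge0 => s /=; rewrite in_itv/= andbT gt_max => /andP[s0 _].
  exact: psie0.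
rewrite EFinM -muleA.
apply: (@le_trans _ _ (C%:E * \int[leb]_(t in `]0%R, +oo[)
    ((t `^ (e - 1))%:E * J t))); last first.
  rewrite lee_pmul2l ?lte_fin//.
  apply: (le_trans _ (hardy_kernel_high e0 mpsi psi0)).
  apply: le_integral_nonneg => // t /=; rewrite in_itv/= andbT => t0.
    rewrite /J max_r ?lexx ?andbT; last by rewrite ltW// divr_gt0.
    rewrite mule_ge0 ?lee_fin ?powR_ge0// integral_ge0// => s/=.
    by rewrite in_itv/= andbT => /(lt_trans _) s0; rewrite psie0// s0// divr_gt0.
  rewrite mule_ge0 ?lee_fin ?powR_ge0// integral_ge0// => s/=.
  by rewrite in_itv/= andbT => /(lt_trans _) s0; rewrite psie0// s0// divr_gt0.
have mJ : measurable_fun setT J.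
  apply: nonincreasing_emeasurable => t u tu.
  apply: le_integral_nonneg => s /=; rewrite !in_itv/= !andbT !gt_max.
  - move=> /andP[-> us]; rewrite (le_lt_trans _ us)// ler_pM2r// invr_gt0//.
  - by move=> /andP[s0 _]; rewrite psie0 ?lexx.
  - by move=> /andP[s0 _]; rewrite psie0.
rewrite -ge0_integralZl//; last 3 first.
- apply: emeasurable_funM; last exact: measurable_funTS.
  by apply/measurable_EFinP/measurable_funTS; exact: measurable_powR.
- by move=> t _; rewrite mule_ge0// lee_fin powR_ge0.
- by rewrite lee_fin ltW.
apply: le_integral_nonneg => // t /=; rewrite in_itv/= andbT => t0; last first.
  by rewrite !mule_ge0// lee_fin ?powR_ge0// ltW.
apply/andP; split.
  by rewrite mule_ge0 ?poweR_ge0// lee_fin invr_ge0 ltW.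
(* For $u$ in $(s/2, s)$ one has $(s/u)^e \ge 1$; since $s \ge t$ this interval only reaches down to
   $t/2$, which is why [J] starts there. *)
have phiB s : `[t, +oo[%classic s ->
    phi s <= (K `^ r^-1 * s `^ (- p^-1 + e / r))%:E * (J t) `^ r^-1.
  rewrite /= in_itv/= andbT => st; have s0 : (0 < s)%R by exact: lt_le_trans st.
  have := @poweR_split s p^-1 r (K * s `^ e)%R (phi s) (J t) s0 r0.
  rewrite mulr_ge0 ?powR_ge0 ?(ltW K0)// => /(_ isT (phi0 s) (J0 t)) H.
  have {H} := H _.
  rewrite powRM ?powR_ge0 ?(ltW K0)// -powRrM mulrCA -powRD; last first.
    by apply/implyP => _; rewrite gt_eqF.
  apply.
  apply: (le_trans (lorentz_base_le_dyadic phi0 phih pp r0 s0)).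
  rewrite /K [in leRHS]EFinM -[leRHS]muleA.
  have s20 : (0 < s / 2)%R by rewrite divr_gt0.
  apply: lee_pmul => //.
    by apply: integral_ge0 => u/=; rewrite in_itv/= => /andP[su _];
      apply: psi0; apply: lt_trans su.
  rewrite -ge0_integralZl//; last 3 first.
  - apply: measurable_funS (emeasurable_funM _ mpsi) => //; last first.
      by apply/measurable_EFinP/measurable_funTS; exact: measurable_powR.
    by move=> u /=; rewrite !in_itv/= !andbT gt_max => /andP[->].
  - move=> u /=; rewrite in_itv/= andbT gt_max => /andP[u0 _].
    exact: psie0.
  - by rewrite lee_fin powR_ge0.
  apply: le_integral_nonneg => u /=; rewrite !in_itv/= ?andbT ?gt_max.
  - move=> /andP[su us]; rewrite (lt_trans s20 su)/= (le_lt_trans _ su)//.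
    by rewrite ler_pM2r// invr_gt0.
  - move=> /andP[su us]; have u0 : (0 < u)%R by exact: lt_trans su.
    rewrite [X in X && _]psi0//= muleA -EFinM -[leLHS]mul1e.
    apply: lee_pmul => //; first exact: psi0.
    rewrite lee_fin powRN ler_pdivlMr ?powR_gt0//.
    by rewrite mul1r ge0_ler_powR ?nnegrE ?(ltW e0) ?(ltW s0) ?(ltW u0) ?(ltW us).
  - by move=> /andP[u0 _]; apply: mule_ge0; [rewrite lee_fin powR_ge0|exact: psie0].
have t0' s : `[t, +oo[%classic s -> (0 < s)%R.
  by rewrite /= in_itv/= andbT; exact: lt_le_trans.
have vt : \int[leb]_(s in `[t, +oo[) (s `^ ((- p^-1 + e / r) * p1))%:E <=
    (t `^ (- c) / c)%:E.
  rewrite (_ : (- p^-1 + e / r) * p1 = - c - 1)%R; last first.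
    by rewrite /e /c; field; rewrite !gt_eqF.
  exact: integral_powR_ty.
have H := integral_poweR_bound (measurable_itv _) t0' phi0 (powR_ge0 K r^-1) p10
  (poweR_ge0 (J t) r^-1) phiB vt.
rewrite [leLHS]muleC (_ : (t `^ (e - 1))%:E = (t^-1)%:E * (t `^ e)%:E); last first.
  rewrite -EFinM -[(t^-1)%R]powR_inv1 ?ltW// -powRD; last by apply/implyP => _; rewrite gt_eqF.
  by rewrite addrC.
rewrite -[((t^-1)%:E * _ * J t)]muleA [leRHS]muleCA; apply: lee_pmul => //.
- by rewrite lee_fin invr_ge0 ltW.
- exact: poweR_ge0.
apply: (@le_trans _ _ (((t `^ (p^-1 - p1^-1))%:E *
    ((K `^ r^-1 * (t `^ (- c) / c) `^ p1^-1)%:E * J t `^ r^-1)) `^ r)).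
  apply: lee_poweR; first exact: ltW.
    by rewrite mule_ge0 ?poweR_ge0// lee_fin powR_ge0.
  by apply: lee_pmul => //; rewrite ?poweR_ge0 ?lee_fin ?powR_ge0.
rewrite [X in X `^ r]muleA poweRM ?poweR_ge0//; last first.
  by rewrite -EFinM lee_fin !mulr_ge0 ?powR_ge0.
rewrite poweRVK ?gt_eqF// [leRHS]muleA; apply: lee_pmul => //; first exact: poweR_ge0.
rewrite -EFinM poweR_EFin -EFinM lee_fin /C.
have -> : ((t `^ (- c) / c) `^ p1^-1 = t `^ (- c / p1) * c^-1 `^ p1^-1)%R.
  by rewrite powRM ?powR_ge0 ?invr_ge0 ?(ltW c0)// -powRrM.
have -> : (t `^ (p^-1 - p1^-1) * (K `^ r^-1 * (t `^ (- c / p1) * c^-1 `^ p1^-1)) =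
  (K `^ r^-1 * c^-1 `^ p1^-1) * t `^ (e / r))%R.
  have -> : (t `^ (e / r) = t `^ (p^-1 - p1^-1) * t `^ (- c / p1))%R.
    rewrite -powRD; last by apply/implyP => _; rewrite gt_eqF.
    by congr (_ `^ _)%R; rewrite /e /c; field; rewrite !gt_eqF.
  by ring.
rewrite powRM ?mulr_ge0 ?powR_ge0// -[(t `^ _ `^ _)%R]powRrM.
by rewrite divfK ?gt_eqF.
Qed.

End hardy_lorentz.

(** * Lebesgue measure of boxes and cubes; a countable family of cubes *)

HB.instance Definition _ (R : realType) (d : nat) :=
  Measure_isSigmaFinite.Build _ _ _ (@lebesgue R d)
    (completed_measure_extension_sigma_finite
       (sigma_finiteT (borel_lebesgue R d))).

Section boxes.
Local Open Scope ereal_scope.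
Context {R : realType}.

Definition box d (A : 'I_d -> set R) : set (d.-tuple (measurableTypeR R)) :=
  [set x | forall i, A i (tnth x i)].

Lemma measurable_box d (A : 'I_d -> set R) : (forall i, measurable (A i)) ->
  measurable (box A).
Proof.
move=> mA; rewrite (_ : box A = \bigcap_(i in [set: 'I_d])
    ((fun x : d.-tuple (measurableTypeR R) => tnth x i) @^-1` A i)).
  apply: fin_bigcap_measurable => // i _; rewrite -[X in measurable X]setTI.
  by apply: measurable_tnth => //; exact: mA.
by apply/seteqP; split => [x xA i _|x xA i]; exact: xA.
Qed.

Lemma borel_lebesgue_box d (A : 'I_d -> set R) : (forall i, measurable (A i)) ->
  borel_lebesgue R d (box A) = \prod_(i < d) lebesgue_measure (A i).
Proof.
elim: d A => [|d IH] A mA.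
  by rewrite big_ord0 /= diracE mem_set//= => -[].
rewrite big_ord_recl -IH// /= /borel_lebesgue_step /pushforward.
rewrite -product_measure1E; [|exact: mA|exact: measurable_box].
congr ((_ \x _)%E _); apply/seteqP; split => -[x y] /=.
  move=> h; split; first by have := h ord0; rewrite tnth0.
  by move=> i; have := h (lift ord0 i); rewrite tnthS.
move=> [/= Ax Ay] i; case: (unliftP ord0 i) => [j ->|->]; first by rewrite tnthS.
by rewrite tnth0.
Qed.

Lemma measurable_Rd d (A : set (d.-tuple (measurableTypeR R))) : measurable A ->
  measurable (A : set (Rd R d)).
Proof. exact: caratheodory_measurable_mu_ext. Qed.

Lemma lebesgueE d (A : set (d.-tuple (measurableTypeR R))) : measurable A ->
  lebesgue (A : set (Rd R d)) = borel_lebesgue R d A.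
Proof. exact: measurable_mu_extE. Qed.


(** Half-open cubes split into disjoint halves in each coordinate, as dyadic arguments require; they
    differ from closed cubes by a null set. *)
Definition hcube d (c : Rd R d) (l : R) : set (Rd R d) :=
  [set x | forall i, (tnth c i <= tnth x i < tnth c i + l)%R].

Lemma measurable_borel_cube d (c : Rd R d) l :
  measurable (cube c l : set (d.-tuple (measurableTypeR R))).
Proof.
rewrite (_ : cube c l = box (fun i => `[tnth c i, (tnth c i + l)%R]%classic)).
  by apply: measurable_box => i; exact: measurable_itv.
by apply/seteqP; split => x h i; have := h i; rewrite /= in_itv.
Qed.

Lemma measurable_borel_hcube d (c : Rd R d) l :
  measurable (hcube c l : set (d.-tuple (measurableTypeR R))).
Proof.
rewrite (_ : hcube c l = box (fun i => `[tnth c i, (tnth c i + l)%R[%classic)).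
  by apply: measurable_box => i; exact: measurable_itv.
by apply/seteqP; split => x h i; have := h i; rewrite /= in_itv.
Qed.

Lemma measurable_cube d (c : Rd R d) l : measurable (cube c l).
Proof. by apply: measurable_Rd; exact: measurable_borel_cube. Qed.

Lemma measurable_hcube d (c : Rd R d) l : measurable (hcube c l).
Proof. by apply: measurable_Rd; exact: measurable_borel_hcube. Qed.

Lemma lebesgue_cube d (c : Rd R d) l : (0 < l)%R ->
  lebesgue (cube c l) = (l ^+ d)%:E.
Proof.
move=> l0; rewrite lebesgueE; last exact: measurable_borel_cube.
rewrite (_ : cube c l = box (fun i => `[tnth c i, (tnth c i + l)%R]%classic)).
  rewrite borel_lebesgue_box; last by move=> i; exact: measurable_itv.
  rewrite (eq_bigr (fun=> l%:E)).
    by rewrite prodEFin prodr_const card_ord.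
  move=> i _; rewrite [LHS]lebesgue_measure_itv/= lte_fin ltrDl l0 -EFinB.
  by rewrite addrAC subrr add0r.
by apply/seteqP; split => x h i; have := h i; rewrite /= in_itv.
Qed.

Lemma lebesgue_hcube d (c : Rd R d) l : (0 < l)%R ->
  lebesgue (hcube c l) = (l ^+ d)%:E.
Proof.
move=> l0; rewrite lebesgueE; last exact: measurable_borel_hcube.
rewrite (_ : hcube c l = box (fun i => `[tnth c i, (tnth c i + l)%R[%classic)).
  rewrite borel_lebesgue_box; last by move=> i; exact: measurable_itv.
  rewrite (eq_bigr (fun=> l%:E)).
    by rewrite prodEFin prodr_const card_ord.
  move=> i _; rewrite [LHS]lebesgue_measure_itv/= lte_fin ltrDl l0 -EFinB.
  by rewrite addrAC subrr add0r.
by apply/seteqP; split => x h i; have := h i; rewrite /= in_itv.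
Qed.

Lemma hcube_subset_cube d (c : Rd R d) l : hcube c l `<=` cube c l.
Proof. by move=> x h i; have /andP[-> /ltW] := h i. Qed.

Lemma cube_subset_hcube d (c : Rd R d) l k : (l < k)%R -> cube c l `<=` hcube c k.
Proof.
by move=> lk x h i; have /andP[-> xl]/= := h i; rewrite (le_lt_trans xl)// ltrD2l.
Qed.

(* A countable family of cubes which approximates all cubes from outside. *)
Definition rat_cube_data d (n : nat) : d.-tuple rat * rat :=
  odflt ([tuple of nseq d 0%R], 1%R) (@unpickle (d.-tuple rat * rat)%type n).

(** A nonpositive decoded side is replaced by 1, so that every index names a genuine cube. *)
Definition rat_side d n : R := 
  let l : R := ratr (rat_cube_data d n).2 in if (0 < l)%R then l else 1%R.

Definition rat_corner d n : Rd R d :=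
  [tuple of map (fun x : rat => ratr x : R) (rat_cube_data d n).1].

Definition rat_cube d n : set (Rd R d) := cube (rat_corner d n) (rat_side d n).

Lemma rat_side_gt0 d n : (0 < rat_side d n)%R.
Proof. by rewrite /rat_side; case: ifP. Qed.

Lemma is_cube_rat_cube d n : is_cube (@rat_cube d n).
Proof. by exists (rat_corner d n), (rat_side d n); split => //; exact: rat_side_gt0. Qed.

(** The corner is lowered by less than $e/2$ in each coordinate and the side enlarged by more than
    $e/2$ but less than $e$, both to rational values. *)
Lemma rat_cube_approx d (c : Rd R d) (l e : R) : (0 < l)%R -> (0 < e)%R ->
  exists2 n, cube c l `<=` rat_cube n & (rat_side d n <= l + e)%R.
Proof.
move=> l0 e0.
have e20 : (0 < e / 2)%R by rewrite divr_gt0.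
have [l' /andP[ll' l'e]] : exists q : rat, (l + e / 2 < ratr q < l + e)%R.
  have : (l + e / 2 < l + e)%R by rewrite ltrD2l ltr_pdivrMr// ltr_pMr// ltr1n.
  by move=> /rat_in_itvoo[q]; rewrite in_itv/= => ?; exists q.
have /choice[c' c'P] (i : 'I_d) : exists q : rat,
    (tnth c i - e / 2 < ratr q < tnth c i)%R.
  have : (tnth c i - e / 2 < tnth c i)%R by rewrite gtrBl.
  by move=> /rat_in_itvoo[q]; rewrite in_itv/= => ?; exists q.
exists (pickle ([tuple c' i | i < d], l')).
  have l'0 : (0 < ratr l' :> R)%R by rewrite (lt_trans _ ll')// addr_gt0.
  move=> x cx i; rewrite /rat_corner /rat_side /rat_cube_data pickleK/= l'0.
  rewrite tnth_map tnth_mktuple; have /andP[c1 c2] := c'P i.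
  by have /andP[x1 x2] := cx i; apply/andP; split; lra.
rewrite /rat_side /rat_cube_data pickleK/= (lt_trans _ ll') ?addr_gt0//.
exact: ltW.
Qed.

End boxes.

(** * Maximal operators of doubling measures over countably many cubes *)

Section sigma_finite_rearr.
Local Open Scope ereal_scope.
Context d (T : measurableType d) (R : realType).
Variable m : {measure set T -> \bar R}.
Hypothesis sf : sigma_finite setT m.

(** Weighted measures have sigma-finiteness as a proved fact, not as a structure, so the structure
    is packed on the spot to apply [integral_rearr]. *)
Lemma sigma_finite_integral_rearr (f : T -> \bar R) (a : R) :
  measurable_fun setT f -> (0 < a)%R ->
  \int[m]_x `|f x| `^ a =
  \int[lebesgue_measure]_(t in `]0%R, +oo[) rearr m f t `^ a.
Proof.
pose H1 := isSigmaFinite.Build _ _ _ _ sf.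
pose H2 := isSFinite.Build _ _ _ _ (sfinite_measure_sigma_finite sf).
pose m' := HB.pack_for (SigmaFiniteMeasure.type T R) (Measure.sort m) H1 H2.
exact: (@integral_rearr _ _ _ m').
Qed.

End sigma_finite_rearr.

Section countable_sup.
Local Open Scope ereal_scope.
Context d (T : measurableType d) (R : realType).
Implicit Types (a : nat -> \bar R) (Q : nat -> set T).

(** A supremum over the sets that contain [x], written with indicators so that measurability is
    immediate; the other sets contribute 0, harmless for nonnegative coefficients. *)
Definition csup a Q (x : T) : \bar R :=
  ereal_sup (range (fun n => a n * (\1_(Q n) x : R)%:E)).

Lemma le_csup a Q n x : Q n x -> a n <= csup a Q x.
Proof.
move=> Qx; apply: ereal_sup_ubound; exists n => //.
by rewrite indicE mem_set// mule1.
Qed.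

Lemma csup_le a Q x y : 0 <= y -> (forall n, Q n x -> a n <= y) ->
  csup a Q x <= y.
Proof.
move=> y0 H; apply: ge_ereal_sup => _ [n _ <-]; rewrite indicE.
by case: (pselect (Q n x)) => Qx; [rewrite mem_set// mule1 H|rewrite memNset// mule0].
Qed.

Lemma csup_ge0 a Q x : (forall n, 0 <= a n) -> 0 <= csup a Q x.
Proof.
move=> a0; apply: (@le_trans _ _ (a 0%N * (\1_(Q 0%N) x : R)%:E)).
  by rewrite mule_ge0// lee_fin.
by apply: ereal_sup_ubound; exists 0%N.
Qed.

Lemma measurable_csup a Q : (forall n, measurable (Q n)) ->
  measurable_fun setT (csup a Q).
Proof.
move=> mQ.
have := @measurable_fun_esups _ T R setT (fun n x => a n * (\1_(Q n) x : R)%:E).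
move=> /(_ _ 0%N) H; apply: (eq_measurable_fun _ _ (H _)) => [x _|n].
  rewrite /esups/=; congr ereal_sup; apply/seteqP; split => y.
    by move=> [n _ <-]; exists n.
  by move=> [n _ <-]; exists n.
by apply: emeasurable_funM => //; apply/measurable_EFinP; exact: measurable_indic.
Qed.

Lemma csup_gtE a Q (y : \bar R) : 0 <= y ->
  [set x | y < csup a Q x] = \bigcup_(n in [set n | y < a n]) Q n.
Proof.
move=> y0; apply/seteqP; split => x /=.
  move=> /ereal_sup_gt[_ [n _ <-]]; rewrite indicE.
  case: (pselect (Q n x)) => Qx; last by rewrite memNset// mule0 ltNge y0.
  by rewrite mem_set// mule1 => ya; exists n.
by move=> [n /= ya Qx]; rewrite (lt_le_trans ya)// le_csup.
Qed.

End countable_sup.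

Lemma ex_seq_argmax (R : realDomainType) (I : eqType) (f : I -> R) (i : I) s :
  exists2 j, j \in i :: s & forall k, k \in i :: s -> f k <= f j.
Proof.
elim: s => [|i' s [j js jmax]].
  by exists i; rewrite ?inE// => k; rewrite inE => /eqP ->.
have [le|/ltW le] := leP (f i') (f j).
- exists j; first by move: js; rewrite !inE => /orP[->//|->]; rewrite !orbT.
  move=> k; rewrite !inE => /or3P[ki|/eqP ->//|ks]; apply: jmax; rewrite inE ?ki//.
  by rewrite ks orbT.
- exists i'; first by rewrite !inE eqxx orbT.
  move=> k; rewrite !inE => /or3P[ki|/eqP ->//|ks]; apply: le_trans le;
    apply: jmax; rewrite inE ?ki//.
  by rewrite ks orbT.
Qed.

Section vitali.
Local Open Scope ereal_scope.
Context {R : realType} {d : nat}.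
Notation T := (Rd R d).

Definition triple_corner (c : T) (l : R) : T := [tuple (tnth c i - l)%R | i < d].

Lemma cube_subset_triple (c c' : T) (l l' : R) : (l' <= l)%R ->
  cube c l `&` cube c' l' !=set0 -> cube c' l' `<=` cube (triple_corner c l) (3 * l).
Proof.
move=> ll' [y [yc yc']] x xc' i.
have /andP[y1 y2] := yc i; have /andP[y3 y4] := yc' i.
have /andP[x1 x2] := xc' i; rewrite tnth_mktuple.
by apply/andP; split; lra.
Qed.

Variables (nu : {measure set T -> \bar R}) (D : R).
Hypothesis D_gt0 : (0 < D)%R.
Hypothesis nu_double : forall c l, (0 < l)%R ->
  nu (cube (triple_corner c l) (3 * l)) <= D%:E * nu (cube c l).

Variables (c : nat -> T) (l : nat -> R).
Hypothesis l_gt0 : forall n, (0 < l n)%R.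
Notation Q n := (cube (c n) (l n)).

Variables (h : T -> \bar R) (y : R).
Hypotheses (mh : measurable_fun setT h) (h_ge0 : forall x, 0 <= h x)
  (y_ge0 : (0 <= y)%R).

Let mQ n : measurable (Q n). Proof. exact: measurable_cube. Qed.
Let mU (s : seq nat) : measurable (\big[setU/set0]_(n <- s) Q n).
Proof. by apply: bigsetU_measurable. Qed.

(* Greedy selection: a largest cube absorbs, after tripling, all the cubes which
   meet it. *)
Lemma vitali_weak_type (s : seq nat) :
  (forall n, n \in s -> y%:E * nu (Q n) <= \int[nu]_(x in Q n) h x) ->
  y%:E * nu (\big[setU/set0]_(n <- s) Q n) <=
  D%:E * \int[nu]_(x in \big[setU/set0]_(n <- s) Q n) h x.
Proof.
have [k sk] := ubnP (size s); elim: k => // k IH in s sk *.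
case: s => [|n0 s0] in sk *.
  by move=> _; rewrite big_nil measure0 mule0 mule_ge0// ?integral_ge0// lee_fin ltW.
set s := n0 :: s0 in sk * => sP.
have [n ns nmax] : exists2 n, n \in s & forall i, i \in s -> (l i <= l n)%R.
  exact: ex_seq_argmax.
pose s1 := [seq i <- s | `[< Q n `&` Q i = set0 >]].
have s1s i : i \in s1 -> i \in s by rewrite mem_filter => /andP[].
have s1P i : i \in s1 -> Q n `&` Q i = set0.
  by rewrite mem_filter => /andP[/asboolP].
(* The selected cube meets itself, at its corner, so it is removed and the list becomes strictly
   shorter. *)
have sizes1 : (size s1 < k)%N.
  apply: leq_trans (_ : size s <= k)%N => //.
  rewrite size_filter -(count_predC (fun i => `[< Q n `&` Q i = set0 >])).
  rewrite -[X in (X < _)%N]addn0 ltn_add2l -has_count; apply/hasP; exists n => //=.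
  apply/asboolPn; rewrite setIid => /seteqP[+ _] => /(_ (c n)); apply=> i.
  by rewrite lexx lerDl ltW.
have {}IH := IH s1 sizes1 (fun i is1 => sP i (s1s i is1)).
set U := \big[setU/set0]_(i <- s) Q i.
set U1 := \big[setU/set0]_(i <- s1) Q i in IH.
pose Q3 := cube (triple_corner (c n) (l n)) (3 * l n).
have mQ3 : measurable Q3 by exact: measurable_cube.
have UU1 : U `<=` Q3 `|` U1.
  rewrite /U /U1 -!bigcup_seq => x [i /= si Qx].
  case: (pselect (Q n `&` Q i = set0)) => [ni|/eqP/set0P ni].
    by right; exists i => //=; rewrite mem_filter si andbT; apply/asboolP.
  by left; apply: (cube_subset_triple (nmax _ si) ni).
have dU1 : [disjoint Q n & U1].
  apply/disj_setPS; rewrite /U1 -bigcup_seq => x [Qx [i /= is1 Qix]].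
  by have : (Q n `&` Q i) x by []; rewrite s1P.
have QU : Q n `|` U1 `<=` U.
  rewrite /U /U1 -!bigcup_seq => x [Qx|[i /= is1 Qx]]; first by exists n.
  by exists i => //=; exact: s1s.
apply: (@le_trans _ _ (D%:E * \int[nu]_(x in Q n `|` U1) h x)); last first.
  rewrite lee_pmul2l//; apply: ge0_subset_integral => //; try exact: mU.
  - exact: measurableU (mU _).
  - exact: measurable_funTS.
rewrite ge0_integral_setU//; last 2 first.
- exact: mU.
- exact: measurable_funTS.
rewrite ge0_muleDr ?integral_ge0//.
apply: (@le_trans _ _ (y%:E * nu (Q3 `|` U1))).
  apply: lee_pmul => //.
  by apply: le_measure; rewrite ?inE//; [exact: mU|exact: measurableU (mU _)].
apply: (@le_trans _ _ (y%:E * (nu Q3 + nu U1))).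
  apply: lee_pmul => //.
  by apply: measureU2 => //; exact: mU.
rewrite ge0_muleDr//; apply: leeD => //.
apply: (@le_trans _ _ (y%:E * (D%:E * nu (Q n)))).
  by apply: lee_pmul => //; exact: nu_double.
by rewrite muleCA lee_pmul2l//; exact: sP.
Qed.

End vitali.

Section doubling_maximal.
Local Open Scope ereal_scope.
Context {R : realType} {d : nat}.
Notation T := (Rd R d).
Notation leb := (@lebesgue_measure R).
Variables (nu : {measure set T -> \bar R}) (D : R).
Hypotheses (D_gt0 : (0 < D)%R)
  (nu_double : forall c l, (0 < l)%R ->
    nu (cube (triple_corner c l) (3 * l)) <= D%:E * nu (cube c l))
  (nu_gt0 : forall Q : set T, is_cube Q -> 0 < nu Q)
  (nu_fin : forall Q : set T, is_cube Q -> nu Q < +oo)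
  (nu_sf : sigma_finite setT nu).
Variables (c : nat -> T) (l : nat -> R).
Hypothesis l_gt0 : forall n, (0 < l n)%R.
Notation Q n := (cube (c n) (l n)).

Definition maxop (m : set T -> \bar R) (cs : nat -> T) (ls : nat -> R)
    (h : T -> \bar R) : T -> \bar R :=
  csup (fun n => (m (cube (cs n) (ls n)))^-1 *
                 \int[m]_(x in cube (cs n) (ls n)) h x)
       (fun n => cube (cs n) (ls n)).

Notation M := (maxop nu c l).

Let mQ n : measurable (Q n). Proof. exact: measurable_cube. Qed.
Let cQ n : is_cube (Q n). Proof. by exists (c n), (l n). Qed.

Let nuQ n : exists2 v : R, (0 < v)%R & nu (Q n) = v%:E.
Proof.
exists (fine (nu (Q n))).
  by apply: fine_gt0; rewrite nu_gt0//= nu_fin.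
by rewrite fineK// ge0_fin_numE// nu_fin.
Qed.

Lemma maxop_ge0 h x : (forall x, 0 <= h x) -> 0 <= M h x.
Proof.
by move=> h0; apply: csup_ge0 => n; rewrite mule_ge0 ?integral_ge0// inve_ge0.
Qed.

Lemma measurable_maxop h : measurable_fun setT (M h).
Proof. exact: measurable_csup. Qed.

(** The superlevel set is a countable union of cubes on which [h] has average above [y];
    [vitali_weak_type] treats its finite subunions and continuity from below the limit. *)
Lemma maxop_weak_type h (y : R) : measurable_fun setT h ->
  (forall x, 0 <= h x) -> (0 <= y)%R ->
  y%:E * nu [set x | y%:E < M h x] <= D%:E * \int[nu]_x h x.
Proof.
move=> mh h0 y0'; have [->|yn0] := eqVneq y 0%R.
  by rewrite mul0e mule_ge0 ?integral_ge0// lee_fin ltW.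
have y0 : (0 < y)%R by rewrite lt_neqAle eq_sym yn0.
rewrite /maxop csup_gtE ?lee_fin//.
set S := [set n | _].
pose F N := \big[setU/set0]_(n <- [seq n <- iota 0 N | `[< S n >]]) Q n.
have FE N : F N = \bigcup_(n in [set n | (n < N)%N /\ S n]) Q n.
  rewrite /F -bigcup_seq; congr bigcup; apply/seteqP; split => n /=.
    by rewrite mem_filter mem_iota add0n => /andP[/asboolP].
  by move=> [nN Sn]; rewrite mem_filter mem_iota add0n/= nN andbT; apply/asboolP.
have mF N : measurable (F N) by apply: bigsetU_measurable.
have -> : \bigcup_(n in S) Q n = \bigcup_N F N.
  apply/seteqP; split => x.
    by move=> [n Sn Qx]; exists n.+1 => //; rewrite FE; exists n => //=.
  by move=> [N _]; rewrite FE => -[n /= [_ Sn] Qx]; exists n.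
have cF : nu (F N) @[N --> \oo] --> nu (\bigcup_N F N).
  apply: nondecreasing_cvg_mu => //; first exact: bigcup_measurable.
  move=> i j ij; apply/subsetPset; rewrite !FE; apply: bigcup_subset => n /= [ni Sn].
  by split=> //; exact: leq_trans ij.
rewrite -lee_pdivlMl// -(cvg_lim _ cF)//; apply: lime_le; first exact: cvgP cF.
apply: nearW => N; rewrite lee_pdivlMl//.
apply: (@le_trans _ _ (D%:E * \int[nu]_(x in F N) h x)); last first.
  by rewrite lee_pmul2l// ge0_subset_integral.
apply: vitali_weak_type => //.
move=> n; rewrite mem_filter => /andP[/asboolP Sn _].
have [v v0 vE] := nuQ n; move: Sn; rewrite /S/= vE inver gt_eqF// => /ltW.
by rewrite lee_pdivlMl// muleC.
Qed.

(** Cut [h] at the height $H = h^*(t)$. The part [h1] above $H$ lives on a set of measure at most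
    $t$, hence has integral at most $\int_0^t h^*$ and obeys the weak type bound; the rest adds at
    most $H$ to the maximal function. *)
Lemma rearr_maxop h t : measurable_fun setT h -> (forall x, 0 <= h x) ->
  (0 < t)%R ->
  rearr nu (M h) t <=
  (D / t)%:E * \int[leb]_(s in `]0%R, t[) rearr nu h s + rearr nu h t.
Proof.
move=> mh h0 t0.
set N := \int[leb]_(s in _) _.
have N0 : 0 <= N by apply: integral_ge0 => s _; exact: rearr_ge0.
have := rearr_ge0 nu h t; case Ht : (rearr nu h t) => [H| |//]; last first.
  by rewrite addey ?leey// gt_eqF// (lt_le_trans (ltNyr 0%R))// mule_ge0// lee_fin divr_ge0 ?ltW.
rewrite lee_fin => H0.
case NE : N N0 => [n| |//] n0; last first.
  by rewrite mulry gtr0_sg ?divr_gt0// mul1e addye ?leey.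
pose h1 := h \_ [set x | H%:E < `|h x|].
have mA : measurable [set x | H%:E < `|h x|] by exact: measurable_superlevel.
have mh1 : measurable_fun setT h1.
  by apply/(measurable_restrictT _ _).1 => //; exact: measurable_funTS.
have h10 x : 0 <= h1 x by exact: erestrict_ge0.
have int_h1 : \int[nu]_x h1 x <= N.
  have -> : \int[nu]_x h1 x = \int[nu]_x `|h1 x| `^ 1.
    by apply: eq_integral => x _; rewrite poweRe1 ?gee0_abs.
  rewrite sigma_finite_integral_rearr//.
  have nt : nu [set x | H%:E < `|h x|] <= t%:E by rewrite -rearr_le// Ht.
  have h1_le s : rearr nu h1 s <= rearr nu h s.
    apply: le_rearr => // x; rewrite /h1 patchE.
    by case: ifP => // _; rewrite abse0.
  have h1_eq0 s : (t <= s)%R -> rearr nu h1 s = 0.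
    move=> ts; apply/eqP; rewrite eq_le rearr_ge0 andbT rearr_le//.
    rewrite (@le_trans _ _ t%:E) ?lee_fin// (le_trans _ nt)//.
    apply: le_measure; rewrite ?inE//; first exact: measurable_superlevel.
    by move=> x /=; rewrite /h1 patchE; case: ifPn => [/set_mem//|_]; rewrite abse0 ltxx.
  rewrite /N integral_mkcond [leRHS]integral_mkcond.
  apply: le_integral_nonneg => // s _; rewrite !patchE; last first.
    by case: ifP => // _; exact: rearr_ge0.
  case: ifPn => [/set_mem/=|_]; last by case: ifP => _; rewrite lexx ?rearr_ge0.
  rewrite in_itv/= andbT => s0; rewrite poweRe1 ?rearr_ge0//.
  case: ifPn => [_|]; first by rewrite h1_le.
  rewrite notin_setE/= in_itv/= s0/= => /negP; rewrite -leNgt => ts.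
  by rewrite h1_eq0 ?lexx.
have h_le x : M h x <= M h1 x + H%:E.
  apply: csup_le => [|k Qx].
    by rewrite adde_ge0// ?lee_fin// maxop_ge0.
  apply: (@le_trans _ _ ((nu (Q k))^-1 * \int[nu]_(x in Q k) (h1 x + H%:E))).
    apply: lee_pmul => //; rewrite ?inve_ge0 ?integral_ge0//.
    apply: le_integral_nonneg => // z _; last by rewrite adde_ge0.
    rewrite h0/= /h1 patchE; case: ifPn => [_|]; first by rewrite leeDl.
    by rewrite notin_setE/= => /negP; rewrite -leNgt gee0_abs// add0e.
  rewrite ge0_integralD//; last exact: measurable_funTS.
  rewrite integral_cst// ge0_muleDr ?integral_ge0 ?mule_ge0//.
  rewrite leeD//; first by apply: (@le_csup _ _ _ (fun n => (nu (Q n))^-1 * _) _ k).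
  have [v v0 ->] := nuQ k.
  by rewrite inver gt_eqF// -!EFinM lee_fin mulrCA mulVf ?gt_eqF// mulr1.
rewrite NE in int_h1; rewrite lee_fin in n0.
(* The margin [e] makes the level [y] positive even when the integral vanishes, so that one can
   divide by it. *)
rewrite -EFinM -EFinD; apply/lee_addgt0Pr => e e0.
rewrite -EFinD rearr_le//; last 2 first.
- exact: measurable_maxop.
- by rewrite !addr_ge0 ?mulr_ge0 ?invr_ge0 ?(ltW D_gt0) ?(ltW t0) ?(ltW e0).
set y := (D / t * n + e)%R.
have y0 : (0 < y)%R by rewrite ltr_wpDl// !mulr_ge0 ?invr_ge0 ?(ltW D_gt0) ?(ltW t0).
apply: (@le_trans _ _ (nu [set x | y%:E < M h1 x])).
  apply: le_measure; rewrite ?inE.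
  - by apply: measurable_superlevel; exact: measurable_maxop.
  - rewrite -[X in measurable X]setTI; apply: emeasurable_fun_o_infty => //.
    exact: measurable_maxop.
  - move=> x /=; rewrite gee0_abs ?maxop_ge0// => yx.
    rewrite -(@lteD2rE _ H%:E)// (lt_le_trans _ (h_le x))// -EFinD.
    by rewrite /y addrAC.
rewrite -(@lee_pmul2l _ y%:E)// (le_trans (maxop_weak_type mh1 h10 (ltW y0)))//.
apply: (@le_trans _ _ (D%:E * n%:E)).
  by rewrite lee_pmul2l.
rewrite -!EFinM lee_fin /y mulrDl mulrAC divfK ?gt_eqF//.
by rewrite lerDl mulr_ge0 ?(ltW e0) ?(ltW t0).
Qed.

(** [rearr_maxop] followed by [hardy_low] with inner exponent 1 and $r = p$, for which the Lorentz
    integral is the integral of $\phi^p$. *)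
Lemma maxop_strong_type (p : R) : (1 < p)%R ->
  exists2 C : R, (0 < C)%R & forall h, measurable_fun setT h ->
    (forall x, 0 <= h x) ->
    \int[nu]_x M h x `^ p <= C%:E * \int[nu]_x h x `^ p.
Proof.
move=> p1; have p0 : (0 < p)%R by exact: lt_trans p1.
have [C C0 HC] := @hardy_low R p 1 p ltr01 p1 p0.
pose K : R := (2 `^ p * (D `^ p * C + 1))%R.
exists K; first by rewrite mulr_gt0 ?powR_gt0// addr_gt0// mulr_gt0// powR_gt0.
move=> h mh h0.
have M0 x : 0 <= M h x by exact: maxop_ge0.
have -> : \int[nu]_x M h x `^ p = \int[nu]_x `|M h x| `^ p.
  by apply: eq_integral => x _; rewrite gee0_abs.
have -> : \int[nu]_x h x `^ p = \int[nu]_x `|h x| `^ p.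
  by apply: eq_integral => x _; rewrite gee0_abs.
rewrite !sigma_finite_integral_rearr//; last exact: measurable_maxop.
set phi := rearr nu h.
have phi0 t : 0 <= phi t by exact: rearr_ge0.
have phih : {homo phi : s t / (s <= t)%R >-> t <= s} by exact: rearr_nonincreasing.
have mphi : measurable_fun setT phi by exact: measurable_rearr.
pose N t := \int[leb]_(s in `]0%R, t[) phi s.
have N0 t : 0 <= N t by exact: integral_ge0.
have mN : measurable_fun setT N.
  apply: nondecreasing_emeasurable => s t st; apply: le_integral_nonneg => // u.
    by rewrite /= !in_itv/= => /andP[-> /lt_le_trans->].
  by rewrite phi0 lexx.
have L : lorentz_int p p phi = \int[leb]_(t in `]0%R, +oo[) phi t `^ p.
  apply: eq_integral => t; rewrite inE/= in_itv/= andbT => t0.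
  rewrite poweRM ?lee_fin ?powR_ge0// poweR_EFin -powRrM mulVf ?gt_eqF//.
  by rewrite powRr1 ?ltW// muleAC -EFinM divff ?gt_eqF// mul1e.
have HN : \int[leb]_(t in `]0%R, +oo[) ((t^-1)%:E * N t) `^ p <=
    C%:E * \int[leb]_(t in `]0%R, +oo[) phi t `^ p.
  rewrite -L; apply: le_trans (HC phi phi0 phih).
  apply: le_integral_nonneg => // t /=; rewrite in_itv/= andbT => t0; last first.
    by rewrite mule_ge0 ?poweR_ge0// lee_fin invr_ge0 ltW.
  rewrite poweR_ge0/=.
  have -> : \int[leb]_(s in `]0%R, t[) phi s `^ 1 = N t.
    by apply: eq_integral => s _; rewrite poweRe1.
  rewrite invr1 poweRe1// !poweRM ?lee_fin ?powR_ge0 ?invr_ge0 ?(ltW t0)//.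
  rewrite muleAC; apply: lee_pmul => //; rewrite ?poweR_ge0//.
  rewrite !poweR_EFin -EFinM lee_fin -powRrM mulrBl mulVf ?gt_eqF// mul1r.
  rewrite -[(t^-1)%R]powR_inv1 ?(ltW t0)// -powRrM mulN1r -powRD.
    by rewrite addrAC subrr add0r.
  by apply/implyP => _; rewrite gt_eqF.
apply: (@le_trans _ _ (\int[leb]_(t in `]0%R, +oo[)
    ((2 `^ p * D `^ p)%:E * ((t^-1)%:E * N t) `^ p + (2 `^ p)%:E * phi t `^ p))).
  apply: le_integral_nonneg => // t /=; rewrite in_itv/= andbT => t0; last first.
    by rewrite adde_ge0// mule_ge0 ?poweR_ge0// lee_fin ?mulr_ge0 ?powR_ge0.
  rewrite poweR_ge0/=.
  have := lee_poweR (ltW p0) (rearr_ge0 _ _ _) (rearr_maxop mh h0 t0).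
  move=> /le_trans; apply; rewrite -/phi -/(N t).
  set x := (D / t)%:E * N t.
  have x0 : 0 <= x by rewrite mule_ge0// lee_fin divr_ge0 ?ltW.
  have -> : (2 `^ p * D `^ p)%:E * ((t^-1)%:E * N t) `^ p = (2 `^ p)%:E * x `^ p.
    rewrite EFinM -muleA; congr (_ * _); rewrite -poweR_EFin -poweRM ?lee_fin ?(ltW D_gt0)//.
      by rewrite muleA -EFinM.
    by rewrite mule_ge0// lee_fin invr_ge0 ltW.
  rewrite -ge0_muleDr ?poweR_ge0//.
  apply: (@le_trans _ _ ((2%:E * maxe x (phi t)) `^ p)).
    apply: lee_poweR; rewrite ?(ltW p0) ?adde_ge0//.
    rewrite mule_natl mule2n; apply: leeD; rewrite le_max lexx ?orbT//.
  rewrite poweRM ?lee_fin// ?le_max ?x0//; apply: lee_pmul => //; rewrite ?poweR_ge0//.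
  by case: (leP x (phi t)) => _; rewrite ?leeDl ?leeDr ?poweR_ge0.
have mP : measurable (`]0%R, +oo[%classic : set R) by exact: measurable_itv.
have mNt : measurable_fun (`]0%R, +oo[%classic : set R) (fun t => ((t^-1)%:E * N t) `^ p).
  apply: measurable_fun_poweR; apply: emeasurable_funM; last exact: measurable_funTS.
  by apply/measurable_EFinP; exact: measurable_inv_gt0.
have mphip : measurable_fun (`]0%R, +oo[%classic : set R) (fun t => phi t `^ p).
  by apply: measurable_fun_poweR; exact: measurable_funTS.
rewrite ge0_integralD//; last 4 first.
- by move=> t _; rewrite mule_ge0 ?poweR_ge0// lee_fin mulr_ge0 ?powR_ge0.
- exact: emeasurable_funM.
- by move=> t _; rewrite mule_ge0 ?poweR_ge0// lee_fin powR_ge0.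
- exact: emeasurable_funM.
rewrite !ge0_integralZl//; last 3 first.
- by move=> t _; exact: poweR_ge0.
- by move=> t _; exact: poweR_ge0.
- by rewrite lee_fin mulr_ge0 ?powR_ge0.
have K20 : 0 <= (2 `^ p * D `^ p)%:E by rewrite lee_fin mulr_ge0 ?powR_ge0.
rewrite /K mulrDr mulr1 EFinD ge0_muleDl ?lee_fin ?mulr_ge0 ?powR_ge0 ?addr_ge0 ?(ltW C0)//.
apply: leeD => //; rewrite mulrA [in leRHS]EFinM -[leRHS]muleA.
exact: (lee_wpmul2l K20 HN).
Qed.

End doubling_maximal.

(** * Hölder's inequality for nonnegative extended functions *)

Section ge0_hoelder.
Local Open Scope ereal_scope.
Context d (T : measurableType d) (R : realType).
Variable m : {measure set T -> \bar R}.

Let young (x y : \bar R) (p q : R) : 0 <= x -> 0 <= y ->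
  (0 < p)%R -> (0 < q)%R -> (p^-1 + q^-1 = 1)%R ->
  x * y <= (p^-1)%:E * x `^ p + (q^-1)%:E * y `^ q.
Proof.
move=> x0 y0 p0 q0 pq.
have ge0M r z : (0 < r)%R -> 0 <= (r^-1)%:E * z `^ r.
  by move=> r0; rewrite mule_ge0 ?poweR_ge0// lee_fin invr_ge0 ltW.
have My r : (0 < r)%R -> (r^-1)%:E * +oo `^ r = +oo.
  by move=> r0; rewrite poweRyr ?gt_eqF// mulry gtr0_sg ?invr_gt0// mul1e.
case: x x0 => [x| |//] x0; last first.
  rewrite My// addye ?leey// gt_eqF// (lt_le_trans (ltNyr 0%R))//.
  exact: ge0M.
case: y y0 => [y| |//] y0; last first.
  by rewrite My// addey ?leey// gt_eqF// (lt_le_trans (ltNyr 0%R))// ge0M.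
rewrite !poweR_EFin -!EFinM -EFinD lee_fin ![(_^-1 * _)%R]mulrC.
by apply: conjugate_powR.
Qed.

Let hoelder_eq0 D (f g : T -> \bar R) (p : R) : measurable D ->
  measurable_fun D f -> measurable_fun D g ->
  (forall x, D x -> 0 <= f x) -> (forall x, D x -> 0 <= g x) -> (0 < p)%R ->
  \int[m]_(x in D) f x `^ p = 0 -> \int[m]_(x in D) (f x * g x) = 0.
Proof.
move=> mD mf mg f0 g0 p0.
have -> : \int[m]_(x in D) f x `^ p = \int[m]_(x in D) `|f x `^ p|.
  by apply: eq_integral => x _; rewrite gee0_abs// poweR_ge0.
move=> h; have fp0 := (ae_eq_integral_abs m mD (measurable_fun_poweR p mf)).1 h.
rewrite (ge0_ae_eq_integral _ _ (measurable_cst 0))//.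
- by rewrite integral0.
- exact: emeasurable_funM.
- by move=> x Dx; rewrite mule_ge0 ?f0 ?g0.
- apply: filterS fp0.
  move=> x /= fx Dx; have /poweR_eq0_eq0 -> := fx Dx; first by rewrite mul0e.
  exact: f0.
Qed.

(** Young's inequality after normalising both factors; the cases where one of the two integrals is
    zero or infinite are settled beforehand. *)
Lemma ge0_hoelder D (f g : T -> \bar R) (p q : R) : measurable D ->
  measurable_fun D f -> measurable_fun D g ->
  (forall x, D x -> 0 <= f x) -> (forall x, D x -> 0 <= g x) ->
  (0 < p)%R -> (0 < q)%R -> (p^-1 + q^-1 = 1)%R ->
  \int[m]_(x in D) (f x * g x) <=
  (\int[m]_(x in D) f x `^ p) `^ p^-1 * (\int[m]_(x in D) g x `^ q) `^ q^-1.
Proof.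
move=> mD mf mg f0 g0 p0 q0 pq.
set A := \int[m]_(x in D) f x `^ p; set B := \int[m]_(x in D) g x `^ q.
have A0 : 0 <= A by apply: integral_ge0 => x _; exact: poweR_ge0.
have B0 : 0 <= B by apply: integral_ge0 => x _; exact: poweR_ge0.
have [AE|An0] := eqVneq A 0.
  by rewrite (hoelder_eq0 mD mf mg f0 g0 p0 AE) mule_ge0 ?poweR_ge0.
have [BE|Bn0] := eqVneq B 0.
  under eq_integral do rewrite muleC.
  by rewrite (hoelder_eq0 mD mg mf g0 f0 q0 BE) mule_ge0 ?poweR_ge0.
have Agt0 : 0 < A by rewrite lt_neqAle eq_sym An0.
have Bgt0 : 0 < B by rewrite lt_neqAle eq_sym Bn0.
case AE : A Agt0 A0 => [a| |//] a0 _; last first.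
  by rewrite poweRyr ?gt_eqF ?invr_gt0// gt0_mulye ?leey// poweR_gt0.
case BE : B Bgt0 B0 => [b| |//] b0 _; last first.
  by rewrite poweRyr ?gt_eqF ?invr_gt0// gt0_muley ?leey// poweR_gt0.
rewrite !lte_fin in a0 b0.
pose ap : R := (a `^ p^-1)%R; pose bq : R := (b `^ q^-1)%R.
have ap0 : (0 < ap)%R by exact: powR_gt0.
have bq0 : (0 < bq)%R by exact: powR_gt0.
rewrite !poweR_EFin -/ap -/bq -EFinM.
have pa0 : 0 <= (p^-1 / a : R)%:E.
  by rewrite lee_fin divr_ge0 ?invr_ge0 ?(ltW p0) ?(ltW a0).
have qb0 : 0 <= (q^-1 / b : R)%:E.
  by rewrite lee_fin divr_ge0 ?invr_ge0 ?(ltW q0) ?(ltW b0).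
have apbq0 : 0 <= (ap * bq : R)%:E.
  by rewrite lee_fin mulr_ge0 ?(ltW ap0) ?(ltW bq0).
apply: (@le_trans _ _ ((ap * bq : R)%:E * \int[m]_(x in D)
   ((p^-1 / a : R)%:E * f x `^ p + (q^-1 / b : R)%:E * g x `^ q))).
  rewrite -ge0_integralZl//; last 2 first.
  - apply: emeasurable_funD; apply: emeasurable_funM => //; exact: measurable_fun_poweR.
  - by move=> x _; rewrite adde_ge0// mule_ge0 ?poweR_ge0.
  have rhs0 x : D x -> 0 <= (ap * bq : R)%:E * ((p^-1 / a : R)%:E * f x `^ p + (q^-1 / b : R)%:E * g x `^ q).
    by move=> Dx; rewrite mule_ge0 ?adde_ge0 ?mule_ge0 ?poweR_ge0.
  apply: le_integral_nonneg => // x Dx.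
  rewrite mule_ge0 ?f0 ?g0//=.
  have -> : f x * g x = (ap * bq : R)%:E * (((ap^-1 : R)%:E * f x) * ((bq^-1 : R)%:E * g x)).
    have cK (k : R) z : (0 < k)%R -> k%:E * ((k^-1 : R)%:E * z) = z.
      by move=> k0; rewrite muleA -EFinM mulfV ?gt_eqF// mul1e.
    by rewrite EFinM [RHS]muleACA !cK.
  apply: lee_pmul => //.
  - by rewrite !mule_ge0 ?f0 ?g0// lee_fin invr_ge0 ltW.
  have fx0 : 0 <= (ap^-1 : R)%:E * f x by rewrite mule_ge0 ?f0// lee_fin invr_ge0 ltW.
  have gx0 : 0 <= (bq^-1 : R)%:E * g x by rewrite mule_ge0 ?g0// lee_fin invr_ge0 ltW.
  apply: (le_trans (young fx0 gx0 p0 q0 pq)).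
  rewrite !poweRM ?f0 ?g0 ?lee_fin ?invr_ge0 ?(ltW ap0) ?(ltW bq0)//.
  rewrite !muleA !poweR_EFin -!EFinM -!powRN -!powRrM !mulNr !mulVf ?gt_eqF//.
  rewrite !powR_inv1 ?(ltW a0) ?(ltW b0)//.
rewrite ge0_integralD//; last 4 first.
- by move=> x _; rewrite mule_ge0 ?poweR_ge0.
- by apply: emeasurable_funM => //; exact: measurable_fun_poweR.
- by move=> x _; rewrite mule_ge0 ?poweR_ge0.
- by apply: emeasurable_funM => //; exact: measurable_fun_poweR.
rewrite !ge0_integralZl//; last 4 first.
- exact: measurable_fun_poweR.
- by move=> x _; exact: poweR_ge0.
- exact: measurable_fun_poweR.
- by move=> x _; exact: poweR_ge0.
have E : (p^-1 / a * a + q^-1 / b * b)%R%:E = 1%R%:E :> \bar R.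
  by rewrite !divfK ?gt_eqF// pq.
by rewrite -/A -/B AE BE [X in _ * X](_ : _ = 1) ?mule1//; exact: E.
Qed.

End ge0_hoelder.

(** * Weight pairs: finiteness and doubling *)

Section weight_pair.
Local Open Scope ereal_scope.
Context {R : realType} {d : nat}.
Notation T := (Rd R d).
Notation mu := (@lebesgue R d).
Implicit Types (u sg : T -> R) (a b K : R) (E Q : set T).

(* Normalised form of the Muckenhoupt condition: for u = w^q, sg = w^-p',
   a = p' / (p' + q), b = q / (p' + q), it is a power of the A_{p,q} condition. *)
Definition weight_pair u sg a b K :=
  [/\ measurable_fun setT u, measurable_fun setT sg,
      (forall x, 0 < u x)%R, (forall x, 0 < sg x)%R &
      [/\ (0 < a)%R, (0 < b)%R, (a + b = 1)%R, (0 < K)%R &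
      (forall x, u x `^ a * sg x `^ b = 1)%R /\
      (forall Q, is_cube Q ->
        (\int[mu]_(x in Q) (u x)%:E) `^ a * (\int[mu]_(x in Q) (sg x)%:E) `^ b <=
        K%:E * mu Q)]].

Lemma weight_pairC u sg a b K : weight_pair u sg a b K -> weight_pair sg u b a K.
Proof.
move=> [mu_u mu_s u0 s0 [a0 b0 ab K0 [us H]]]; split => //; split => //.
  by rewrite addrC.
split=> [x|Q cQ]; first by rewrite mulrC us.
by rewrite muleC; exact: H.
Qed.

Lemma is_cube_lebesgue Q : is_cube Q ->
  exists l : R, [/\ (0 < l)%R, mu Q = (l ^+ d)%:E & measurable Q].
Proof.
move=> [c [l [l0 ->]]]; exists l; split=> //; first exact: lebesgue_cube.
exact: measurable_cube.
Qed.

Lemma is_cube_measurable Q : is_cube Q -> measurable Q.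
Proof. by move=> /is_cube_lebesgue[l []]. Qed.

Lemma is_cube_lebesgue_gt0 Q : is_cube Q -> 0 < mu Q.
Proof. by move=> /is_cube_lebesgue[l [l0 -> _]]; rewrite lte_fin exprn_gt0. Qed.

Lemma is_cube_lebesgue_lty Q : is_cube Q -> mu Q < +oo.
Proof. by move=> /is_cube_lebesgue[l [l0 -> _]]; rewrite ltry. Qed.

Lemma integral_pos_gt0 E u : measurable E -> measurable_fun setT u ->
  (forall x, 0 < u x)%R -> 0 < mu E -> 0 < \int[mu]_(x in E) (u x)%:E.
Proof.
move=> mE mu_u u0 E0.
have I0 : 0 <= \int[mu]_(x in E) (u x)%:E.
  by apply: integral_ge0 => x _; rewrite lee_fin ltW.
rewrite lt_neqAle I0 andbT eq_sym; apply/eqP => I0'.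
have : \int[mu]_(x in E) `|(u x)%:E| = 0.
  by rewrite -I0'; apply: eq_integral => x _; rewrite gee0_abs// lee_fin ltW.
have mE_u : measurable_fun E (EFin \o u) by exact/measurable_EFinP/measurable_funTS.
move=> /(ae_eq_integral_abs mu mE mE_u).1 [N [mN N0 sN]].
move: E0; rewrite ltNge -N0 => /negP; apply; apply: le_measure; rewrite ?inE//.
move=> x Ex; apply: sN => /= /(_ Ex) ux; have := u0 x.
by case: ux => ->; rewrite ltxx.
Qed.

Section consequences.
Variables (u sg : T -> R) (a b K : R).
Hypothesis usP : weight_pair u sg a b K.
Let U E := \int[mu]_(x in E) (u x)%:E.
Let S E := \int[mu]_(x in E) (sg x)%:E.

Let U0 E : 0 <= U E.
Proof. by case: usP => _ _ u0 _ _; apply: integral_ge0 => x _; rewrite lee_fin ltW. Qed.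
Let S0 E : 0 <= S E.
Proof. by case: usP => _ _ _ s0 _; apply: integral_ge0 => x _; rewrite lee_fin ltW. Qed.

Lemma weight_pair_gt0 Q : is_cube Q -> 0 < U Q.
Proof.
case: usP => mu_u _ u0 _ _ cQ; apply: integral_pos_gt0 => //.
  exact: is_cube_measurable.
exact: is_cube_lebesgue_gt0.
Qed.

(** The other weight has positive mass on the cube, so an infinite [U Q] would make the controlled
    product infinite. *)
Lemma weight_pair_lty Q : is_cube Q -> U Q < +oo.
Proof.
move=> cQ; case: (usP) => _ mu_s u0 s0 [a0 b0 ab K0 [_ H]].
have SQ0 : 0 < S Q.
  apply: integral_pos_gt0 => //; first exact: is_cube_measurable.
  exact: is_cube_lebesgue_gt0.
have := H _ cQ; rewrite -/(U Q) -/(S Q); case UE : (U Q) (U0 Q) => [x| |//] _.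
  by rewrite ltry.
rewrite poweRyr ?gt_eqF// gt0_mulye ?poweR_gt0// leye_eq.
by have [l [l0 -> _]] := is_cube_lebesgue cQ.
Qed.

(** Hölder with exponents $1/a$ and $1/b$ applied to the constant function $1 = u^a \sigma^b$. *)
Lemma weight_pair_hoelder E : measurable E -> mu E <= U E `^ a * S E `^ b.
Proof.
case: (usP) => mu_u mu_s u0 s0 [a0 b0 ab K0 [us _]] mE.
have := @ge0_hoelder _ T R mu E (fun x => (u x `^ a)%:E) (fun x => (sg x `^ b)%:E)
  a^-1 b^-1 mE.
rewrite !invrK !invr_gt0 => H.
have {}H := H _ _ _ _ a0 b0 ab.
rewrite -[leLHS]mul1e -integral_cst//.
have -> : \int[mu]_(x in E) cst 1 x =
    \int[mu]_(x in E) ((u x `^ a)%:E * (sg x `^ b)%:E).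
  by apply: eq_integral => x _; rewrite -EFinM us.
have -> : U E = \int[mu]_(x in E) ((u x `^ a)%:E) `^ a^-1.
  apply: eq_integral => x _; rewrite poweR_EFin -powRrM mulfV ?gt_eqF//.
  by rewrite powRr1// ltW.
have -> : S E = \int[mu]_(x in E) ((sg x `^ b)%:E) `^ b^-1.
  apply: eq_integral => x _; rewrite poweR_EFin -powRrM mulfV ?gt_eqF//.
  by rewrite powRr1// ltW.
apply: H.
- apply/measurable_EFinP/measurable_funTS.
  exact: (measurableT_comp (measurable_powR a) mu_u).
- apply/measurable_EFinP/measurable_funTS.
  exact: (measurableT_comp (measurable_powR b) mu_s).
- by move=> x _; rewrite lee_fin powR_ge0.
- by move=> x _; rewrite lee_fin powR_ge0.
Qed.

(** Hölder on [E] against the weight condition on [Q]: a subset with a fixed share of the volume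
    keeps a fixed share of the weighted mass. Both doubling and the reverse Hölder inequality start
    here. *)
Lemma weight_pair_subset E Q : is_cube Q -> measurable E -> E `<=` Q ->
  mu E * U Q `^ a <= K%:E * mu Q * U E `^ a.
Proof.
move=> cQ mE EQ; case: (usP) => mu_u mu_s u0 s0 [a0 b0 ab K0 [_ H]].
apply: (@le_trans _ _ (U E `^ a * S Q `^ b * U Q `^ a)).
  apply: lee_pmul => //; first exact: poweR_ge0.
  apply: (le_trans (weight_pair_hoelder mE)).
  apply: lee_pmul => //; rewrite ?poweR_ge0//.
  apply: lee_poweR => //; first exact: ltW.
  apply: ge0_subset_integral => //.
  - exact: is_cube_measurable.
  - exact/measurable_funTS/measurable_EFinP.
  - by move=> x _; rewrite lee_fin ltW.
rewrite -muleA [leRHS]muleC; apply: lee_pmul => //; rewrite ?mule_ge0 ?poweR_ge0//.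
by rewrite muleC; exact: H.
Qed.

Lemma weight_pair_double c l : (0 < l)%R ->
  U (cube (triple_corner c l) (3 * l)) <=
  ((K * 3 ^+ d) `^ a^-1)%:E * U (cube c l).
Proof.
move=> l0; case: (usP) => mu_u mu_s u0 s0 [a0 b0 ab K0 _].
set Q := cube c l; set Q3 := cube _ _.
have cQ3 : is_cube Q3.
  by exists (triple_corner c l), (3 * l)%R; rewrite mulr_gt0.
have QQ3 : Q `<=` Q3.
  apply: cube_subset_triple => //; exists c; split=> i;
    by rewrite lexx lerDl ltW.
have mQ : measurable Q by exact: measurable_cube.
have := weight_pair_subset cQ3 mQ QQ3.
rewrite /Q3 {1}/Q !lebesgue_cube// ?mulr_gt0// -/Q -/Q3 exprMn.
have ld0 : (0 < l ^+ d)%R by rewrite exprn_gt0.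
rewrite -EFinM (_ : K * (3 ^+ d * l ^+ d) = l ^+ d * (K * 3 ^+ d))%R; last by ring.
rewrite EFinM -muleA lee_pmul2l ?lte_fin// => H.
have := lee_poweR (r := a^-1) _ (poweR_ge0 _ _) H.
rewrite invr_ge0 (ltW a0) => /(_ isT).
rewrite poweRK ?gt_eqF// poweRM ?poweR_ge0 ?lee_fin ?mulr_ge0 ?exprn_ge0 ?(ltW K0)//.
by rewrite poweRK ?gt_eqF// poweR_EFin.
Qed.

End consequences.

Lemma density_cube_sigma_finite (u : T -> R) (mu_u : measurable_fun setT u)
    (u_ge0 : forall x, (0 <= u x)%R) :
  (forall Q, is_cube Q -> \int[mu]_(x in Q) (u x)%:E < +oo) ->
  sigma_finite setT (density mu mu_u u_ge0).
Proof.
move=> H; pose c n : T := [tuple of nseq d (- n.+1%:R)]%R.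
exists (fun n => cube (c n) (2 * n.+1%:R)); last first.
  move=> n; split; first exact: measurable_cube.
  by apply: H; exists (c n), (2 * n.+1%:R)%R.
apply/esym; rewrite -subTset => x _.
pose N := \max_(i < d) Num.truncn `|tnth x i|.
exists N => // i; rewrite /c tnth_nseq.
have xN : (`|tnth x i| <= N.+1%:R)%R.
  rewrite (le_trans (ltW (truncnS_gt _)))// ler_nat ltnS.
  exact: (@leq_bigmax _ (fun i => Num.truncn `|tnth x i|)).
move: xN; rewrite ler_norml => /andP[x1 x2].
by rewrite x1/= (le_trans x2)// mulr2n mulrDl mul1r; lra.
Qed.

End weight_pair.

(** * Strong type of the fractional maximal operator for a weight pair *)

Section off_diagonal.
Local Open Scope ereal_scope.
Context {R : realType} {d : nat}.
Notation T := (Rd R d).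
Notation mu := (@lebesgue R d).

(* With |Q| = m, u(Q) = v, sg(Q) = s, int_Q g dsg = I, int g^p dsg = G:
   Hoelder's inequality and the weight condition give the pointwise bound. *)
Let lerner_real (p q a b K m v s I G : R) :
  (1 < p)%R -> (p <= q)%R -> (0 < a)%R -> (0 < b)%R -> (a + b = 1)%R ->
  (a^-1 = 1 + q * (1 - p^-1))%R ->
  (0 < K)%R -> (0 < m)%R -> (0 < v)%R -> (0 < s)%R -> (0 <= I)%R -> (0 <= G)%R ->
  (v `^ a * s `^ b <= K * m)%R -> (I <= s `^ (1 - p^-1) * G `^ p^-1)%R ->
  ((m `^ (- (a^-1 / q)) * I) `^ q <=
    K `^ (a * b)^-1 * G `^ (q / p - 1) * (v^-1 * (m * (I / s) `^ (p * b))) `^ b^-1)%R.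
Proof.
move=> p1 pq a0 b0 ab aE K0 m0 v0 s0 I0 G0 vs IG.
have p0 : (0 < p)%R by exact: lt_trans p1.
have q0 : (0 < q)%R by exact: lt_le_trans pq.
have rhs0 : (0 <= K `^ (a * b)^-1 * G `^ (q / p - 1) *
    (v^-1 * (m * (I / s) `^ (p * b))) `^ b^-1)%R by rewrite !mulr_ge0 ?powR_ge0.
have [I0'|In0] := eqVneq I 0%R.
  by rewrite {1}I0' mulr0 powR0; [exact: rhs0|exact: lt0r_neq0].
have Igt0 : (0 < I)%R by rewrite lt_neqAle eq_sym In0.
have IE : (I `^ q = I `^ p * I `^ (q - p))%R.
  by rewrite -powRD ?subrKC//; apply/implyP => _; rewrite gt_eqF.
have IG' : (I `^ (q - p) <= s `^ ((1 - p^-1) * (q - p)) * G `^ (q / p - 1))%R.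
  have := @ge0_ler_powR R (q - p) _ I _ _ _ IG.
  rewrite subr_ge0 !nnegrE I0 mulr_ge0 ?powR_ge0// => /(_ pq isT isT).
  rewrite powRM ?powR_ge0// -!powRrM.
  by rewrite (_ : p^-1 * (q - p) = q / p - 1)%R//; field; rewrite gt_eqF.
rewrite powRM ?powR_ge0// -powRrM IE mulNr divfK ?gt_eqF//.
rewrite !powRM ?mulr_ge0 ?powR_ge0 ?invr_ge0 ?(ltW v0) ?(ltW m0) ?(ltW s0) ?divr_ge0//.
rewrite -!powRrM -[(v^-1)%R]powR_inv1 ?(ltW v0)// -[(s^-1)%R]powR_inv1 ?(ltW s0)//.
rewrite -!powRrM [(p * b / b)%R]mulfK ?gt_eqF//.
apply: (@le_trans _ _ (m `^ (- a^-1) *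
    (I `^ p * (s `^ ((1 - p^-1) * (q - p)) * G `^ (q / p - 1)))))%R.
  by rewrite ler_wpM2l ?powR_ge0// ler_wpM2l ?powR_ge0.
have vs' : (v `^ b^-1 * s `^ a^-1 <= K `^ (a * b)^-1 * m `^ (a * b)^-1)%R.
  have := @ge0_ler_powR R (a * b)^-1 _ _ _ _ _ vs.
  rewrite invr_ge0 !nnegrE !mulr_ge0 ?powR_ge0 ?(ltW a0) ?(ltW b0) ?(ltW K0) ?(ltW m0)//.
  move=> /(_ isT isT isT).
  rewrite !powRM ?powR_ge0 ?(ltW K0) ?(ltW m0)// -!powRrM.
  rewrite (_ : a * (a * b)^-1 = b^-1)%R; last by field; rewrite !gt_eqF.
  by rewrite (_ : b * (a * b)^-1 = a^-1)%R//; field; rewrite !gt_eqF.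
have -> : (K `^ (a * b)^-1 * G `^ (q / p - 1) *
    (v `^ (-1 * b^-1) * (m `^ b^-1 * (I `^ p * s `^ (-1 * p)))) =
  (K `^ (a * b)^-1 * m `^ b^-1 * v `^ (-1 * b^-1)) * s `^ (-1 * p) *
    (I `^ p * G `^ (q / p - 1)))%R by ring.
have -> : (m `^ (- a^-1) * (I `^ p * (s `^ ((1 - p^-1) * (q - p)) * G `^ (q / p - 1))) =
   m `^ (- a^-1) * s `^ ((1 - p^-1) * (q - p)) * (I `^ p * G `^ (q / p - 1)))%R by ring.
rewrite ler_wpM2r ?mulr_ge0 ?powR_ge0//.
have sE : (s `^ ((1 - p^-1) * (q - p)) = s `^ a^-1 * s `^ (- 1 * p))%R.
  rewrite -powRD; last by apply/implyP => _; rewrite gt_eqF.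
  by rewrite aE; congr (_ `^ _)%R; field; rewrite gt_eqF.
rewrite sE mulrA ler_wpM2r ?powR_ge0//.
have mE : (m `^ (a * b)^-1 = m `^ a^-1 * m `^ b^-1)%R.
  rewrite -powRD; last by apply/implyP => _; rewrite gt_eqF.
  by congr (_ `^ _)%R; rewrite -[LHS]mul1r -ab; field; rewrite !gt_eqF.
rewrite mE in vs'.
rewrite mulN1r powRN powRN ler_pdivlMr ?powR_gt0// mulrAC -mulrA mulrC.
rewrite ler_pdivrMr ?powR_gt0//.
by move: vs'; rewrite mulrA mulrAC.
Qed.

(** For $f \ge 0$ and $e = \alpha/d - 1$ this is $M_\alpha f$, by [fractional_maximal_countable];
    only the countably many rational cubes occur, which gives measurability. *)
Definition off_diag_maxop (e : R) (f : T -> \bar R) : T -> \bar R :=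
  csup (fun n => mu (rat_cube n) `^ e * \int[mu]_(x in rat_cube n) f x)
       (fun n => rat_cube n).

Section strong_type.
Variables (u sg : T -> R) (a b K p q : R).
Hypotheses (usP : weight_pair u sg a b K) (p1 : (1 < p)%R) (pq : (p <= q)%R)
  (aE : (a^-1 = 1 + q * (1 - p^-1))%R).

Let p0 : (0 < p)%R. Proof. exact: lt_trans p1. Qed.
Let q0 : (0 < q)%R. Proof. exact: lt_le_trans pq. Qed.
Let a0 : (0 < a)%R. Proof. by case: usP => _ _ _ _ []. Qed.
Let b0 : (0 < b)%R. Proof. by case: usP => _ _ _ _ []. Qed.
Let ab : (a + b = 1)%R. Proof. by case: usP => _ _ _ _ []. Qed.
Let K0 : (0 < K)%R. Proof. by case: usP => _ _ _ _ []. Qed.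
Let u0 x : (0 < u x)%R. Proof. by case: usP. Qed.
Let s0 x : (0 < sg x)%R. Proof. by case: usP. Qed.
Let us x : (u x `^ a * sg x `^ b = 1)%R.
Proof. by case: usP => _ _ _ _ [_ _ _ _ []]. Qed.
Let mu_u : measurable_fun setT u. Proof. by case: usP. Qed.
Let mu_s : measurable_fun setT sg. Proof. by case: usP. Qed.
Let u_ge0 x : (0 <= u x)%R. Proof. exact: ltW. Qed.
Let s_ge0 x : (0 <= sg x)%R. Proof. exact: ltW. Qed.

Let nuU := density mu mu_u u_ge0.
Let nuS := density mu mu_s s_ge0.
Let suP := weight_pairC usP.
Let c := @rat_corner R d.
Let l := @rat_side R d.
Let l0 n : (0 < l n)%R. Proof. exact: rat_side_gt0. Qed.
Notation Q n := (cube (c n) (l n)).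
Let cQ n : is_cube (Q n). Proof. exact: is_cube_rat_cube. Qed.
Let mQ n : measurable (Q n). Proof. exact: measurable_cube. Qed.
Notation MU := (maxop nuU c l).
Notation MS := (maxop nuS c l).

(** Solved from $u^a\sigma^b = 1$ and $a + b = 1$; this identity passes from the measure $u\,dx$ to
    $\sigma\,dx$ between the two maximal operators. *)
Let sgE x : (u x `^ (- b^-1) * u x = sg x)%R.
Proof.
have uE : (u x = sg x `^ (- b / a))%R.
  have : (u x `^ a = sg x `^ (- b))%R.
    by apply: (mulIf (lt0r_neq0 (powR_gt0 b (s0 x)))); rewrite us powRN mulVf// lt0r_neq0// powR_gt0.
  move/(congr1 (fun z => z `^ a^-1)%R).
  by rewrite -!powRrM mulfV ?gt_eqF// powRr1.
rewrite -[X in (_ * X)%R]powRr1// -powRD; last by apply/implyP => _; rewrite gt_eqF.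
rewrite uE -powRrM (_ : - b / a * _ = 1)%R ?powRr1//.
have -> : a = (1 - b)%R by rewrite -ab addrK.
by field; rewrite gt_eqF//= subr_eq0 -ab -subr_eq0 addrK gt_eqF.
Qed.

Let pos_fin (x : \bar R) : 0 < x -> x < +oo ->
  exists2 v : R, (0 < v)%R & x = v%:E.
Proof. by case: x => [v| |]//; rewrite lte_fin => v0 _; exists v. Qed.

Let intU D f : measurable D -> measurable_fun D f ->
  (forall x, D x -> 0 <= f x) ->
  \int[nuU]_(x in D) f x = \int[mu]_(x in D) (f x * (u x)%:E).
Proof. exact: ge0_integral_density. Qed.

Let intS D f : measurable D -> measurable_fun D f ->
  (forall x, D x -> 0 <= f x) ->
  \int[nuS]_(x in D) f x = \int[mu]_(x in D) (f x * (sg x)%:E).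
Proof. exact: ge0_integral_density. Qed.

(** With $H = (M_\sigma g)^{pb}u^{-1}$, [lerner_real] gives the pointwise bound of the $q$-th power
    by $G^{q/p-1}(M_u H)^{1/b}$, up to a constant. Integrating against $u$, the operator $M_u$ is
    bounded on $L^{1/b}(u)$ because $1/b > 1$, then $M_\sigma$ is bounded on $L^p(\sigma)$, and
    $G^{q/p-1}G = G^{q/p}$. Only doubling of the two measures is used, no reverse Hölder
    inequality. *)
Lemma off_diag_strong_type :
  exists2 C : R, (0 < C)%R & forall g, measurable_fun setT g ->
    (forall x, 0 <= g x) ->
    \int[mu]_x (off_diag_maxop (- (a^-1 / q)) (fun x => g x * (sg x)%:E) x `^ q
                * (u x)%:E) <=
    C%:E * (\int[mu]_x (g x `^ p * (sg x)%:E)) `^ (q / p).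
Proof.
have Vb1 : (1 < b^-1)%R by rewrite invf_gt1// -ab ltrDr.
have DU0 : (0 < (K * 3 ^+ d) `^ a^-1)%R.
  by rewrite powR_gt0// mulr_gt0// exprn_gt0.
have DS0 : (0 < (K * 3 ^+ d) `^ b^-1)%R.
  by rewrite powR_gt0// mulr_gt0// exprn_gt0.
have [CU CU0 HU] := @maxop_strong_type R d nuU _ DU0 (@weight_pair_double _ _ _ _ _ _ _ usP)
  (@weight_pair_gt0 _ _ _ _ _ _ _ usP) (@weight_pair_lty _ _ _ _ _ _ _ usP)
  (density_cube_sigma_finite mu_u u_ge0 (@weight_pair_lty _ _ _ _ _ _ _ usP))
  c l l0 b^-1 Vb1.
have [CS CS0 HS] := @maxop_strong_type R d nuS _ DS0 (@weight_pair_double _ _ _ _ _ _ _ suP)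
  (@weight_pair_gt0 _ _ _ _ _ _ _ suP) (@weight_pair_lty _ _ _ _ _ _ _ suP)
  (density_cube_sigma_finite mu_s s_ge0 (@weight_pair_lty _ _ _ _ _ _ _ suP))
  c l l0 p p1.
exists (K `^ (a * b)^-1 * CU * CS)%R; first by rewrite !mulr_gt0// powR_gt0.
move=> g mg g0.
set G := \int[mu]_x (g x `^ p * (sg x)%:E).
have G0 : 0 <= G.
  by apply: integral_ge0 => x _; rewrite mule_ge0 ?poweR_ge0// lee_fin.
case GE : G G0 => [G'| |//] G'0; last first.
  rewrite poweRyr ?gt_eqF ?divr_gt0// gt0_muley ?leey// lte_fin !mulr_gt0//.
  exact: powR_gt0.
rewrite lee_fin in G'0.
pose Mg := MS g.
have Mg0 x : 0 <= Mg x by exact: maxop_ge0.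
have mMg : measurable_fun setT Mg by exact: measurable_maxop.
pose H x := Mg x `^ (p * b) * ((u x)^-1)%:E.
have H0 x : 0 <= H x by rewrite mule_ge0 ?poweR_ge0// lee_fin invr_ge0.
have mH : measurable_fun setT H.
  apply: emeasurable_funM; first exact: measurable_fun_poweR.
  apply/measurable_EFinP; apply: (eq_measurable_fun (fun x => u x `^ (- 1)))%R.
    by move=> x _; rewrite powR_inv1.
  exact: (measurableT_comp (measurable_powR (- 1)%R) mu_u).
have MH0 x : 0 <= MU H x by exact: maxop_ge0.
pose C1 : R := (K `^ (a * b)^-1 * G' `^ (q / p - 1))%R.
have C10 : (0 <= C1)%R by rewrite mulr_ge0 ?powR_ge0.
have pointwise x : off_diag_maxop (- (a^-1 / q)) (fun x => g x * (sg x)%:E) x `^ q <=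
    C1%:E * MU H x `^ b^-1.
  set Y := C1%:E * _.
  have Y0 : 0 <= Y by rewrite mule_ge0 ?poweR_ge0.
  rewrite -[Y](@poweRVK _ q) ?gt_eqF//; apply: lee_poweR; first exact: ltW.
    apply: csup_ge0 => n; rewrite mule_ge0 ?poweR_ge0// integral_ge0// => z _.
    by rewrite mule_ge0 ?lee_fin.
  apply: csup_le; first exact: poweR_ge0.
  move=> n Qx; set I := \int[mu]_(z in _) _.
  have I0 : 0 <= I by apply: integral_ge0 => z _; rewrite mule_ge0 ?lee_fin.
  rewrite -(lee_poweRE q0) ?mule_ge0 ?poweR_ge0// poweRVK ?gt_eqF//.
  pose m : R := (l n ^+ d)%R.
  have m0 : (0 < m)%R by rewrite exprn_gt0.
  have mE : mu (rat_cube n) = m%:E by exact: lebesgue_cube.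
  have [v v0 vE] : exists2 v : R, (0 < v)%R & nuU (Q n) = v%:E :=
    pos_fin (weight_pair_gt0 usP (cQ n)) (weight_pair_lty usP (cQ n)).
  have [s s_gt0 sE] : exists2 s : R, (0 < s)%R & nuS (Q n) = s%:E :=
    pos_fin (weight_pair_gt0 suP (cQ n)) (weight_pair_lty suP (cQ n)).
  have vs : (v `^ a * s `^ b <= K * m)%R.
    case: (usP) => _ _ _ _ [_ _ _ _ [_ /(_ _ (cQ n))]].
    have vE' : \int[mu]_(x in Q n) (u x)%:E = v%:E := vE.
    have sE' : \int[mu]_(x in Q n) (sg x)%:E = s%:E := sE.
    by rewrite vE' sE' [mu _]mE -!EFinM lee_fin.
  have IE : I = \int[nuS]_(z in Q n) g z.
    by rewrite intS//; exact: measurable_funTS.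
  have IG : I <= (s `^ (1 - p^-1) * G' `^ p^-1)%:E.
    have p'0 : (0 < 1 - p^-1)%R by rewrite subr_gt0 invf_lt1.
    have := @ge0_hoelder _ T R nuS (Q n) g (cst 1) p (1 - p^-1)^-1 (mQ n).
    rewrite invr_gt0 invrK => /(_ _ _ _ _ p0 p'0) HH.
    rewrite IE; apply: le_trans (_ : _ <= \int[nuS]_(z in Q n) (g z * cst 1 z)) _.
      by rewrite le_eqVlt; apply/orP; left; apply/eqP/eq_integral => z _; rewrite mule1.
    apply: le_trans (HH _ _ _ _ _) _ => //; first exact: measurable_funTS.
      by rewrite addrC subrK.
    rewrite EFinM muleC; apply: lee_pmul; rewrite ?poweR_ge0//.
      rewrite (_ : integral _ _ _ = s%:E)//.
      by under eq_integral do rewrite poweR1r; rewrite integral_cst// mul1e; exact: sE.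
    rewrite -poweR_EFin -GE; apply: lee_poweR; first by rewrite invr_ge0 ltW.
      by apply: integral_ge0 => z _; exact: poweR_ge0.
    rewrite (intS (mQ n)).
    - by apply: le_integral_nonneg => // z _; rewrite mule_ge0 ?poweR_ge0 ?lee_fin ?lexx.
    - by apply: measurable_fun_poweR; exact: measurable_funTS.
    - by move=> z _; exact: poweR_ge0.
  case I'E : I I0 IG => [I'| |//]; last by move=> _; rewrite leye_eq.
  rewrite !lee_fin => I'0 IG.
  have := lerner_real p1 pq a0 b0 ab aE K0 m0 v0 s_gt0 I'0 G'0 vs IG.
  rewrite -lee_fin => HL.
  rewrite mE poweR_EFin -EFinM poweR_EFin; apply: (le_trans HL).
  rewrite EFinM; apply: lee_wpmul2l; first by rewrite lee_fin.
  rewrite -poweR_EFin; apply: lee_poweR; first by rewrite invr_ge0 ltW.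
    by rewrite lee_fin !mulr_ge0 ?powR_ge0 ?invr_ge0 ?(ltW v0) ?(ltW m0).
  (* The factor $u^{-1}$ in [H] turns its $u$-integral over the cube into the Lebesgue integral of
     $(M_\sigma g)^{pb}$, and $M_\sigma g$ is at least the $\sigma$-average of [g] throughout the
     cube. *)
  apply: (@le_trans _ _ ((nuU (Q n))^-1 * \int[nuU]_(z in Q n) H z)); last first.
    exact: (@le_csup _ _ _ (fun n => (nuU (Q n))^-1 * \int[nuU]_(z in Q n) H z) _ n).
  rewrite vE inver gt_eqF// EFinM; apply: lee_wpmul2l; first by rewrite lee_fin invr_ge0 ltW.
  rewrite intU//; last exact: measurable_funTS.
  rewrite mulrC EFinM -mE -integral_cst; last exact: (mQ n).
  apply: le_integral_nonneg => // z Qz; last by rewrite mule_ge0 ?lee_fin.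
  rewrite lee_fin powR_ge0/= /H -muleA -EFinM mulVf ?gt_eqF// mule1.
  rewrite -poweR_EFin; apply: lee_poweR; first by rewrite mulr_ge0 ?(ltW p0) ?(ltW b0).
    by rewrite lee_fin divr_ge0 ?(ltW s_gt0).
  have -> : (I' / s)%:E = (nuS (Q n))^-1 * \int[nuS]_(z in Q n) g z.
    by rewrite sE inver gt_eqF// -IE I'E -EFinM mulrC.
  exact: (@le_csup _ _ _ (fun n => (nuS (Q n))^-1 * \int[nuS]_(z in Q n) g z) _ n).
have [Z [Z0 mZ FZ HU']] : exists Z : T -> \bar R, [/\ forall x, 0 <= Z x,
    measurable_fun setT Z,
    forall x, off_diag_maxop (- (a^-1 / q)) (fun x => g x * (sg x)%:E) x `^ q <=
      C1%:E * Z x &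
    \int[mu]_x (Z x * (u x)%:E) <= CU%:E * \int[mu]_x (H x `^ b^-1 * (u x)%:E)].
  have mZ : measurable_fun setT (fun x => MU H x `^ b^-1).
    by apply: measurable_fun_poweR; exact: measurable_maxop.
  have mHb : measurable_fun setT (fun x => H x `^ b^-1).
    exact: measurable_fun_poweR.
  have Z0 x : 0 <= MU H x `^ b^-1 by exact: poweR_ge0.
  have Hb0 x : 0 <= H x `^ b^-1 by exact: poweR_ge0.
  exists (fun x => MU H x `^ b^-1); split; [exact: Z0|exact: mZ|exact: pointwise|].
  have := HU H mH H0.
  rewrite (intU measurableT mZ (fun x _ => Z0 x)).
  by rewrite (intU measurableT mHb (fun x _ => Hb0 x)).
apply: (@le_trans _ _ (\int[mu]_x (C1%:E * (Z x * (u x)%:E)))).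
  have u0' x : 0 <= (u x)%:E by rewrite lee_fin.
  have F0 x : 0 <= off_diag_maxop (- (a^-1 / q)) (fun x => g x * (sg x)%:E) x `^ q.
    exact: poweR_ge0.
  have C10' : 0 <= C1%:E by rewrite lee_fin.
  apply: le_integral_nonneg => // x _; last exact: (mule_ge0 C10' (mule_ge0 (Z0 x) (u0' x))).
  by rewrite (mule_ge0 (F0 x) (u0' x))/= muleA; exact: lee_wpmul2r.
have mEu : measurable_fun setT (EFin \o u) by exact/measurable_EFinP.
have mZu := emeasurable_funM mZ mEu.
have Zu0 x : setT x -> 0 <= (Z \* (EFin \o u)) x.
  by move=> _; rewrite mule_ge0 ?lee_fin.
have C10' : 0 <= C1%:E by rewrite lee_fin.
rewrite (ge0_integralZl mu measurableT mZu Zu0 C10').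
have HS' : \int[mu]_x (Mg x `^ p * (sg x)%:E) <= CS%:E * G'%:E.
  have mMp : measurable_fun setT (fun x => Mg x `^ p) by exact: measurable_fun_poweR.
  have mgp : measurable_fun setT (fun x => g x `^ p) by exact: measurable_fun_poweR.
  have Mp0 x : 0 <= Mg x `^ p by exact: poweR_ge0.
  have gp0 x : 0 <= g x `^ p by exact: poweR_ge0.
  have := HS g mg g0.
  rewrite (intS measurableT mMp (fun x _ => Mp0 x)).
  by rewrite (intS measurableT mgp (fun x _ => gp0 x)) -/G GE.
(* Indeed $H^{1/b}u = (M_\sigma g)^p u^{1-1/b}$, and the last factor is $\sigma$ by [sgE]. *)
have HE : \int[mu]_x (H x `^ b^-1 * (u x)%:E) = \int[mu]_x (Mg x `^ p * (sg x)%:E).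
  apply: eq_integral => x _; rewrite poweRM ?poweR_ge0 ?lee_fin ?invr_ge0//.
  rewrite -poweRrM mulfK ?gt_eqF// -muleA poweR_EFin -EFinM; congr (_ * _%:E).
  by rewrite -sgE -[((u x)^-1)%R]powR_inv1// -powRrM mulN1r.
rewrite HE in HU'.
apply: (@le_trans _ _ (C1%:E * (CU%:E * (CS%:E * G'%:E)))).
  apply: lee_wpmul2l; first by rewrite lee_fin.
  apply: (le_trans HU'); apply: lee_wpmul2l; first by rewrite lee_fin ltW.
  exact: HS'.
rewrite poweR_EFin -!EFinM lee_fin /C1.
have -> : (G' `^ (q / p) = G' `^ (q / p - 1) * G')%R.
  have := @powRD R G' (q / p - 1) 1; rewrite subrK powRr1// => -> //.
  by rewrite gt_eqF// divr_gt0.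
by rewrite le_eqVlt; apply/orP; left; apply/eqP; ring.
Qed.

End strong_type.

End off_diagonal.

(** * Dyadic children and the stopping argument *)

Section dyadic.
Local Open Scope ereal_scope.
Context {R : realType} {d : nat}.
Notation T := (Rd R d).
Notation mu := (@lebesgue R d).
Implicit Types (c : T) (l : R) (A B : set T).

Definition child_corner c l (e : {ffun 'I_d -> bool}) : T :=
  [tuple (if e i then tnth c i + l / 2 else tnth c i)%R | i < d].

Definition child c l e : set T := hcube (child_corner c l e) (l / 2)%R.

Lemma child_subset c l e : (0 < l)%R -> child c l e `<=` hcube c l.
Proof.
move=> l0 x h i; have := h i; rewrite tnth_mktuple.
by case: (e i) => /andP[x1 x2]; apply/andP; split; lra.
Qed.

Lemma child_cover c l : (0 < l)%R -> hcube c l = \bigcup_(e in setT) child c l e.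
Proof.
move=> l0; apply/seteqP; split=> [x h|x [e _]]; last exact: child_subset.
exists [ffun i => (tnth c i + l / 2 <= tnth x i)%R] => // i.
rewrite tnth_mktuple ffunE; have /andP[x1 x2] := h i.
move: x1 x2; set y : R := tnth x i; set z : R := tnth c i => x1 x2.
by have [x3|x3] := leP (z + l / 2)%R y; apply/andP; split; lra.
Qed.

Lemma child_disjoint c l e e' : child c l e `&` child c l e' !=set0 -> e = e'.
Proof.
move=> [x [h h']]; apply/ffunP => i; have := h i; have := h' i.
rewrite !tnth_mktuple; case: (e i); case: (e' i) => // /andP[x1 x2] /andP[x3 x4];
  by exfalso; lra.
Qed.

(** Inside the cube, [A] is a union of dyadic descendants of generation [n]. For such sets the
    stopping argument is a finite recursion, with no appeal to Lebesgue differentiation. *)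
Fixpoint saturated n c l A : Prop :=
  match n with
  | 0 => A `&` hcube c l = set0 \/ hcube c l `<=` A
  | n'.+1 => forall e, saturated n' (child_corner c l e) (l / 2)%R A
  end.

Lemma saturated_ext n c l A B : (0 < l)%R -> A `&` hcube c l = B `&` hcube c l ->
  saturated n c l A -> saturated n c l B.
Proof.
elim: n c l => [|n IH] c l l0 AB /=.
  rewrite AB => -[->|h]; [by left|right => x xQ].
  by have : (A `&` hcube c l) x by [split => //; exact: h]; rewrite AB => -[].
move=> h e; apply: IH (h e); first by rewrite divr_gt0.
by rewrite -/(child c l e) -(setIidr (@child_subset c l e l0)) !setIA AB.
Qed.

Lemma saturated_nested n c l A : (0 < l)%R ->
  A `&` hcube c l = set0 \/ hcube c l `<=` A -> saturated n c l A.
Proof.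
elim: n c l => [//|n IH] c l l0 h e; apply: IH; first by rewrite divr_gt0.
have sub := @child_subset c l e l0; case: h => h; [left|right].
  by apply/seteqP; split => // x [Ax /sub Qx]; rewrite -h.
exact: subset_trans h.
Qed.

Lemma saturatedS n c l A : (0 < l)%R -> saturated n c l A -> saturated n.+1 c l A.
Proof.
elim: n c l => [|n IH] c l l0; first exact: (@saturated_nested 1).
by move=> h e; apply: IH; [rewrite divr_gt0|exact: h].
Qed.

Lemma saturated_leq n m c l A : (n <= m)%N -> (0 < l)%R ->
  saturated n c l A -> saturated m c l A.
Proof.
move=> /subnK <- l0; elim: (m - n)%N => // k IH /IH; rewrite addSn.
exact: saturatedS.
Qed.

Lemma saturatedC n c l A : saturated n c l A -> saturated n c l (~` A).
Proof.
elim: n c l => [|n IH] c l /=; last by move=> h e; exact: IH.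
move=> [h|h]; [right => x Qx Ax|left; apply/seteqP; split => // x [nAx /h]//].
by have : (A `&` hcube c l) x by []; rewrite h.
Qed.

Lemma saturatedU n c l A B : saturated n c l A -> saturated n c l B ->
  saturated n c l (A `|` B).
Proof.
elim: n c l => [|n IH] c l /=; last by move=> hA hB e; exact: IH.
move=> [hA|hA]; last by move=> _; right=> x /hA; left.
move=> [hB|hB]; last by right=> x /hB; right.
by left; rewrite setIUl hA hB setU0.
Qed.

Lemma saturated_glue n c l (F : {ffun 'I_d -> bool} -> set T) : (0 < l)%R ->
  (forall e, saturated n (child_corner c l e) (l / 2)%R (F e)) ->
  saturated n.+1 c l (\bigcup_(e in setT) (F e `&` child c l e)).
Proof.
move=> l0 h e; apply: saturated_ext (h e); first by rewrite divr_gt0.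
apply/seteqP; split => x [Fx Qx]; split => //; first by exists e.
case: Fx => e' _ [Fx Qx']; rewrite (@child_disjoint c l e e')//.
by exists x.
Qed.

Lemma measurable_child c l e : measurable (child c l e).
Proof. exact: measurable_hcube. Qed.

Lemma measurable_glue c l (F : {ffun 'I_d -> bool} -> set T) :
  (forall e, measurable (F e)) ->
  measurable (\bigcup_(e in setT) (F e `&` child c l e)).
Proof.
move=> mF; apply: fin_bigcup_measurable => // e _.
by apply: measurableI => //; exact: measurable_child.
Qed.

(* Summation over the children of a cube. *)
Lemma measure_children (nu1 nu2 : {measure set T -> \bar R}) (k : R) c l A B :
  (0 < l)%R -> (0 <= k)%R -> measurable A -> measurable B ->
  (forall e, nu1 (A `&` child c l e) <= k%:E * nu2 (B `&` child c l e)) ->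
  nu1 (A `&` hcube c l) <= k%:E * nu2 (B `&` hcube c l).
Proof.
move=> l0 k0 mA mB H.
have E (m : {measure set T -> \bar R}) D : measurable D ->
    m (D `&` hcube c l) = \sum_(e \in setT) m (D `&` child c l e).
  move=> mD; rewrite (child_cover c l0) setI_bigcupr measure_fin_bigcup//.
  - exact: finite_finset.
  - apply/trivIsetP => e e' _ _ /eqP ee'; apply/eqP/negPn/negP => /set0P.
    move=> [x [[_ xe] [_ xe']]]; apply: ee'; apply: (@child_disjoint c l).
    by exists x.
  - by move=> e _; apply: measurableI => //; exact: measurable_child.
rewrite !E// ge0_mule_fsumr//; apply: lee_fsum; [exact: finite_finset|by move=> e _; exact: H].
Qed.

(* Calderon-Zygmund stopping: stop at the first descendants in which A has density
   larger than eta. *)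
Lemma stopping (nu : {measure set T -> \bar R}) (eta beta : R) n c l A :
  (0 < eta)%R -> (eta < 1)%R -> (0 <= beta)%R ->
  (forall c' l' E, (0 < l')%R -> measurable E -> E `<=` hcube c' l' ->
     mu E <= (2 ^+ d * eta)%:E * mu (hcube c' l') ->
     nu E <= beta%:E * nu (hcube c' l')) ->
  (0 < l)%R -> measurable A -> saturated n c l A ->
  mu (A `&` hcube c l) <= eta%:E * mu (hcube c l) ->
  exists W : set T, [/\ measurable W, saturated n c l W,
    nu (A `&` hcube c l) <= beta%:E * nu (W `&` hcube c l) &
    mu (W `&` hcube c l) <= (eta^-1)%:E * mu (A `&` hcube c l)].
Proof.
move=> eta0 eta1 beta0 small.
elim: n c l => [|n IH] c l l0 mA.
  (* At depth 0 the set fills the cube or misses it; density at most $\eta < 1$ excludes the first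
     case. *)
  move=> [h|h] Aeta; last first.
    exfalso; move: Aeta; rewrite (setIidr h) lebesgue_hcube// -EFinM lee_fin.
    by rewrite leNgt gtr_pMl ?eta1// exprn_gt0.
  exists set0; split=> //; first by left; rewrite set0I.
    by rewrite h measure0 mule_ge0// lee_fin.
  by rewrite set0I measure0 mule_ge0// lee_fin invr_ge0 ltW.
move=> satA Aeta; have l20 : (0 < l / 2)%R by rewrite divr_gt0.
have /choice[W WP] e : exists W : set T,
    [/\ measurable W, saturated n (child_corner c l e) (l / 2)%R W,
    nu (A `&` child c l e) <= beta%:E * nu (W `&` child c l e) &
    mu (W `&` child c l e) <= (eta^-1)%:E * mu (A `&` child c l e)].
  have [dens|dens] := leP (mu (A `&` child c l e)) (eta%:E * mu (child c l e)).
    exact: IH.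
  exists (child c l e); split.
  - exact: measurable_child.
  - by apply: saturated_nested => //; right.
  (* The child stops here. Its parent has density at most $\eta$ and $2^d$ times its volume, so the
     density in the child is at most $2^d\eta$. *)
  - rewrite setIid; apply: small => //.
      by apply: measurableI => //; exact: measurable_child.
    apply: (@le_trans _ _ (mu (A `&` hcube c l))).
      apply: le_measure; rewrite ?inE; try (apply: measurableI => //).
      + exact: measurable_child.
      + exact: measurable_hcube.
      + by apply: setIS; exact: child_subset.
    apply: (le_trans Aeta); rewrite !lebesgue_hcube// -!EFinM lee_fin.
    rewrite expr_div_n (_ : 2 ^+ d * eta * (l ^+ d / 2 ^+ d) = eta * l ^+ d)%R//.
    by field; rewrite expf_neq0.
  - rewrite setIid -lee_pdivrMl ?invr_gt0// invrK; exact: ltW.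
pose V := \bigcup_(e in setT) (W e `&` child c l e).
have mV : measurable V by apply: measurable_glue => e; have [] := WP e.
have VE e : V `&` child c l e = W e `&` child c l e.
  apply/seteqP; split => x [Vx Qx]; split => //; last by exists e.
  case: Vx => e' _ [Wx Qx']; rewrite (@child_disjoint c l e e')//.
  by exists x.
exists V; split => //.
- by apply: saturated_glue => // e; have [] := WP e.
- by apply: measure_children => // e; rewrite VE; have [] := WP e.
- apply: measure_children => //; first by rewrite invr_ge0 ltW.
  by move=> e; rewrite VE; have [] := WP e.
Qed.

(** Each passage from [A] to the union of its stopping cubes gains a factor $\beta$ in weighted mass
    and costs at most $1/\eta$ in volume; density $\eta^k$ allows [k] passages. *)
Lemma stopping_iter (nu : {measure set T -> \bar R}) (eta beta : R) n c l A k :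
  (0 < eta)%R -> (eta < 1)%R -> (0 <= beta)%R ->
  (forall c' l' E, (0 < l')%R -> measurable E -> E `<=` hcube c' l' ->
     mu E <= (2 ^+ d * eta)%:E * mu (hcube c' l') ->
     nu E <= beta%:E * nu (hcube c' l')) ->
  (0 < l)%R -> measurable A -> saturated n c l A ->
  mu (A `&` hcube c l) <= (eta ^+ k)%:E * mu (hcube c l) ->
  nu (A `&` hcube c l) <= (beta ^+ k)%:E * nu (hcube c l).
Proof.
move=> eta0 eta1 beta0 small l0.
elim: k A => [|k IH] A mA satA.
  rewrite !expr0 !mul1e => _; apply: le_measure; rewrite ?inE//.
  - by apply: measurableI => //; exact: measurable_hcube.
  - exact: measurable_hcube.
move=> Ak.
have A1 : mu (A `&` hcube c l) <= eta%:E * mu (hcube c l).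
  apply: (le_trans Ak); apply: lee_wpmul2r => //.
  by rewrite lee_fin exprS ler_piMr ?(ltW eta0)// exprn_ile1 ?(ltW eta0) ?(ltW eta1).
have [W [mW satW AW WA]] := stopping eta0 eta1 beta0 small l0 mA satA A1.
apply: (le_trans AW); rewrite exprS EFinM -muleA.
apply: lee_wpmul2l; first by rewrite lee_fin.
apply: IH => //; apply: (le_trans WA).
rewrite lee_pdivrMl//; apply: (le_trans Ak).
by rewrite exprS EFinM muleA.
Qed.

End dyadic.

(** * Approximation of Borel sets by finite unions of dyadic cubes *)

Section dyadic_approximation.
Local Open Scope ereal_scope.
Context {R : realType} {d : nat}.
Notation T := (Rd R d).
Notation mu := (@lebesgue R d).
Variables (nu : {measure set T -> \bar R}) (c0 : T) (l0 : R).
Hypotheses (l0_gt0 : (0 < l0)%R) (nu_fin : nu (hcube c0 l0) < +oo).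
Notation Q := (hcube c0 l0).
Implicit Types A B : set T.

Let symd A B : set T := (A `\` B) `|` (B `\` A).

Definition dyadic_approx : set (set T) := [set A | measurable A /\
  forall e : R, (0 < e)%R -> exists n B, [/\ measurable B, saturated n c0 l0 B &
    nu (symd A B `&` Q) <= e%:E]].

Let mQ : measurable Q. Proof. exact: measurable_hcube. Qed.

Let msymd A B : measurable A -> measurable B -> measurable (symd A B `&` Q).
Proof.
by move=> mA mB; apply: measurableI => //; apply: measurableU; exact: measurableD.
Qed.

Let symd_sub A B C D E : measurable A -> measurable B -> measurable C ->
  measurable D -> measurable E ->
  symd A B `<=` symd C D `|` E ->
  nu (symd A B `&` Q) <= nu (symd C D `&` Q) + nu (E `&` Q).
Proof.
move=> mA mB mC mD mE sub.
apply: (@le_trans _ _ (nu ((symd C D `&` Q) `|` (E `&` Q)))).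
  apply: le_measure; rewrite ?inE; first exact: msymd.
    by apply: measurableU; [exact: msymd|exact: measurableI].
  by move=> x [/sub[]]; [left|right].
by apply: measureU2; [exact: msymd|exact: measurableI].
Qed.

Let dyadic_approxC A : dyadic_approx A -> dyadic_approx (~` A).
Proof.
move=> [mA HA]; split; first exact: measurableC.
move=> e e0; have [n [B [mB sB AB]]] := HA e e0.
exists n, (~` B); split; [exact: measurableC|exact: saturatedC|].
by rewrite (_ : symd (~` A) (~` B) = symd A B)// /symd !setDE !setCK setUC
  [X in X `|` _]setIC [X in _ `|` X]setIC.
Qed.

Let dyadic_approxU A B : dyadic_approx A -> dyadic_approx B ->
  dyadic_approx (A `|` B).
Proof.
move=> [mA HA] [mB HB]; split; first exact: measurableU.
move=> e e0; have e20 : (0 < e / 2)%R by rewrite divr_gt0.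
have [n [A' [mA' sA AA']]] := HA _ e20.
have [m [B' [mB' sB BB']]] := HB _ e20.
exists (maxn n m), (A' `|` B'); split; first exact: measurableU.
  by apply: saturatedU; [apply: saturated_leq sA|apply: saturated_leq sB] => //;
    rewrite ?leq_maxl ?leq_maxr.
rewrite (splitr e) EFinD; apply: le_trans (leeD AA' BB').
apply: symd_sub; rewrite ?/symd; try exact: measurableU; try by [].
  by apply: measurableU; exact: measurableD.
move=> x [[[Ax|Bx] /not_orP[nA nB]]|[[Ax|Bx] /not_orP[nA nB]]].
- by left; left.
- by right; left.
- by left; right.
- by right; right.
Qed.

(** The part of the cube in [A] but outside [F n] shrinks to the empty set, and [nu] is finite on
    the cube, so its measure tends to 0. *)
Let dyadic_approx_increasing (A : set T) (F : nat -> set T) :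
  (forall n, dyadic_approx (F n)) -> A = \bigcup_n F n ->
  nondecreasing_seq F -> dyadic_approx A.
Proof.
move=> HF AE ndF.
have mF n : measurable (F n) by have [] := HF n.
have mA : measurable A by rewrite AE; exact: bigcupT_measurable.
split=> // e e0; have e20 : (0 < e / 2)%R by rewrite divr_gt0.
pose G n := (A `\` F n) `&` Q.
have mG n : measurable (G n).
  by apply: measurableI => //; exact: measurableD.
have G0 : \bigcap_n G n = set0.
  apply/seteqP; split => // x Gx; have [[Ax _] _] := Gx 0%N Logic.I.
  by move: Ax; rewrite AE => -[n _ Fx]; have [[]] := Gx n Logic.I.
have cG : nu (G n) @[n --> \oo] --> nu (\bigcap_n G n).
  apply: nonincreasing_cvg_mu => //; last 2 first.
  - by rewrite G0.
  - move=> n m nm; apply/subsetPset => x [[Ax nFx] Qx]; split=> //; split=> //.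
    by apply: contra_not nFx; apply/subsetPset/ndF.
  - rewrite (le_lt_trans _ nu_fin)//; apply: le_measure; rewrite ?inE//.
    exact: subIsetr.
have [n Gn] : exists n, nu (G n) <= (e / 2)%:E.
  apply: contrapT => /forallNP h.
  have : (e / 2)%:E <= nu (\bigcap_n G n).
    rewrite -(cvg_lim _ cG)//; apply: lime_ge; first exact: cvgP cG.
    by apply: nearW => n; apply: ltW; rewrite ltNge; apply/negP; exact: h.
  by rewrite G0 measure0 lee_fin leNgt e20.
have [_ /(_ _ e20)[k [B [mB sB FB]]]] := HF n.
exists k, B; split => //.
rewrite (splitr e) EFinD; apply: le_trans (leeD FB Gn).
apply: symd_sub => //; first exact: measurableD.
move=> x [[Ax nB]|[Bx nA]].
  by case: (pselect (F n x)) => Fx; [left; left|right].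
by left; right; split=> // Fx; apply: nA; rewrite AE; exists n.
Qed.

Let dyadic_approx_sat A n : measurable A -> saturated n c0 l0 A -> dyadic_approx A.
Proof.
move=> mA sA; split=> // e e0; exists n, A; split => //.
by rewrite /symd setDv setU0 set0I measure0 lee_fin ltW.
Qed.

Let dyadic_approx_sigma : sigma_algebra setT dyadic_approx.
Proof.
split.
- apply: (@dyadic_approx_sat _ 0%N) => //; left; exact: set0I.
- by move=> A HA; rewrite setTD; exact: dyadic_approxC.
- move=> F HF; pose G n := \big[setU/set0]_(i < n.+1) F i.
  apply: (@dyadic_approx_increasing _ G).
  + elim=> [|n IH]; first by rewrite /G big_ord1.
    by rewrite /G big_ord_recr; exact: dyadic_approxU.
  + apply/seteqP; split => x [n _ Fx].
      exists n => //; rewrite /G -bigcup_mkord; exists n => //=.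
    by move: Fx; rewrite /G -bigcup_mkord => -[i /= _ Fx]; exists i.
  + move=> n m nm; apply/subsetPset; rewrite /G -!bigcup_mkord.
    apply: bigcup_subset => i /= ik; exact: leq_trans ik _.
Qed.

(** Keep the descendants whose corner lies beyond [t] in coordinate [i]. Those that straddle [t]
    have side $l/2^n$, so only a strip of that width can be missed. *)
Let ray_sat (i : 'I_d) (t : R) n : forall c l, (0 < l)%R -> exists B : set T,
  [/\ measurable B, saturated n c l B, B `&` hcube c l `<=` [set x | t < tnth x i]%R &
      [set x | t + l / 2 ^+ n < tnth x i]%R `&` hcube c l `<=` B].
Proof.
elim: n => [|n IH] c l l_gt0.
  have [ct|ct] := ltP t (tnth c i).
    exists (hcube c l); split; [exact: measurable_hcube|by right| |by move=> x []].
    move=> x [Qx _]/=; have /andP[+ _] := Qx i; exact: lt_le_trans.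
  exists set0; split; [by []|by left; rewrite set0I|by rewrite set0I|].
  move=> x [/= tx Qx]; have /andP[_ xc] := Qx i; exfalso.
  move: tx; rewrite expr0 divr1 ltNge => /negP; apply.
  by rewrite ltW// (lt_le_trans xc)// lerD2r.
have l20 : (0 < l / 2)%R by rewrite divr_gt0.
have /choice[B BP] e := IH (child_corner c l e) (l / 2)%R l20.
exists (\bigcup_(e in setT) (B e `&` child c l e)); split.
- by apply: measurable_glue => e; have [] := BP e.
- by apply: saturated_glue => // e; have [] := BP e.
- by move=> x [[e _ [Bx Qx]] _]; have [_ _ + _] := BP e; apply.
- move=> x [/= tx]; rewrite (child_cover c l_gt0) => -[e _ Qx].
  exists e => //; split => //; have [_ _ _] := BP e; apply; split => //=.
  by rewrite -mulrA -invfM -exprS.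
Qed.

Let dyadic_approx_ray (i : 'I_d) (t : R) :
  dyadic_approx [set x | t < tnth x i]%R.
Proof.
have mray s : measurable [set x : T | s < tnth x i]%R.
  apply: measurable_Rd.
  have := @measurable_tnth _ (measurableTypeR R) d i.
  move=> /(_ measurableT _ (measurable_itv `]s, +oo[)); rewrite setTI.
  congr (measurable _); apply/funext => x /=; apply/propext.
  by rewrite in_itv/= andbT.
split=> // e e0.
pose F n := [set x : T | t + l0 / 2 ^+ n < tnth x i]%R.
pose G n := ([set x : T | t < tnth x i]%R `\` F n) `&` Q.
have mG n : measurable (G n).
  by apply: measurableI => //; apply: measurableD; exact: mray.
have G0 : \bigcap_n G n = set0.
  apply/seteqP; split => // x Gx; have [[/= tx _] _] := Gx 0%N Logic.I.
  have tx0 : (0 < tnth x i - t)%R by rewrite subr_gt0.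
  have [n nx] : exists n, (l0 / (tnth x i - t) < 2 ^+ n)%R.
    exists (Num.truncn (l0 / (tnth x i - t))).+1.
    apply: (lt_trans (truncnS_gt _)); rewrite -natrX ltr_nat; exact: ltn_expl.
  have [[_ nF] _] := Gx n Logic.I; apply: nF; rewrite /F/= -ltrBrDl.
  by rewrite ltr_pdivrMr ?exprn_gt0// mulrC -ltr_pdivrMr.
have cG : nu (G n) @[n --> \oo] --> nu (\bigcap_n G n).
  apply: nonincreasing_cvg_mu => //; last 2 first.
  - by rewrite G0.
  - move=> n m nm; apply/subsetPset => x [[Ax nFx] Qx]; split=> //; split=> //.
    apply: contra_not nFx; rewrite /F/=; apply: le_lt_trans.
    rewrite lerD2l ler_pM2l// lef_pV2 ?posrE ?exprn_gt0//.
    by rewrite ler_eXn2l// ltr1n.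
  - rewrite (le_lt_trans _ nu_fin)//; apply: le_measure; rewrite ?inE//.
    exact: subIsetr.
have [n Gn] : exists n, nu (G n) <= e%:E.
  apply: contrapT => /forallNP h.
  have : e%:E <= nu (\bigcap_n G n).
    rewrite -(cvg_lim _ cG)//; apply: lime_ge; first exact: cvgP cG.
    by apply: nearW => n; apply: ltW; rewrite ltNge; apply/negP; exact: h.
  by rewrite G0 measure0 lee_fin leNgt e0.
have [B [mB sB Bsub subB]] := ray_sat i t n c0 l0_gt0.
exists n, B; split=> //; apply: le_trans Gn; apply: le_measure; rewrite ?inE//.
  exact: msymd.
move=> x [[[tx nB]|[Bx nt]] Qx]; last by exfalso; apply: nt; apply: Bsub.
by split=> //; split=> // Fx; apply: nB; apply: subB.
Qed.

(** The approximable sets form a sigma-algebra for which all coordinates are measurable, hence it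
    contains the Borel sets. *)
Lemma borel_dyadic_approx (A : set (d.-tuple (measurableTypeR R))) :
  measurable A -> dyadic_approx A.
Proof.
move=> mA; pose gT := g_sigma_algebraType dyadic_approx.
have mid : measurable_fun [set: gT] (id : gT -> d.-tuple (measurableTypeR R)).
  apply/measurable_fun_tnthP => i.
  apply: (measurability _ (RGenOInfty.measurableE R)).
  move=> _ [_ [t ->] <-]; rewrite setTI.
  apply: sub_sigma_algebra.
  rewrite (_ : _ @^-1` _ = [set x | t < tnth x i]%R); first exact: dyadic_approx_ray.
  by apply/funext => x /=; apply/propext; rewrite in_itv/= andbT.
have := mid measurableT _ mA; rewrite setTI => sA.
exact: (smallest_sub dyadic_approx_sigma (@subset_refl _ _)) sA.
Qed.

End dyadic_approximation.

(** * Quantitative absolute continuity of the weighted measure *)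

Section reverse_hoelder.
Local Open Scope ereal_scope.
Context {R : realType} {d : nat}.
Notation T := (Rd R d).
Notation mu := (@lebesgue R d).
Implicit Types (u sg : T -> R) (a b K : R) (A E Q : set T).

Lemma integral_cube_hcube (c : T) (l : R) (f : T -> \bar R) : (0 < l)%R ->
  measurable_fun setT f -> (forall x, 0 <= f x) ->
  \int[mu]_(x in cube c l) f x = \int[mu]_(x in hcube c l) f x.
Proof.
move=> l0 mf f0.
have mC := @measurable_cube R d c l; have mH := @measurable_hcube R d c l.
have sub := @hcube_subset_cube R d c l.
have mD : measurable (cube c l `\` hcube c l) by exact: measurableD.
have D0 : mu (cube c l `\` hcube c l) = 0.
  have HC : mu (hcube c l) = mu (cube c l) by rewrite lebesgue_hcube// lebesgue_cube.
  have Cfin : mu (cube c l) < +oo by rewrite lebesgue_cube// ltry.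
  rewrite measureD ?(setIidr sub)//.
  by rewrite [X in _ - X]HC subee// ge0_fin_numE.
rewrite -{1}(setDUK sub) ge0_integral_setU//.
- rewrite [X in _ + X]null_set_integral ?adde0//.
  exact: measurable_funTS.
- exact: measurable_funTS.
- by apply/disj_setPS => x [? []].
Qed.

(** Lebesgue measure is an outer measure, an infimum over countable Borel covers; the union of a
    good cover is the required [B]. *)
Lemma lebesgue_outer_regular A (v : \bar R) : mu A < v ->
  exists B : set (d.-tuple (measurableTypeR R)),
    [/\ measurable B, A `<=` B & mu (B : set T) < v].
Proof.
move=> /ereal_inf_lt[_ [F [mF AF] <-] Fv].
have mB : measurable (\bigcup_n F n) by exact: bigcup_measurable.
exists (\bigcup_n F n); split => //; apply: le_lt_trans Fv.
by rewrite lebesgueE//; exact: measure_sigma_subadditive.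
Qed.

Section absolute_continuity.
Variables (u sg : T -> R) (a b K : R).
Hypothesis usP : weight_pair u sg a b K.
Let U E := \int[mu]_(x in E) (u x)%:E.

Let mu_u : measurable_fun setT u. Proof. by case: usP. Qed.
Let u0 x : (0 < u x)%R. Proof. by case: usP. Qed.
Let u_ge0 x : (0 <= u x)%R. Proof. exact: ltW. Qed.
Notation nuU := (density mu mu_u u_ge0).

Let U0 E : 0 <= U E.
Proof. by apply: integral_ge0 => x _; rewrite lee_fin. Qed.

Let U_hcube (c : T) l : (0 < l)%R -> U (hcube c l) = U (cube c l).
Proof.
move=> l0; apply/esym; apply: integral_cube_hcube l0 _ _.
  exact/measurable_EFinP.
by move=> x; rewrite lee_fin.
Qed.

Lemma weight_pair_hcube_lty (c : T) l : (0 < l)%R -> U (hcube c l) < +oo.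
Proof.
by move=> l0; rewrite U_hcube//; apply: (weight_pair_lty usP); exists c, l.
Qed.

(** The complement of [E] has at least half of the volume, so [weight_pair_subset] gives it at least
    $1/D$ of the mass, and $\beta = 1 - 1/D$. The summand 1 in [D] ensures $D > 1$. *)
Lemma weight_pair_small : exists2 beta : R, (0 < beta < 1)%R &
  forall (c : T) l E, (0 < l)%R -> measurable E -> E `<=` hcube c l ->
    mu E <= (2^-1)%:E * mu (hcube c l) -> U E <= beta%:E * U (hcube c l).
Proof.
case: (usP) => _ mu_s _ s0 [a0 b0 ab K0 _].
pose D : R := ((2 * K) `^ a^-1 + 1)%R.
have D1 : (1 < D)%R by rewrite ltrDr powR_gt0// mulr_gt0.
have D0 : (0 < D)%R by exact: lt_trans D1.
exists (1 - D^-1)%R.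
  by rewrite subr_gt0 invf_lt1// D1 ltrBlDr ltrDl invr_gt0.
move=> c l E l0 mE EP small; set P := hcube c l in EP small *.
have mP : measurable P by exact: measurable_hcube.
have mPE : measurable (P `\` E) by exact: measurableD.
have PC : P `<=` cube c l by exact: hcube_subset_cube.
have Pfin : mu P < +oo by rewrite lebesgue_hcube// ltry.
have mu2 : (2^-1)%:E * mu P <= mu (P `\` E).
  have muD : mu (P `\` E) = mu P - mu E by rewrite measureD ?(setIidr EP).
  rewrite muD leeBrDr; last first.
    by rewrite ge0_fin_numE// (le_lt_trans _ Pfin)//; apply: le_measure; rewrite ?inE.
  apply: (le_trans (leeD2l _ small)).
  by rewrite lebesgue_hcube// -!EFinM -EFinD lee_fin -mulrDl; lra.
have cC : is_cube (cube c l) by exists c, l.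
have := weight_pair_subset usP cC mPE (subset_trans (@subDsetl _ _ _) PC).
rewrite -!/(U _) -U_hcube// lebesgue_cube// -(lebesgue_hcube c l0) -/P => H.
have UPE : U P <= D%:E * U (P `\` E).
  have {}H : U P `^ a <= (2 * K)%:E * U (P `\` E) `^ a.
    have P0 : 0 < mu P by rewrite lebesgue_hcube// lte_fin exprn_gt0.
    rewrite -(@lee_pmul2l _ ((2^-1)%:E * mu P)); last 2 first.
    - by rewrite lebesgue_hcube.
    - by rewrite lebesgue_hcube// -EFinM lte_fin mulr_gt0// ?invr_gt0// exprn_gt0.
    apply: (@le_trans _ _ (mu (P `\` E) * U P `^ a)).
      by apply: lee_wpmul2r => //; exact: poweR_ge0.
    apply: (le_trans H); rewrite !muleA; apply: lee_wpmul2r; first exact: poweR_ge0.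
    rewrite lebesgue_hcube// -!EFinM lee_fin le_eqVlt; apply/orP; left; apply/eqP.
    by field.
  have := lee_poweR (r := a^-1) _ (poweR_ge0 _ _) H.
  rewrite invr_ge0 (ltW a0) => /(_ isT).
  rewrite poweRK ?gt_eqF// poweRM ?poweR_ge0 ?lee_fin ?mulr_ge0 ?(ltW K0)//.
  rewrite poweRK ?gt_eqF// poweR_EFin => /le_trans; apply.
  by apply: lee_wpmul2r => //; rewrite lee_fin lerDl.
have UP : U P = U E + U (P `\` E).
  rewrite -[in LHS](setDUK EP); apply: (@measureU _ _ _ nuU _ _ mE mPE).
  by apply/seteqP; split => // x [? []].
have := weight_pair_hcube_lty c l0; rewrite -/P.
move: UP UPE (U0 E) (U0 (P `\` E)).
case: (U E) => [x| |]//; case: (U (P `\` E)) => [y| |]// -> //.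
rewrite -!EFinD -!EFinM !lee_fin => h x0 y0 _.
rewrite -(ler_pM2l D0); rewrite mulrA mulrBr mulr1 mulfV ?gt_eqF//; nra.
Qed.

(** [stopping_iter] for general sets: pass to a Borel superset of nearly the same volume, then to a
    saturated set close to it for Lebesgue measure and weighted measure simultaneously. *)
Lemma weight_pair_abs_cont : exists eta beta : R,
  [/\ (0 < eta < 1)%R, (0 < beta < 1)%R &
  forall (c : T) l k A, (0 < l)%R -> measurable A -> A `<=` hcube c l ->
    mu A < (eta ^+ k)%:E * mu (hcube c l) ->
    U A <= (beta ^+ k)%:E * U (hcube c l)].
Proof.
have [beta /andP[beta0 beta1] small] := weight_pair_small.
(* Then $2^d\eta = 1/2$, the density for which [weight_pair_small] applies. *)
pose eta : R := ((2 ^+ d.+1)^-1)%R.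
have eta0 : (0 < eta)%R by rewrite invr_gt0 exprn_gt0.
have eta1 : (eta < 1)%R by rewrite invf_lt1 ?exprn_gt0// exprn_egt1// ltr1n.
have etaE : (2 ^+ d * eta = 2^-1)%R.
  by rewrite /eta exprS invfM mulrCA mulfV ?mulr1// expf_neq0.
exists eta, beta; split; rewrite ?eta0 ?beta0// => c l k A l0 mA AP Ak.
set P := hcube c l in AP Ak *.
have mP : measurable P by exact: measurable_hcube.
have [B [mB AB Bk]] := lebesgue_outer_regular Ak.
have mB' : measurable (B : set T) by exact: measurable_Rd.
have mBP : measurable ((B : set T) `&` P) by exact: measurableI.
apply: (@le_trans _ _ (U (B `&` P))).
  apply: (@le_measure _ _ _ nuU); rewrite ?inE//.
  by move=> x Ax; split; [exact: AB|exact: AP].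
have Pfin : mu P < +oo by rewrite lebesgue_hcube// ltry.
have {}Bk : mu (B `&` P) < (eta ^+ k)%:E * mu P.
  by apply: le_lt_trans Bk; apply: le_measure; rewrite ?inE//; exact: subIsetl.
pose nu := measure_add mu nuU.
have nuP : nu P < +oo.
  by rewrite /nu measure_addE; apply: lte_add_pinfty => //; exact: weight_pair_hcube_lty.
have Bfin : mu (B `&` P) \is a fin_num.
  by rewrite ge0_fin_numE// (lt_trans Bk)// lebesgue_hcube// -EFinM ltry.
have [_ approx] := borel_dyadic_approx l0 nuP mB.
apply/lee_addgt0Pr => e e0.
(* The strict inequality on [mu A] leaves room: the approximation error is also taken below the
   remaining slack, so that the saturated set still has density at most $\eta^k$. *)
have [e1 [e10 e1e Be1]] : exists e1 : R, [/\ (0 < e1)%R, (e1 <= e)%R &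
    mu (B `&` P) + e1%:E <= (eta ^+ k)%:E * mu P].
  move: Bk; rewrite /P lebesgue_hcube// -EFinM -/P.
  case/fineK : Bfin => <-; rewrite lte_fin => h.
  exists (Num.min e (eta ^+ k * l ^+ d - fine (mu (B `&` P))))%R; split.
  - by rewrite lt_min e0 subr_gt0.
  - by rewrite ge_min lexx.
  - by rewrite -EFinD lee_fin -lerBrDl ge_min lexx orbT.
have [n [B1 [mB1 sB1]]] := approx _ e10.
set S := (_ `|` _) `&` _ => Se1.
have {}Se1 : mu S + U S <= e1%:E by rewrite -[leLHS](measure_addE mu nuU).
have mS : measurable S.
  by apply: measurableI => //; apply: measurableU; exact: measurableD.
have mB1P : measurable (B1 `&` P) by exact: measurableI.
have muS : mu S <= e1%:E by apply: le_trans Se1; rewrite leeDl.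
have nuS : U S <= e1%:E by apply: le_trans Se1; rewrite leeDr.
have H : U (B1 `&` P) <= (beta ^+ k)%:E * U P.
  apply: (@stopping_iter _ _ nuU eta beta n c l B1 k) => //; first exact: ltW.
    by move=> c' l' E l'0 mE EP'; rewrite etaE; exact: small.
  apply: (le_trans _ Be1).
  apply: (@le_trans _ _ (mu (B `&` P) + mu S)); last exact: leeD2l.
  apply: (@le_trans _ _ (mu ((B `&` P) `|` S))); last exact: measureU2.
  apply: le_measure; rewrite ?inE//; first exact: measurableU.
  by move=> x [B1x Px]; have [Bx|nBx] := pselect (B x); [left|right; split=> //; right].
apply: (@le_trans _ _ (nuU (B1 `&` P) + nuU S)); last by apply: leeD => //; exact: le_trans nuS _.
apply: (@le_trans _ _ (nuU ((B1 `&` P) `|` S))); last exact: measureU2.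
apply: (@le_measure _ _ _ nuU); rewrite ?inE//; first exact: measurableU.
by move=> x [Bx Px]; have [B1x|nBx] := pselect (B1 x); [left|right; split=> //; left].
Qed.

End absolute_continuity.
End reverse_hoelder.

(** * The reverse Hölder inequality *)

Section reverse_hoelder_inequality.
Local Open Scope ereal_scope.
Context {R : realType} {d : nat}.
Notation T := (Rd R d).
Notation mu := (@lebesgue R d).

Lemma ex_exprn_lt (x c : R) : (0 <= x < 1)%R -> (0 < c)%R ->
  exists n, (x ^+ n < c)%R.
Proof.
move=> /andP[x0 x1] c0.
have x1' : (`|x| < 1)%R by rewrite ger0_norm.
have /cvgr_lt/(_ _ c0)[n _ /(_ n (leqnn n))] := cvg_expr x1'.
by exists n.
Qed.

Lemma nneseries_geometric_le (F : nat -> \bar R) (C x : R) :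
  (0 <= C)%R -> (0 < x < 1)%R -> (forall n, 0 <= F n) ->
  (forall n, F n <= (C * x ^+ n)%:E) -> \sum_(n <oo) F n <= (C / (1 - x))%:E.
Proof.
move=> C0 /andP[x0 x1] F0 FC; apply: lime_le.
  by apply: is_cvg_nneseries => n _ _.
apply: nearW => n; apply: (@le_trans _ _ (\sum_(0 <= k < n) (C * x ^+ k)%:E)).
  by apply: lee_sum => k _; exact: FC.
rewrite sumEFin lee_fin; have := @geometric_le_lim R n C x C0 x0.
by rewrite ger0_norm ?(ltW x0)// => /(_ x1); rewrite /series.
Qed.

Variables (u sg : T -> R) (a b K : R).
Hypothesis usP : weight_pair u sg a b K.

(** Cut the cube by the level of $u$ on the scale $v/\eta^k$, with $v$ the average of $u$. The
    [k]-th strip has volume share at most $\eta^k$ by Chebyshev, hence geometrically small mass,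
    while $u^e$ grows only by $\eta^{-e}$ per strip; for small $e$ the series converges. *)
Lemma weight_pair_reverse_hoelder : exists2 e0 : R, (0 < e0)%R &
  forall e : R, (0 < e <= e0)%R -> exists2 C : R, (0 < C)%R &
    forall Q, is_cube Q ->
      mu Q `^ e * \int[mu]_(x in Q) (u x `^ (1 + e))%:E <=
      C%:E * (\int[mu]_(x in Q) (u x)%:E) `^ (1 + e).
Proof.
case: (usP) => mu_u _ u0 _ _.
have u_ge0 x : (0 <= u x)%R by exact: ltW.
have [eta [beta [/andP[eta0 eta1] /andP[beta0 beta1] H]]] := weight_pair_abs_cont usP.
have lneta : (ln eta < 0)%R by rewrite ln_lt0// eta0.
have lnbeta : (ln beta < 0)%R by rewrite ln_lt0// beta0.
(* For $e$ up to this value the ratio $x = \eta^{-e}\beta$ is at most $\beta^{1/2}$, hence below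
   1. *)
exists (ln beta / (2 * ln eta))%R.
  by rewrite -mulrNN -invrN divr_gt0// ?oppr_gt0// nmulr_llt0.
move=> e /andP[e_gt0 ee0].
pose x : R := (eta `^ (- e) * beta)%R.
have x01 : (0 < x < 1)%R.
  rewrite mulr_gt0 ?powR_gt0//=; rewrite /x /powR gt_eqF// -{1}(lnK beta0) -expRD.
  rewrite expR_lt1.
  have : (ln beta <= e * (2 * ln eta))%R.
    by rewrite -ler_ndivlMr// nmulr_llt0.
  by nra.
have /andP[x0 x1] := x01.
pose C : R := (eta `^ (- e) / beta / (1 - x))%R.
have C0 : (0 < C)%R by rewrite divr_gt0 ?subr_gt0// divr_gt0 ?powR_gt0.
exists C => // _ [c [l [l0 ->]]].
have mV : measurable_fun setT (fun x => u x `^ (1 + e))%R.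
  exact: (measurableT_comp (measurable_powR _) mu_u).
have V0 y : (0 <= u y `^ (1 + e))%R by exact: powR_ge0.
set P := hcube c l.
have -> : \int[mu]_(x in cube c l) (u x `^ (1 + e))%:E =
    \int[mu]_(x in P) (u x `^ (1 + e))%:E.
  by apply: integral_cube_hcube l0 _ _; [exact/measurable_EFinP|move=> y; rewrite lee_fin].
have -> : \int[mu]_(x in cube c l) (u x)%:E = \int[mu]_(x in P) (u x)%:E.
  by apply: integral_cube_hcube l0 _ _; [exact/measurable_EFinP|move=> y; rewrite lee_fin].
rewrite lebesgue_cube//; pose m : R := (l ^+ d)%R; rewrite -/m.
have m0 : (0 < m)%R by rewrite exprn_gt0.
have muP : mu P = m%:E by exact: lebesgue_hcube.
have mP : measurable P by exact: measurable_hcube.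
pose U := density mu mu_u u_ge0.
pose V := density mu mV V0.
rewrite -/(V P).
have UPgt : 0 < U P by apply: integral_pos_gt0 => //; rewrite muP lte_fin.
have [i Ui] : exists i : R, U P = i%:E.
  exists (fine (U P)); rewrite fineK// ge0_fin_numE//.
  exact: (weight_pair_hcube_lty usP).
have i0 : (0 < i)%R by rewrite -lte_fin -Ui.
pose v : R := (i / m)%R; have v0 : (0 < v)%R by rewrite divr_gt0.
(* Strip 0 takes all values up to $v/\eta$, so the strips cover the whole cube. *)
pose I k := Interval (if k is 0%N then -oo%O else BRight (v / eta ^+ k)%R)
  (BRight (v / eta ^+ k.+1)%R).
pose F k := P `&` u @^-1` [set` I k].
have mF k : measurable (F k).
  apply: measurableI => //; rewrite -[X in measurable X]setTI.
  by apply: (mu_u) => //; exact: measurable_itv.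
have FP k : F k `<=` P by move=> y [].
have PF : P `<=` \bigcup_k F k.
  move=> y Py.
  have ex : exists k, (u y <= v / eta ^+ k.+1)%R.
    have [|n nv] := @ex_exprn_lt eta (v / u y)%R _ (divr_gt0 v0 (u0 y)).
      by rewrite ltW.
    exists n; rewrite ler_pdivlMr ?exprn_gt0// mulrC -ler_pdivlMr//.
    by rewrite (le_trans _ (ltW nv))// exprS ler_piMl ?exprn_ge0 ?ltW.
  have := ex_minnP ex; case=> k uk kmin; exists k => //; split => //=.
  rewrite in_itv/= uk andbT; case: k uk kmin => [//|k _ kmin] /=.
  by rewrite ltNge; apply/negP => /kmin; rewrite ltnn.
(* [weight_pair_abs_cont] needs a strict inequality, obtained by giving up one power: the share of
   strip $k+1$ is at most $\eta^{k+1} < \eta^k$. This explains the factor $1/\beta$. *)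
have UF k : U (F k) <= (beta ^+ k / beta * i)%:E.
  have UFP : U (F k) <= i%:E by rewrite -Ui; apply: le_measure; rewrite ?inE.
  case: k UFP => [|k] UFP.
    apply: (le_trans UFP); rewrite lee_fin ler_peMl ?(ltW i0)//.
    by rewrite expr0 div1r invf_ge1// ltW.
  rewrite exprSr mulfK ?gt_eqF// EFinM -Ui; apply: H => //.
  rewrite -/P muP; apply: (@le_lt_trans _ _ (eta ^+ k.+1 * m)%:E).
    have : (v / eta ^+ k.+1)%:E * mu (F k.+1) <= i%:E.
      apply: le_trans UFP; rewrite -integral_cst//.
      apply: le_integral_nonneg => [//|y|y _]; last by rewrite lee_fin.
      move=> [_ /=]; rewrite in_itv/= => /andP[/ltW uy _].
      by rewrite !lee_fin uy divr_ge0 ?exprn_ge0 ?(ltW v0) ?(ltW eta0).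
    have vk0 : (0 < v / eta ^+ k.+1)%R by rewrite divr_gt0// exprn_gt0.
    rewrite -lee_pdivlMl// => /le_trans; apply; rewrite -EFinM lee_fin.
    rewrite /v le_eqVlt; apply/orP; left; apply/eqP; field.
    by rewrite !gt_eqF ?exprn_gt0.
  by rewrite -EFinM lte_fin ltr_pM2r// exprS gtr_pMl// exprn_gt0.
have VF k : V (F k) <= (eta `^ (- e) * v `^ e * i / beta * x ^+ k)%:E.
  apply: (@le_trans _ _ (((v / eta ^+ k.+1) `^ e)%:E * U (F k))).
    have mFu : measurable_fun (F k) (fun y => (u y)%:E).
      exact/measurable_funTS/measurable_EFinP.
    have Fu0 y : F k y -> 0 <= (u y)%:E by rewrite lee_fin.
    have vk0 : 0 <= ((v / eta ^+ k.+1) `^ e)%:E by rewrite lee_fin powR_ge0.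
    rewrite -(ge0_integralZl mu (mF k) mFu Fu0 vk0).
    apply: le_integral_nonneg => [//|y|y _]; last by rewrite mule_ge0// lee_fin.
    move=> [_ /=]; rewrite in_itv/= => /andP[_ uy].
    rewrite lee_fin powR_ge0/= -EFinM lee_fin powRD; last first.
      by apply/implyP => _; rewrite gt_eqF.
    rewrite powRr1// mulrC ler_pM2r// ge0_ler_powR ?nnegrE ?(ltW e_gt0)//.
    by rewrite divr_ge0 ?exprn_ge0 ?(ltW v0) ?(ltW eta0).
  apply: (le_trans (lee_wpmul2l _ (UF k))); first by rewrite lee_fin powR_ge0.
  rewrite -EFinM lee_fin /x le_eqVlt; apply/orP; left; apply/eqP.
  rewrite powRM ?invr_ge0 ?exprn_ge0 ?(ltW v0) ?(ltW eta0)//.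
  have -> : ((eta ^+ k.+1)^-1 `^ e = eta `^ (- e) * (eta `^ (- e)) ^+ k)%R.
    rewrite -exprS -!powR_mulrn ?powR_ge0 ?(ltW eta0)// -powRrM mulNr mulrC.
    rewrite -powR_inv1 ?powR_ge0// -!powRrM; congr (_ `^ _)%R; ring.
  by rewrite exprMn; ring.
have VP : V P <= (C * v `^ e * i)%:E.
  apply: (le_trans (measure_sigma_subadditive _ mF mP PF)).
  apply: (le_trans (@nneseries_geometric_le _ _ x _ x01 _ VF)) => //.
    by rewrite !mulr_ge0 ?powR_ge0 ?invr_ge0 ?(ltW i0) ?(ltW beta0).
  by rewrite lee_fin le_eqVlt; apply/orP; left; apply/eqP; rewrite /C; ring.
rewrite poweR_EFin; apply: (le_trans (lee_wpmul2l _ VP)).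
  by rewrite lee_fin powR_ge0.
have -> : \int[mu]_(x in P) (u x)%:E = i%:E by exact: Ui.
rewrite poweR_EFin -!EFinM lee_fin powRD; last first.
  by apply/implyP => _; rewrite gt_eqF.
rewrite powRr1 ?(ltW i0)//.
rewrite /v powRM ?invr_ge0 ?(ltW m0) ?(ltW i0)// -(powR_inv1 (ltW m0)) -powRrM mulN1r.
rewrite le_eqVlt; apply/orP; left; apply/eqP.
rewrite powRN; field; by rewrite gt_eqF// powR_gt0.
Qed.

End reverse_hoelder_inequality.

(** * Estimates for rearrangements *)

Section rearrangement_estimates.
Local Open Scope ereal_scope.
Context {R : realType}.
Notation leb := (@lebesgue_measure R).

Lemma poweR_add_le (x y : \bar R) (s : R) : (0 < s)%R -> 0 <= x -> 0 <= y ->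
  (x + y) `^ s <= (2 `^ s)%:E * (x `^ s + y `^ s).
Proof.
move=> s0 x0 y0.
have H (u v : \bar R) : 0 <= u -> u <= v ->
    (u + v) `^ s <= (2 `^ s)%:E * (u `^ s + v `^ s).
  move=> u0 uv; have v0 := le_trans u0 uv.
  apply: (@le_trans _ _ ((2%:E * v) `^ s)).
    apply: lee_poweR; [exact: ltW|exact: adde_ge0|].
    by rewrite mule_natl mule2n leeD2r.
  rewrite poweRM ?lee_fin// poweR_EFin; apply: lee_wpmul2l.
    by rewrite lee_fin powR_ge0.
  by rewrite leeDr// poweR_ge0.
have [xy|/ltW yx] := leP x y; first exact: H.
by rewrite addeC [X in _ * X]addeC; exact: H.
Qed.

Lemma nonincreasing_le_average (phi : R -> \bar R) (p t : R) : (0 < p)%R ->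
  (0 < t)%R -> (forall s, 0 <= phi s) -> {homo phi : s t / (s <= t)%R >-> t <= s} ->
  phi t <= (t `^ (- p^-1))%:E * (\int[leb]_(s in `]0%R, t[) phi s `^ p) `^ p^-1.
Proof.
move=> p0 t0 phi0 phih.
have H : t%:E * phi t `^ p <= \int[leb]_(s in `]0%R, t[) phi s `^ p.
  have -> : t%:E * phi t `^ p = \int[leb]_(s in `]0%R, t[) (phi t `^ p).
    rewrite integral_cst// [X in _ = _ * X]lebesgue_measure_itv/= lte_fin t0.
    by rewrite sube0 muleC.
  apply: le_integral_nonneg => [//|s|s _]; last exact: poweR_ge0.
  rewrite /= in_itv/= => /andP[_ st]; rewrite poweR_ge0/=.
  by apply: lee_poweR; rewrite ?(ltW p0)// phih// ltW.
have := lee_poweR (r := p^-1) _ _ H.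
rewrite invr_ge0 (ltW p0) mule_ge0 ?poweR_ge0 ?lee_fin ?(ltW t0)// => /(_ isT isT).
rewrite poweRM ?poweR_ge0 ?lee_fin ?(ltW t0)// poweRK ?gt_eqF// poweR_EFin.
rewrite -lee_pdivlMl ?powR_gt0//; first by rewrite -powRN.
Qed.

Context d (T : measurableType d) (m : {sigma_finite_measure set T -> \bar R}).

(** The weak type estimate contained in a strong one: $G^*(t)$ is at most the $p$-mean of $G^*$ over
    $(0, t)$. *)
Lemma rearr_le_strong (G : T -> \bar R) (p t : R) : measurable_fun setT G ->
  (forall x, 0 <= G x) -> (0 < p)%R -> (0 < t)%R ->
  rearr m G t <= (t `^ (- p^-1))%:E * (\int[m]_x G x `^ p) `^ p^-1.
Proof.
move=> mG G0 p0 t0.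
have -> : \int[m]_x G x `^ p = \int[m]_x `|G x| `^ p.
  by apply: eq_integral => x _; rewrite gee0_abs.
rewrite integral_rearr//.
apply: (le_trans (nonincreasing_le_average p0 t0 (rearr_ge0 m G)
  (@rearr_nonincreasing _ _ _ m G))).
apply: lee_wpmul2l; first by rewrite lee_fin powR_ge0.
apply: lee_poweR.
- by rewrite invr_ge0 ltW.
- by apply: integral_ge0 => s _; exact: poweR_ge0.
apply: le_integral_nonneg => s; last by rewrite poweR_ge0.
- by rewrite /= !in_itv/= => /andP[-> _].
- by rewrite poweR_ge0 lexx.
Qed.

(** Where [G] exceeds $G_1^*(s) + G_2^*(t)$, one of the summands exceeds its own level, and these
    two sets have measure at most [s] and [t]. *)
Lemma rearr_add_le (G G1 G2 : T -> \bar R) (s t : R) : measurable_fun setT G ->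
  measurable_fun setT G1 -> measurable_fun setT G2 ->
  (forall x, 0 <= G x) -> (forall x, 0 <= G1 x) -> (forall x, 0 <= G2 x) ->
  (forall x, G x <= G1 x + G2 x) ->
  rearr m G (s + t) <= rearr m G1 s + rearr m G2 t.
Proof.
move=> mG mG1 mG2 G0 G10 G20 le.
case E1 : (rearr m G1 s) (rearr_ge0 m G1 s) => [a| |]// => [a0|_]; last first.
  by rewrite addye ?leey// gt_eqF// (lt_le_trans _ (rearr_ge0 m G2 t))// ltNyr.
case E2 : (rearr m G2 t) (rearr_ge0 m G2 t) => [b| |]// => [b0|_]; last by rewrite addey ?leey.
rewrite lee_fin in a0; rewrite lee_fin in b0.
rewrite -EFinD rearr_le ?addr_ge0// EFinD.
have := lexx (rearr m G1 s); rewrite {2}E1 rearr_le// => H1.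
have := lexx (rearr m G2 t); rewrite {2}E2 rearr_le// => H2.
apply: le_trans (leeD H1 H2).
have ms1 := measurable_superlevel a%:E mG1.
have ms2 := measurable_superlevel b%:E mG2.
apply: (@le_trans _ _ (m ([set x | a%:E < `|G1 x|] `|` [set x | b%:E < `|G2 x|]))); last first.
  exact: measureU2.
apply: le_measure; rewrite ?inE; [exact: measurable_superlevel|exact: measurableU|].
move=> x /=; rewrite !gee0_abs// => h.
apply: contrapT => /not_orP[/negP + /negP]; rewrite -!leNgt => h1 h2.
by move: h; rewrite ltNge (le_trans (le x))// leeD.
Qed.

End rearrangement_estimates.

(** * Marcinkiewicz interpolation in Lorentz spaces *)

Section interpolation.
Local Open Scope ereal_scope.
Context {R : realType}.
Notation leb := (@lebesgue_measure R).
Context d (T : measurableType d) (m : {sigma_finite_measure set T -> \bar R}).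
Variables (S : (T -> \bar R) -> T -> \bar R).
Hypothesis S_meas : forall F, measurable_fun setT F -> (forall x, 0 <= F x) ->
  measurable_fun setT (S F).
Hypothesis S_ge0 : forall F, measurable_fun setT F -> (forall x, 0 <= F x) ->
  forall x, 0 <= S F x.
Hypothesis S_add : forall F G, measurable_fun setT F -> (forall x, 0 <= F x) ->
  measurable_fun setT G -> (forall x, 0 <= G x) ->
  forall x, S (fun x => F x + G x) x <= S F x + S G x.
Variables (p q p0 q0 p1 q1 C0 C1 : R).
Hypotheses (p0_gt0 : (0 < p0)%R) (p0p : (p0 < p)%R) (pp1 : (p < p1)%R).
Hypotheses (q0_gt0 : (0 < q0)%R) (q1_gt0 : (0 < q1)%R).
Hypotheses (pq0 : (p0^-1 - q0^-1 = p^-1 - q^-1)%R)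
  (pq1 : (p1^-1 - q1^-1 = p^-1 - q^-1)%R).
Hypotheses (C0_gt0 : (0 < C0)%R) (C1_gt0 : (0 < C1)%R).
Hypothesis strong0 : forall F, measurable_fun setT F -> (forall x, 0 <= F x) ->
  (\int[m]_x S F x `^ q0) `^ q0^-1 <= C0%:E * (\int[m]_x F x `^ p0) `^ p0^-1.
Hypothesis strong1 : forall F, measurable_fun setT F -> (forall x, 0 <= F x) ->
  (\int[m]_x S F x `^ q1) `^ q1^-1 <= C1%:E * (\int[m]_x F x `^ p1) `^ p1^-1.

Let p_gt0 : (0 < p)%R. Proof. exact: lt_trans p0p. Qed.
Let p1_gt0 : (0 < p1)%R. Proof. exact: lt_trans pp1. Qed.

Let A phi t := \int[leb]_(s in `]0%R, t[) phi s `^ p0.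
Let B phi t := \int[leb]_(s in `[t, +oo[) phi s `^ p1.

(* F is split at the level of its rearrangement at t / 2. *)
Lemma rearr_interpolation : exists2 K : R, (0 < K)%R &
  forall F, measurable_fun setT F -> (forall x, 0 <= F x) ->
  forall t : R, (0 < t)%R ->
  (t `^ q^-1)%:E * rearr m (S F) t <=
  K%:E * ((t `^ (p^-1 - p0^-1))%:E * A (rearr m F) t `^ p0^-1 +
          (t `^ (p^-1 - p1^-1))%:E * B (rearr m F) t `^ p1^-1).
Proof.
pose K0 : R := (2 `^ q0^-1 * C0)%R.
pose K1 : R := (2 `^ q1^-1 * C1 * 2 `^ p1^-1)%R.
have K00 : (0 < K0)%R by rewrite mulr_gt0// powR_gt0.
have K10 : (0 < K1)%R by rewrite !mulr_gt0// powR_gt0.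
pose K : R := (K0 + K1 * 2 `^ p0^-1 + K1)%R.
have KK : (0 < K)%R by rewrite !addr_gt0// mulr_gt0// powR_gt0.
exists K => // F mF F0 t t0.
pose phi := rearr m F.
have phi0 s : 0 <= phi s by exact: rearr_ge0.
have phih : {homo phi : s t / (s <= t)%R >-> t <= s} by exact: rearr_nonincreasing.
rewrite -/phi; have A0 : 0 <= A phi t by apply: integral_ge0 => s _; exact: poweR_ge0.
have B0 : 0 <= B phi t by apply: integral_ge0 => s _; exact: poweR_ge0.
have Y0 : 0 <= (t `^ (p^-1 - p1^-1))%:E * B phi t `^ p1^-1.
  by rewrite mule_ge0 ?poweR_ge0// lee_fin powR_ge0.
have [Aoo|Afin] := eqVneq (A phi t) +oo.
  rewrite Aoo poweRyr ?gt_eqF ?invr_gt0// gt0_muley ?lte_fin ?powR_gt0//.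
  rewrite addye ?gt0_muley ?lte_fin ?leey//.
  by rewrite gt_eqF// (lt_le_trans _ Y0)// ltNyr.
have t20 : (0 < t / 2)%R by rewrite divr_gt0.
have t2t : (t / 2 <= t)%R by rewrite ler_pdivrMr// ler_pMr// ler1n.
have hA : phi (t / 2)%R <= ((t / 2) `^ (- p0^-1))%:E * A phi t `^ p0^-1.
  apply: (le_trans (nonincreasing_le_average p0_gt0 t20 phi0 phih)).
  apply: lee_wpmul2l; first by rewrite lee_fin powR_ge0.
  apply: lee_poweR; first by rewrite invr_ge0 ltW.
    by apply: integral_ge0 => s _; exact: poweR_ge0.
  apply: le_integral_nonneg => s; rewrite ?poweR_ge0 ?lexx//.
  by rewrite /= !in_itv/= => /andP[-> /lt_le_trans]; apply.
have [x Ax] : exists x, A phi t = x%:E.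
  by exists (fine (A phi t)); rewrite fineK// ge0_fin_numE// lt_neqAle Afin leey.
have x0 : (0 <= x)%R by rewrite -lee_fin -Ax.
have [h hE] : exists h, phi (t / 2)%R = h%:E.
  move: hA; rewrite Ax poweR_EFin -EFinM; move: (phi0 (t / 2)%R).
  by case: (phi _) => [h| |]//; exists h.
have h0 : (0 <= h)%R by rewrite -lee_fin -hE.
pose F1 y := if h%:E < F y then F y else 0.
pose F2 y := if h%:E < F y then 0 else F y.
have mlt : measurable_fun setT (fun y => h%:E < F y).
  by apply: measurable_fun_lte.
have mF1 : measurable_fun setT F1 by exact: measurable_fun_ifT.
have mF2 : measurable_fun setT F2 by exact: measurable_fun_ifT.
have F10 y : 0 <= F1 y by rewrite /F1; case: ifP.
have F20 y : 0 <= F2 y by rewrite /F2; case: ifP.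
have F12 : F = (fun y => F1 y + F2 y).
  by apply/funext => y; rewrite /F1 /F2; case: ifP; rewrite ?adde0 ?add0e.
(* The high part lives on a set of measure at most $t/2$, so its rearrangement vanishes beyond $t$
   and is at most [phi] before. *)
have I1 : \int[m]_y F1 y `^ p0 <= A phi t.
  have -> : \int[m]_y F1 y `^ p0 = \int[m]_y `|F1 y| `^ p0.
    by apply: eq_integral => y _; rewrite gee0_abs.
  rewrite integral_rearr// /A integral_mkcond [leRHS]integral_mkcond.
  apply: le_integral_nonneg => [//|s _|s _]; last first.
    by rewrite patchE; case: ifP => _ //; exact: poweR_ge0.
  rewrite !patchE; case: ifPn => sp; last first.
    by rewrite lexx/=; case: ifP => _ //; exact: poweR_ge0.
  rewrite poweR_ge0/=; case: ifPn => sm.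
    apply: lee_poweR; rewrite ?(ltW p0_gt0) ?rearr_ge0//.
    apply: le_rearr => // y; rewrite !gee0_abs// /F1; case: ifP => // _.
  have st : (t <= s)%R.
    have s0 : (0 < s)%R by move: sp; rewrite inE/= in_itv/= andbT.
    rewrite leNgt; apply/negP => st; move/negP: sm; apply.
    by rewrite inE/= in_itv/= s0.
  have -> : rearr m F1 s = 0.
    apply/eqP; rewrite eq_le rearr_ge0 andbT rearr_le//.
    apply: (@le_trans _ _ (m [set y | h%:E < `|F y|])).
      apply: le_measure; rewrite ?inE; try exact: measurable_superlevel.
      move=> y /=; rewrite !gee0_abs// /F1; case: ifP => //; by rewrite ltxx.
    have := lexx (phi (t / 2)%R); rewrite {2}hE rearr_le// => /le_trans; apply.
    by rewrite lee_fin (le_trans t2t).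
  by rewrite poweR0r// gt_eqF.
(* The rearrangement of the low part is at most [h] on $(0, t)$ and at most [phi] beyond. *)
have I2 : \int[m]_y F2 y `^ p1 <= (t * h `^ p1)%:E + B phi t.
  have -> : \int[m]_y F2 y `^ p1 = \int[m]_y `|F2 y| `^ p1.
    by apply: eq_integral => y _; rewrite gee0_abs.
  rewrite integral_rearr//.
  have -> : (`]0%R, +oo[%classic : set R) = `]0%R, t[ `|` `[t, +oo[.
    by rewrite -itv_bndbnd_setU//= bnd_simp// ltW.
  have mr D : measurable_fun D (fun s => rearr m F2 s `^ p1).
    by apply: measurable_fun_poweR; apply: measurable_funTS; exact: measurable_rearr.
  rewrite ge0_integral_setU//=; last 3 first.
    exact: mr.
    by move=> s _; exact: poweR_ge0.
    apply/disj_setPS => s []/=; rewrite !in_itv/= andbT => /andP[_ st] ts.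
    by move: st; rewrite ltNge ts.
  apply: leeD; last first.
    apply: le_integral_nonneg => [//|s _|s _]; last exact: poweR_ge0.
    rewrite poweR_ge0/=; apply: lee_poweR; rewrite ?(ltW p1_gt0) ?rearr_ge0//.
    by apply: le_rearr => // y; rewrite !gee0_abs// /F2; case: ifP.
  have -> : (t * h `^ p1)%:E = \int[leb]_(s in `]0%R, t[) (h `^ p1)%:E.
    rewrite integral_cst// [X in _ = _ * X]lebesgue_measure_itv/= lte_fin t0.
    by rewrite sube0 -EFinM mulrC.
  apply: le_integral_nonneg => [//|s|s _]; last by rewrite lee_fin powR_ge0.
  rewrite /= in_itv/= => /andP[s0 _]; rewrite poweR_ge0/= -poweR_EFin.
  apply: lee_poweR; rewrite ?(ltW p1_gt0) ?rearr_ge0// rearr_le//.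
  rewrite (_ : [set y | _] = set0) ?measure0 ?lee_fin ?(ltW s0)//.
  apply/seteqP; split => // y /=; rewrite gee0_abs// /F2; case: ifPn => //.
    by move=> _; rewrite lte_fin ltNge h0.
  by move=> /negP.
have R1 : rearr m (S F1) (t / 2)%R <= ((t / 2) `^ (- q0^-1) * C0)%:E * A phi t `^ p0^-1.
  apply: (le_trans (@rearr_le_strong _ _ _ m _ _ _ (S_meas mF1 F10) (S_ge0 mF1 F10) q0_gt0 t20)).
  rewrite EFinM -muleA; apply: lee_wpmul2l; first by rewrite lee_fin powR_ge0.
  apply: (le_trans (strong0 mF1 F10)); apply: lee_wpmul2l.
    by rewrite lee_fin ltW.
  apply: lee_poweR => //; first by rewrite invr_ge0 ltW.
  by apply: integral_ge0 => y _; exact: poweR_ge0.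
have R2 : rearr m (S F2) (t / 2)%R <= ((t / 2) `^ (- q1^-1) * C1 * 2 `^ p1^-1)%:E *
    ((t `^ p1^-1 * h)%:E + B phi t `^ p1^-1).
  apply: (le_trans (@rearr_le_strong _ _ _ m _ _ _ (S_meas mF2 F20) (S_ge0 mF2 F20) q1_gt0 t20)).
  rewrite (EFinM (_ * C1)%R) (EFinM _ C1) -!muleA; apply: lee_wpmul2l; first by rewrite lee_fin powR_ge0.
  apply: (le_trans (strong1 mF2 F20)); apply: lee_wpmul2l.
    by rewrite lee_fin ltW.
  have th0 : 0 <= (t * h `^ p1)%:E by rewrite lee_fin mulr_ge0 ?powR_ge0// ltW.
  apply: (@le_trans _ _ (((t * h `^ p1)%:E + B phi t) `^ p1^-1)).
    apply: lee_poweR => //; first by rewrite invr_ge0 ltW.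
    by apply: integral_ge0 => y _; exact: poweR_ge0.
  have p1V : (0 < p1^-1)%R by rewrite invr_gt0.
  apply: (le_trans (poweR_add_le p1V th0 B0)).
  rewrite poweR_EFin powRM ?powR_ge0 ?(ltW t0)// -powRrM mulfV ?gt_eqF//.
  by rewrite powRr1.
have mS := S_meas mF F0; have S0 := S_ge0 mF F0.
have H : rearr m (S F) t <= rearr m (S F1) (t / 2)%R + rearr m (S F2) (t / 2)%R.
  rewrite {1}(splitr t); apply: rearr_add_le => //.
  - exact: S_meas.
  - exact: S_meas.
  - exact: S_ge0.
  - exact: S_ge0.
  - by move=> y; rewrite {1}F12; exact: S_add.
apply: (@le_trans _ _ ((t `^ q^-1)%:E * (((t / 2) `^ (- q0^-1) * C0)%:E * A phi t `^ p0^-1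
   + ((t / 2) `^ (- q1^-1) * C1 * 2 `^ p1^-1)%:E *
    ((t `^ p1^-1 * h)%:E + B phi t `^ p1^-1)))).
  apply: lee_wpmul2l; first by rewrite lee_fin powR_ge0.
  by apply: (le_trans H); exact: leeD.
move: hA B0 Y0; rewrite hE Ax poweR_EFin -EFinM lee_fin.
move: (x `^ p0^-1)%R => y hy; case: (B phi t) => [z|_ _|//]; last first.
  rewrite poweRyr ?gt_eqF ?invr_gt0//.
  have -> : (t `^ (p^-1 - p1^-1))%:E * +oo = +oo :> \bar R.
    by rewrite gt0_muley// lte_fin powR_gt0.
  rewrite -[X in _ <= _ * (X + _)]EFinM addey//.
  by rewrite [X in _ <= X]gt0_muley ?lte_fin// leey.
rewrite lee_fin => z0 _; rewrite poweR_EFin -?EFinM -?EFinD lee_fin.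
move: (z `^ p1^-1)%R (powR_ge0 z p1^-1) => w w0.
have t2 r : ((t / 2) `^ (- r) = 2 `^ r * t `^ (- r))%R.
  rewrite powRM ?(ltW t0) ?invr_ge0// mulrC; congr (_ * _)%R.
  by rewrite powRN -[(2^-1)%R]powR_inv1 ?ler0n// -powRrM mulN1r powRN invrK.
have tD r1 r2 : (t `^ r1 * t `^ r2 = t `^ (r1 + r2))%R.
  by rewrite powRD//; apply/implyP => _; rewrite gt_eqF.
have -> : (t `^ q^-1 * ((t / 2) `^ (- q0^-1) * C0 * y +
    (t / 2) `^ (- q1^-1) * C1 * 2 `^ p1^-1 * (t `^ p1^-1 * h + w)) =
    K0 * ((t `^ q^-1 * t `^ (- q0^-1)) * y) +
    K1 * ((t `^ q^-1 * t `^ (- q1^-1) * t `^ p1^-1) * h) +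
    K1 * ((t `^ q^-1 * t `^ (- q1^-1)) * w))%R.
  by rewrite !t2 /K0 /K1; ring.
have E0 : (q^-1 - q0^-1 = p^-1 - p0^-1)%R.
  by have := pq0; lra.
have E1 : (q^-1 - q1^-1 = p^-1 - p1^-1)%R.
  by have := pq1; lra.
rewrite !tD E0 E1 subrK.
(* The term with the cutting level is absorbed in the [A] term by [hA]; hence the middle summand of
   [K]. *)
have H1 : (t `^ p^-1 * h <= 2 `^ p0^-1 * (t `^ (p^-1 - p0^-1) * y))%R.
  rewrite -tD [leRHS](_ : _ = t `^ p^-1 * (2 `^ p0^-1 * t `^ (- p0^-1) * y))%R.
    by rewrite ler_pM2l ?powR_gt0// -t2.
  by ring.
have w1 : (0 <= t `^ (p^-1 - p1^-1) * w)%R by rewrite mulr_ge0 ?powR_ge0.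
have y0 : (0 <= t `^ p^-1 * h)%R by rewrite mulr_ge0 ?powR_ge0.
move: (t `^ p^-1 * h)%R (t `^ (p^-1 - p0^-1) * y)%R (t `^ (p^-1 - p1^-1) * w)%R
  H1 w1 y0 => hh yy ww H1 w1 hh0.
have p20 : (0 < 2 `^ p0^-1 :> R)%R by rewrite powR_gt0.
have yy0 : (0 <= yy)%R by rewrite -(pmulr_rge0 _ p20) (le_trans hh0).
have H2 : (K1 * hh <= K1 * (2 `^ p0^-1 * yy))%R by rewrite ler_pM2l.
have H3 : (0 <= K1 * yy)%R by rewrite mulr_ge0// ltW.
have H4 : (0 <= K0 * ww)%R by rewrite mulr_ge0// ltW.
have H5 : (0 <= K1 * 2 `^ p0^-1 * ww)%R by rewrite !mulr_ge0// ltW.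
rewrite /K; lra.
Qed.

(** The two terms of [rearr_interpolation] are exactly the left sides of [hardy_low] and
    [hardy_high]. *)
Lemma lorentz_interpolation (r : R) : (0 < r)%R -> exists2 C : R, (0 < C)%R &
  forall F, measurable_fun setT F -> (forall x, 0 <= F x) ->
  lorentz_int q r (rearr m (S F)) <= C%:E * lorentz_int p r (rearr m F).
Proof.
move=> r0; have [K K0 HK] := rearr_interpolation.
have [D0 D00 HD0] := hardy_low p0_gt0 p0p r0.
have [D1 D10 HD1] := hardy_high p_gt0 pp1 r0.
exists (K `^ r * 2 `^ r * (D0 + D1))%R.
  by rewrite mulr_gt0 ?addr_gt0// mulr_gt0 ?powR_gt0.
move=> F mF F0; pose phi := rearr m F.
have phi0 s : 0 <= phi s by exact: rearr_ge0.
have phih : {homo phi : s t / (s <= t)%R >-> t <= s} by exact: rearr_nonincreasing.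
pose X t := (t `^ (p^-1 - p0^-1))%:E * A phi t `^ p0^-1.
pose Y t := (t `^ (p^-1 - p1^-1))%:E * B phi t `^ p1^-1.
have X0 t : 0 <= X t by rewrite mule_ge0 ?poweR_ge0// lee_fin powR_ge0.
have Y0 t : 0 <= Y t by rewrite mule_ge0 ?poweR_ge0// lee_fin powR_ge0.
have mA : measurable_fun setT (fun t => A phi t `^ p0^-1).
  apply: measurable_fun_poweR; apply: nondecreasing_emeasurable => t u tu.
  apply: le_integral_nonneg => s; rewrite /= ?in_itv/= ?poweR_ge0 ?lexx//.
  by move=> /andP[-> /lt_le_trans]; apply.
have mB : measurable_fun setT (fun t => B phi t `^ p1^-1).
  apply: measurable_fun_poweR; apply: nonincreasing_emeasurable => t u tu.
  apply: le_integral_nonneg => s; rewrite /= ?in_itv/= ?poweR_ge0 ?lexx//.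
  by rewrite !andbT; exact: le_trans.
have mX : measurable_fun (`]0%R, +oo[%classic : set R) (fun t => X t `^ r * (t^-1)%:E).
  have := measurable_lorentz_integrand (p^-1 - p0^-1)^-1 r mA.
  by rewrite invrK.
have mY : measurable_fun (`]0%R, +oo[%classic : set R) (fun t => Y t `^ r * (t^-1)%:E).
  have := measurable_lorentz_integrand (p^-1 - p1^-1)^-1 r mB.
  by rewrite invrK.
have t0 t : (`]0%R, +oo[%classic : set R) t -> (0 < t)%R by rewrite /= in_itv/= andbT.
have X1 t : (`]0%R, +oo[%classic : set R) t -> 0 <= X t `^ r * (t^-1)%:E.
  by move=> /t0 ?; rewrite mule_ge0 ?poweR_ge0// lee_fin invr_ge0 ltW.
have Y1 t : (`]0%R, +oo[%classic : set R) t -> 0 <= Y t `^ r * (t^-1)%:E.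
  by move=> /t0 ?; rewrite mule_ge0 ?poweR_ge0// lee_fin invr_ge0 ltW.
have k0 : 0 <= (K `^ r * 2 `^ r)%:E by rewrite lee_fin mulr_ge0 ?powR_ge0.
have mI : measurable (`]0%R, +oo[%classic : set R) by exact: measurable_itv.
apply: (@le_trans _ _ (\int[leb]_(t in `]0%R, +oo[)
    ((K `^ r * 2 `^ r)%:E * (X t `^ r * (t^-1)%:E + Y t `^ r * (t^-1)%:E)))).
  apply: le_integral_nonneg => // t tI; last first.
    by apply: mule_ge0 => //; apply: adde_ge0; [exact: X1|exact: Y1].
  have {tI}tp := t0 _ tI; have tV : 0 <= (t^-1)%:E by rewrite lee_fin invr_ge0 ltW.
  rewrite lorentz_integrand_ge0//= -ge0_muleDl ?poweR_ge0//.
  rewrite muleA; apply: lee_wpmul2r => //.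
  apply: (@le_trans _ _ ((K%:E * (X t + Y t)) `^ r)).
    apply: lee_poweR; [exact: ltW| |exact: HK].
    by rewrite mule_ge0 ?rearr_ge0// lee_fin powR_ge0.
  rewrite poweRM ?adde_ge0 ?lee_fin ?(ltW K0)// poweR_EFin EFinM -muleA.
  apply: lee_wpmul2l; first by rewrite lee_fin powR_ge0.
  exact: poweR_add_le.
rewrite [leLHS](ge0_integralZl leb mI _ _ k0); last 2 first.
- exact: emeasurable_funD.
- by move=> t tI; apply: adde_ge0; [exact: X1|exact: Y1].
rewrite (EFinM (_ * _)%R) -muleA; apply: lee_wpmul2l => //.
rewrite [leLHS](ge0_integralD leb mI X1 mX Y1 mY) EFinD ge0_muleDl ?lee_fin ?(ltW D00) ?(ltW D10)//.
by apply: leeD; [exact: HD0|exact: HD1].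
Qed.

End interpolation.

(** * Comparison of Lorentz norms *)

Section lorentz_norms.
Local Open Scope ereal_scope.
Context {R : realType} {d : nat}.
Notation T := (Rd R d).
Notation mu := (@lebesgue R d).
Notation leb := (@lebesgue_measure R).
Implicit Types (f g : T -> \bar R) (V : T -> R) (Q : set T) (a b : R).

Lemma lorentz_normE a b f :
  lorentz_norm a b%:E f = ((b / a)%:E * lorentz_int a b (rearr mu f)) `^ b^-1.
Proof. by []. Qed.

Lemma lorentz_norm_ge0 a b f : 0 <= lorentz_norm a b%:E f.
Proof. exact: poweR_ge0. Qed.

Lemma le_lorentz_norm a b f g : (0 < a)%R -> (0 < b)%R -> measurable_fun setT f ->
  measurable_fun setT g -> (forall x, `|f x| <= `|g x|) ->
  lorentz_norm a b%:E f <= lorentz_norm a b%:E g.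
Proof.
move=> a0 b0 mf mg fg; rewrite !lorentz_normE.
have ba0 : 0 <= (b / a)%:E by rewrite lee_fin divr_ge0 ?ltW.
apply: lee_poweR; first by rewrite invr_ge0 ltW.
  by apply: mule_ge0; [exact: ba0|exact: lorentz_int_ge0].
apply: lee_wpmul2l; first exact: ba0.
apply: le_integral_nonneg => [|t|t]; first exact: subset_refl; last first.
  by rewrite /= in_itv/= andbT => t0; exact: lorentz_integrand_ge0.
rewrite /= in_itv/= andbT => t0; rewrite lorentz_integrand_ge0//=.
apply: lee_wpmul2r; first by rewrite lee_fin invr_ge0 ltW.
apply: lee_poweR; first exact: ltW.
  by rewrite mule_ge0 ?rearr_ge0// lee_fin powR_ge0.
by apply: lee_wpmul2l; [rewrite lee_fin powR_ge0|exact: le_rearr].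
Qed.

Lemma lorentz_norm_diag a f : (0 < a)%R -> measurable_fun setT f ->
  lorentz_norm a a%:E f = (\int[mu]_x `|f x| `^ a) `^ a^-1.
Proof.
move=> a0 mf; rewrite lorentz_normE mulfV ?gt_eqF// mul1e integral_rearr//.
congr (_ `^ _); apply: eq_integral => t.
rewrite inE/= in_itv/= andbT => t0.
rewrite poweRM ?rearr_ge0 ?lee_fin ?powR_ge0// poweR_EFin -powRrM mulVf ?gt_eqF//.
by rewrite powRr1 ?(ltW t0)// muleAC -EFinM mulfV ?gt_eqF// mul1e.
Qed.

(** [lorentz_int_embedding] with the normalising factors restored; the constant depends on the
    exponents only. *)
Lemma lorentz_norm_embedding a b1 b2 : (0 < a)%R -> (0 < b1)%R -> (b1 <= b2)%R ->
  exists2 C : R, (0 < C)%R & forall f,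
    lorentz_norm a b2%:E f <= C%:E * lorentz_norm a b1%:E f.
Proof.
move=> a0 b10 b12; have b20 := lt_le_trans b10 b12.
pose c : R := ((2 `^ (b1 / a) * 2) `^ ((b2 - b1) / b1))%R.
have c0 : (0 < c)%R by rewrite powR_gt0// mulr_gt0// powR_gt0.
pose C : R := ((b2 / a * c) `^ b2^-1 * (b1 / a) `^ (- b1^-1))%R.
have C0 : (0 < C)%R by rewrite mulr_gt0 ?powR_gt0 ?mulr_gt0 ?invr_gt0.
exists C => // f.
rewrite !lorentz_normE; set L1 := lorentz_int a b1 _; set L2 := lorentz_int a b2 _.
have L10 : 0 <= L1 by exact: lorentz_int_ge0.
have H : L2 <= c%:E * L1 `^ (b2 / b1).
  by apply: lorentz_int_embedding => //; [exact: rearr_ge0|exact: rearr_nonincreasing].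
have k2 : 0 <= (b2 / a)%:E by rewrite lee_fin divr_ge0 ?ltW.
have k1 : 0 <= (b1 / a)%:E by rewrite lee_fin divr_ge0 ?ltW.
apply: (@le_trans _ _ (((b2 / a * c)%:E * L1 `^ (b2 / b1)) `^ b2^-1)).
  apply: lee_poweR; first by rewrite invr_ge0 ltW.
    by apply: mule_ge0; [exact: k2|exact: lorentz_int_ge0].
  by rewrite (EFinM _ c) -muleA; apply: lee_wpmul2l.
rewrite !poweRM ?poweR_ge0//; last by rewrite lee_fin !mulr_ge0 ?invr_ge0 ?ltW.
rewrite -poweRrM !poweR_EFin muleA /C EFinM -(muleA _ _ ((b1 / a) `^ b1^-1)%:E).
rewrite -(EFinM ((b1 / a) `^ (- b1^-1))%R) -powRD; last first.
  by apply/implyP => _; rewrite gt_eqF// divr_gt0.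
rewrite addNr powRr0 mule1 (_ : (b2 / b1 / b2 = b1^-1)%R)//.
by field; rewrite !gt_eqF.
Qed.

Definition cube_norm a V Q : \bar R :=
  cube_average Q (fun x => (V x `^ a)%:E) `^ a^-1.

Lemma cube_norm_ge0 a V Q : 0 <= cube_norm a V Q.
Proof. exact: poweR_ge0. Qed.

Lemma cube_normE a V (c : T) l : (0 < l)%R -> cube_norm a V (cube c l) =
  ((l ^+ d) `^ (- a^-1))%:E * (\int[mu]_(x in cube c l) (V x `^ a)%:E) `^ a^-1.
Proof.
move=> l0; have m0 : (0 < l ^+ d)%R by rewrite exprn_gt0.
rewrite /cube_norm /cube_average lebesgue_cube// inver gt_eqF//.
rewrite poweRM ?lee_fin ?invr_ge0 ?(ltW m0)//; last first.
  by apply: integral_ge0 => x _; rewrite lee_fin powR_ge0.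
by rewrite poweR_EFin -(powR_inv1 (ltW m0)) -powRrM mulN1r.
Qed.

Lemma integral_patch_power a V Q : (0 < a)%R -> (forall x, 0 <= V x)%R ->
  \int[mu]_x `|((EFin \o V) \_ Q) x| `^ a = \int[mu]_(x in Q) (V x `^ a)%:E.
Proof.
move=> a0 V0; rewrite [RHS]integral_mkcond; apply: eq_integral => x _.
rewrite !patchE; case: ifPn => _; first by rewrite gee0_abs ?lee_fin//.
by rewrite abse0 poweR0r// gt_eqF.
Qed.

Lemma measurable_EFin_patch V Q : measurable Q -> measurable_fun setT V ->
  measurable_fun setT ((EFin \o V) \_ Q).
Proof.
move=> mQ mV; apply/(measurable_restrictT _ mQ).
exact/measurable_funTS/measurable_EFinP.
Qed.

Lemma cube_lorentz_norm_diag a V Q : is_cube Q -> (0 < a)%R ->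
  measurable_fun setT V -> (forall x, 0 <= V x)%R ->
  cube_lorentz_norm a a%:E Q (EFin \o V) = cube_norm a V Q.
Proof.
move=> [c [l [l0 ->]]] a0 mV V0; rewrite cube_normE// /cube_lorentz_norm.
rewrite lorentz_norm_diag//; last first.
  by apply: measurable_EFin_patch => //; exact: measurable_cube.
by rewrite integral_patch_power// lebesgue_cube.
Qed.

(** The rearrangement of [V] cut off to the cube vanishes beyond $|Q|$ and is at most $t^{-1/a_1}$
    times the $L^{a_1}$ norm before. What remains is the integral of $t^{e-1}$ over $(0, |Q|]$ with
    $e = b(1/a - 1/a_1) > 0$, for any second exponent. *)
Lemma cube_lorentz_norm_le a a1 b : (0 < a)%R -> (a < a1)%R -> (0 < b)%R ->
  exists2 C : R, (0 < C)%R & forall V Q, is_cube Q -> measurable_fun setT V ->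
    (forall x, 0 <= V x)%R ->
    cube_lorentz_norm a b%:E Q (EFin \o V) <= C%:E * cube_norm a1 V Q.
Proof.
move=> a0 aa1 b0; have a10 := lt_trans a0 aa1.
pose e : R := (b * (a^-1 - a1^-1))%R.
have e0 : (0 < e)%R by rewrite mulr_gt0// subr_gt0 ltf_pV2 ?posrE.
pose C : R := ((b / a / e) `^ b^-1)%R.
have C0 : (0 < C)%R by rewrite powR_gt0// !divr_gt0.
exists C => // V _ [c [l [l0 ->]]] mV V0.
rewrite cube_normE// /cube_lorentz_norm lebesgue_cube// lorentz_normE.
set Q := cube c l; pose m : R := (l ^+ d)%R; rewrite -/m.
have m0 : (0 < m)%R by rewrite exprn_gt0.
have mQ : measurable Q by exact: measurable_cube.
set F := (EFin \o V) \_ Q.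
have mF : measurable_fun setT F by exact: measurable_EFin_patch.
have F0 x : 0 <= F x by rewrite /F patchE; case: ifP => _ //=; rewrite lee_fin.
set I := (\int[mu]_(x in Q) _) `^ a1^-1.
have I0 : 0 <= I by exact: poweR_ge0.
have phiI t : (0 < t)%R -> rearr mu F t <= (t `^ (- a1^-1))%:E * I.
  move=> t0; apply: (le_trans (@rearr_le_strong _ _ _ mu _ _ _ mF F0 a10 t0)).
  rewrite /I -integral_patch_power// le_eqVlt; apply/orP; left; apply/eqP.
  congr (_ * _ `^ _); apply: eq_integral => x _; by rewrite gee0_abs.
have phi0 t : (m < t)%R -> rearr mu F t = 0.
  move=> mt; apply/eqP; rewrite eq_le rearr_ge0 andbT [_ <= _]rearr_le//.
  apply: (@le_trans _ _ (mu Q)); last by rewrite lebesgue_cube// lee_fin ltW.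
  apply: le_measure; rewrite ?inE//; first exact: measurable_superlevel.
  move=> x /=; rewrite /F patchE; case: ifPn => [/set_mem//|_].
  by rewrite abse0 ltxx.
have LI : lorentz_int a b (rearr mu F) <= I `^ b * (m `^ e / e)%:E.
  apply: (@le_trans _ _ (\int[leb]_(t in `]0%R, m]) (I `^ b * (t `^ (e - 1))%:E))).
    rewrite /lorentz_int integral_mkcond [leRHS]integral_mkcond.
    apply: le_integral_nonneg => [//|t _|t _]; last first.
      by rewrite patchE; case: ifP => _ //; rewrite mule_ge0 ?poweR_ge0// lee_fin powR_ge0.
    have J0 : 0 <= ((fun t => I `^ b * (t `^ (e - 1))%:E) \_ `]0%R, m]) t.
      by rewrite patchE; case: ifP => _ //; rewrite mule_ge0 ?poweR_ge0// lee_fin powR_ge0.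
    rewrite [X in 0 <= X <= _]patchE; case: ifPn => [|_]; last by rewrite lexx.
    rewrite inE/= in_itv/= andbT => t0; rewrite lorentz_integrand_ge0//=.
    have [mt|tm] := ltP m t.
      by rewrite phi0// mule0 poweR0r ?gt_eqF// mul0e.
    rewrite patchE mem_set/=; last by rewrite in_itv/= t0.
    apply: (@le_trans _ _ (((t `^ a^-1)%:E * ((t `^ (- a1^-1))%:E * I)) `^ b * (t^-1)%:E)).
      apply: lee_wpmul2r; first by rewrite lee_fin invr_ge0 ltW.
      apply: lee_poweR; first exact: ltW.
        by rewrite mule_ge0 ?rearr_ge0// lee_fin powR_ge0.
      by apply: lee_wpmul2l; [rewrite lee_fin powR_ge0|exact: phiI].
    rewrite muleA -EFinM -powRD; last by apply/implyP => _; rewrite gt_eqF.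
    rewrite poweRM ?lee_fin ?powR_ge0// poweR_EFin -powRrM [X in X * _]muleC -muleA.
    rewrite -EFinM -(powR_inv1 (ltW t0)) -powRD; last by apply/implyP => _; rewrite gt_eqF.
    by rewrite /e (mulrC b).
  rewrite [leLHS]ge0_integralZl.
  - apply: lee_wpmul2l; first exact: poweR_ge0.
    exact: integral_powR_0t.
  - exact: measurable_itv.
  - by apply/measurable_EFinP/measurable_funTS; exact: measurable_powR.
  - by move=> t _; rewrite lee_fin powR_ge0.
  - exact: poweR_ge0.
have ba0 : 0 <= (b / a)%:E by rewrite lee_fin divr_ge0 ?ltW.
have mp : 0 <= m%:E `^ (- a^-1) by exact: poweR_ge0.
apply: (@le_trans _ _ (m%:E `^ (- a^-1) * ((b / a)%:E * (I `^ b * (m `^ e / e)%:E)) `^ b^-1)).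
  apply: lee_wpmul2l => //; apply: lee_poweR; first by rewrite invr_ge0 ltW.
    by apply: mule_ge0; [exact: ba0|exact: lorentz_int_ge0].
  exact: lee_wpmul2l.
have -> : (b / a)%:E * (I `^ b * (m `^ e / e)%:E) = (b / a / e * m `^ e)%:E * I `^ b.
  by rewrite muleCA -EFinM muleC; congr (_%:E * _); ring.
rewrite poweRM ?poweR_ge0 ?lee_fin ?mulr_ge0 ?powR_ge0 ?invr_ge0 ?(ltW b0) ?(ltW a0) ?(ltW e0)//.
rewrite poweRK ?gt_eqF// !poweR_EFin !muleA -!EFinM; apply: lee_wpmul2r => //.
rewrite lee_fin le_eqVlt; apply/orP; left; apply/eqP.
rewrite powRM ?powR_ge0 ?mulr_ge0 ?invr_ge0 ?(ltW b0) ?(ltW a0) ?(ltW e0)//.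
rewrite -/C mulrCA -powRrM -powRD; last by apply/implyP => _; rewrite gt_eqF.
congr (_ * _ `^ _)%R; rewrite /e mulrAC mulfV ?gt_eqF// mul1r; ring.
Qed.

End lorentz_norms.

(** * Openness of the Muckenhoupt condition *)

Section muckenhoupt.
Local Open Scope ereal_scope.
Context {R : realType} {d : nat}.
Notation T := (Rd R d).
Notation mu := (@lebesgue R d).
Implicit Types (V W : T -> R) (Q : set T) (a b q p K : R).

(** Hölder's inequality against the constant 1, that is, Jensen for the normalised measure on the
    cube. *)
Lemma cube_norm_le a b V Q : is_cube Q -> (0 < a)%R -> (a <= b)%R ->
  measurable_fun setT V -> (forall x, 0 <= V x)%R ->
  cube_norm a V Q <= cube_norm b V Q.
Proof.
move=> [c [l [l0 ->]]] a0 ab mV V0; have b0 := lt_le_trans a0 ab.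
move: ab; rewrite le_eqVlt => /predU1P[->//|ab].
rewrite !cube_normE//; set Q' := cube c l; pose m : R := (l ^+ d)%R; rewrite -/m.
have m0 : (0 < m)%R by rewrite exprn_gt0.
have mQ : measurable Q' by exact: measurable_cube.
have ba0 : (0 < b / a)%R by rewrite divr_gt0.
pose s : R := (1 - a / b)^-1%R.
have sV0 : (0 < 1 - a / b)%R by rewrite subr_gt0 ltr_pdivrMr// mul1r.
have s0 : (0 < s)%R by rewrite invr_gt0.
have bas : ((b / a)^-1 + s^-1 = 1)%R by rewrite /s invrK invf_div addrC subrK.
have mVa r : measurable_fun Q' (fun x => (V x `^ r)%:E).
  apply/measurable_EFinP/measurable_funTS.
  exact: (measurableT_comp (measurable_powR r) mV).
have Va0 r x : Q' x -> 0 <= (V x `^ r)%:E by rewrite lee_fin powR_ge0.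
have := @ge0_hoelder _ T R mu Q' _ (cst 1) _ _ mQ (mVa a) (measurable_cst _) (Va0 a)
  (fun _ _ => lee01) ba0 s0 bas.
have -> : \int[mu]_(x in Q') ((V x `^ a)%:E * cst 1 x) =
    \int[mu]_(x in Q') (V x `^ a)%:E by apply: eq_integral => x _; rewrite mule1.
have -> : \int[mu]_(x in Q') (V x `^ a)%:E `^ (b / a) =
    \int[mu]_(x in Q') (V x `^ b)%:E.
  apply: eq_integral => x _; rewrite poweR_EFin -powRrM; congr (_ `^ _)%:E.
  by field; rewrite gt_eqF.
have -> : \int[mu]_(x in Q') cst 1 x `^ s = m%:E.
  rewrite (eq_integral (cst 1)); last by move=> x _; rewrite /= powR1.
  by rewrite integral_cst// mul1e; exact: lebesgue_cube.
set A := \int[mu]_(x in Q') _; set B := \int[mu]_(x in Q') _ => H.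
have B0 : 0 <= B by apply: integral_ge0 => x; exact: Va0.
have A0 : 0 <= A by apply: integral_ge0 => x; exact: Va0.
apply: (@le_trans _ _ ((m `^ (- a^-1))%:E *
    (B `^ (b / a)^-1 * m%:E `^ s^-1) `^ a^-1)).
  apply: lee_wpmul2l; first by rewrite lee_fin powR_ge0.
  by apply: lee_poweR => //; rewrite invr_ge0 ltW.
rewrite poweRM ?poweR_ge0// -!poweRrM poweR_EFin muleCA -EFinM muleC.
rewrite -powRD; last by apply/implyP => _; rewrite gt_eqF.
rewrite le_eqVlt; apply/orP; left; apply/eqP; congr ((_ `^ _)%:E * _ `^ _).
  by rewrite /s invrK; field; rewrite !gt_eqF.
by field; rewrite !gt_eqF.
Qed.

Definition muckenhoupt_bound q (p' : R) W K := forall Q, is_cube Q ->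
  cube_norm q W Q * cube_norm p' (fun x => (W x)^-1)%R Q <= K%:E.

Section positive_weight.
Variable W : T -> R.
Hypotheses (mW : measurable_fun setT W) (W0 : forall x, (0 < W x)%R).

Let mWV : measurable_fun setT (fun x => (W x)^-1)%R.
Proof.
rewrite (_ : (fun x => (W x)^-1)%R = (fun x => W x `^ (-1))%R).
  exact: (measurableT_comp (measurable_powR _) mW).
by apply/funext => x; rewrite powR_inv1// ltW.
Qed.

Let WV0 x : (0 < (W x)^-1)%R. Proof. by rewrite invr_gt0. Qed.

Lemma muckenhoupt_bound_le (q p' q1 p1' K : R) : muckenhoupt_bound q p' W K ->
  (0 < q1)%R -> (q1 <= q)%R -> (0 < p1')%R -> (p1' <= p')%R ->
  muckenhoupt_bound q1 p1' W K.
Proof.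
move=> H q10 q1q p10 p1p Q cQ; apply: le_trans (H Q cQ).
by apply: lee_pmul; rewrite ?cube_norm_ge0//; apply: cube_norm_le => // x; exact: ltW.
Qed.

(** The condition raised to the power $\theta = p'q/(p'+q)$: then the powers of the side length
    combine to a single factor $|Q|^{-1}$, and the exponents of the two integrals add up to 1. *)
Lemma muckenhoupt_weight_pair (q p' K : R) : (0 < q)%R -> (0 < p')%R -> (0 < K)%R ->
  muckenhoupt_bound q p' W K ->
  weight_pair (fun x => W x `^ q)%R (fun x => (W x)^-1 `^ p')%R
    (p' / (p' + q))%R (q / (p' + q))%R (K `^ (p' * q / (p' + q)))%R.
Proof.
move=> q0 p0 K0 H.
have pq0 : (0 < p' + q)%R by rewrite addr_gt0.
split.
- exact: (measurableT_comp (measurable_powR _) mW).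
- exact: (measurableT_comp (measurable_powR _) mWV).
- by move=> x; rewrite powR_gt0.
- by move=> x; rewrite powR_gt0.
split; rewrite ?divr_gt0 ?powR_gt0//; first by rewrite -mulrDl mulfV// gt_eqF.
split=> [x|_ [c [l [l0 ->]]]].
  rewrite -!powRrM -(powR_inv1 (ltW (W0 x))) -powRrM -powRD; last first.
    by apply/implyP => _; rewrite gt_eqF.
  rewrite (_ : (_ + _)%R = 0)%R ?powRr0//; ring.
have := H _ (ex_intro _ c (ex_intro _ l (conj l0 erefl))); rewrite !cube_normE//.
rewrite lebesgue_cube//.
pose m : R := (l ^+ d)%R; rewrite -/m; have m0 : (0 < m)%R by rewrite exprn_gt0.
set U := \int[mu]_(x in _) _; set S := \int[mu]_(x in _) _.
have U0 : 0 <= U by apply: integral_ge0 => x _; rewrite lee_fin powR_ge0.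
have S0 : 0 <= S by apply: integral_ge0 => x _; rewrite lee_fin powR_ge0.
pose th : R := (p' * q / (p' + q))%R.
have th0 : (0 < th)%R by rewrite divr_gt0// mulr_gt0.
rewrite muleACA -EFinM => H1; have := lee_poweR (ltW th0) _ H1.
rewrite !poweRM ?mule_ge0 ?poweR_ge0 ?lee_fin ?mulr_ge0 ?powR_ge0//.
rewrite -!poweRrM !poweR_EFin => /(_ isT).
rewrite (_ : (q^-1 * th = p' / (p' + q))%R); last by rewrite /th; field; rewrite !gt_eqF.
rewrite (_ : (p'^-1 * th = q / (p' + q))%R); last by rewrite /th; field; rewrite !gt_eqF.
rewrite -powRD; last by apply/implyP => _; rewrite gt_eqF.
rewrite -powRrM (_ : ((- q^-1 - p'^-1) * th = -1)%R); last first.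
  by rewrite /th; field; rewrite !gt_eqF.
rewrite powR_inv1 ?(ltW m0)// lee_pdivrMl// => /le_trans; apply.
by rewrite muleC.
Qed.

(** The reverse Hölder inequality holds for both weights of the pair, by the symmetry
    [weight_pairC], and with a common exponent gain, the smaller of the two. *)
Lemma muckenhoupt_bound_open (q p' K : R) : (0 < q)%R -> (0 < p')%R -> (0 < K)%R ->
  muckenhoupt_bound q p' W K ->
  exists e K' : R, [/\ (0 < e)%R, (0 < K')%R &
    muckenhoupt_bound (q * (1 + e)) (p' * (1 + e)) W K'].
Proof.
move=> q0 p0 K0 H; have WP := muckenhoupt_weight_pair q0 p0 K0 H.
have step V r e C Q : (0 < r)%R -> (0 < e)%R -> (0 < C)%R -> is_cube Q ->
    mu Q `^ e * \int[mu]_(x in Q) ((V x `^ r) `^ (1 + e))%:E <=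
    C%:E * (\int[mu]_(x in Q) (V x `^ r)%:E) `^ (1 + e) ->
    cube_norm (r * (1 + e)) V Q <= (C `^ (r * (1 + e))^-1)%:E * cube_norm r V Q.
  move=> r0 e0 C0 [c [l [l0 ->]]]; rewrite !cube_normE// lebesgue_cube//.
  pose m : R := (l ^+ d)%R; rewrite -/m; have m0 : (0 < m)%R by rewrite exprn_gt0.
  have re0 : (0 < r * (1 + e))%R by rewrite mulr_gt0// addr_gt0.
  have -> : \int[mu]_(x in cube c l) ((V x `^ r) `^ (1 + e))%:E =
      \int[mu]_(x in cube c l) (V x `^ (r * (1 + e)))%:E.
    by apply: eq_integral => x _; rewrite -powRrM.
  set I1 := \int[mu]_(x in _) _; set I := \int[mu]_(x in _) _.
  have I0 : 0 <= I by apply: integral_ge0 => x _; rewrite lee_fin powR_ge0.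
  have I10 : 0 <= I1 by apply: integral_ge0 => x _; rewrite lee_fin powR_ge0.
  rewrite poweR_EFin -lee_pdivlMl ?powR_gt0// => h.
  have reV : (0 <= (r * (1 + e))^-1)%R by rewrite invr_ge0 ltW.
  have {}h := lee_poweR reV I10 h.
  apply: (le_trans (lee_wpmul2l _ h)); first by rewrite lee_fin powR_ge0.
  rewrite !poweRM ?mule_ge0 ?poweR_ge0 ?lee_fin ?invr_ge0 ?powR_ge0 ?(ltW C0)//.
  rewrite -poweRrM !poweR_EFin.
  rewrite (_ : ((1 + e) / (r * (1 + e)) = r^-1)%R); last first.
    by field; rewrite !gt_eqF// addr_gt0.
  rewrite !muleA -!EFinM; apply: lee_wpmul2r; first exact: poweR_ge0.
  rewrite lee_fin le_eqVlt; apply/orP; left; apply/eqP.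
  rewrite mulrC; congr (_ * _)%R.
  rewrite -powRN -powRrM -powRD; last by apply/implyP => _; rewrite gt_eqF.
  by congr (_ `^ _)%R; field; rewrite !gt_eqF// addr_gt0.
have [eu eu0 RHu] := weight_pair_reverse_hoelder WP.
have [es es0 RHs] := weight_pair_reverse_hoelder (weight_pairC WP).
pose e := Num.min eu es.
have e0 : (0 < e)%R by rewrite lt_min eu0.
have [|Cu Cu0 {}RHu] := RHu e; first by rewrite e0 ge_min lexx.
have [|Cs Cs0 {}RHs] := RHs e; first by rewrite e0 ge_min lexx orbT.
exists e, (Cu `^ (q * (1 + e))^-1 * Cs `^ (p' * (1 + e))^-1 * K)%R; split => //.
  by rewrite !mulr_gt0 ?powR_gt0.
move=> Q cQ; have Hu := step W q e Cu Q q0 e0 Cu0 cQ (RHu Q cQ).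
have Hs := step (fun x => (W x)^-1)%R p' e Cs Q p0 e0 Cs0 cQ (RHs Q cQ).
apply: (le_trans (lee_pmul _ _ Hu Hs)); rewrite ?cube_norm_ge0//.
rewrite muleACA EFinM; apply: lee_pmul => //.
- by rewrite -EFinM lee_fin mulr_ge0 ?powR_ge0.
- by rewrite mule_ge0 ?cube_norm_ge0.
- exact: H.
Qed.

End positive_weight.
End muckenhoupt.

(** * The fractional maximal operator and its conjugate by the weight *)

Section fractional_maximal_function.
Local Open Scope ereal_scope.
Context {R : realType} {d : nat}.
Notation T := (Rd R d).
Notation mu := (@lebesgue R d).
Implicit Types (f g F : T -> \bar R) (W : T -> R) (Q : set T) (a b q p K : R).

Lemma hoelder_conjugate_EFin p : (1 < p)%R ->
  hoelder_conjugate p%:E = ((1 - p^-1)^-1)%:E :> \bar R.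
Proof.
move=> p1; have p0 : (0 < p)%R by exact: lt_trans p1.
rewrite /hoelder_conjugate/= eqe gt_eqF// -EFinB inver subr_eq0 gt_eqF// -EFinM.
by congr (_%:E); field; rewrite !gt_eqF// subr_gt0.
Qed.

Lemma conj_expE p : (1 < p)%R -> conj_exp p = ((1 - p^-1)^-1)%R.
Proof. by move=> p1; rewrite /conj_exp hoelder_conjugate_EFin. Qed.

(** A cube is enclosed in a rational cube whose side is larger by a factor as close to 1 as desired:
    the integral of $|f|$ can only grow, and the power of the volume is almost unchanged. *)
Lemma fractional_maximal_countable (alpha : R) f : (0 <= alpha)%R ->
  (alpha < d%:R)%R ->
  fractional_maximal alpha f = off_diag_maxop (alpha / d%:R - 1) (abse \o f).
Proof.
move=> al0 ald; apply/funext => x.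
have d0 : (0 < d%:R :> R)%R by exact: le_lt_trans ald.
pose e : R := (alpha / d%:R - 1)%R.
have e0 : (e < 0)%R by rewrite subr_lt0 ltr_pdivrMr// mul1r.
have valE (c : T) l : (0 < l)%R -> mu (cube c l) `^ (alpha / d%:R) *
    cube_average (cube c l) (abse \o f) =
    ((l ^+ d) `^ e)%:E * \int[mu]_(y in cube c l) (abse \o f) y.
  move=> l0; rewrite /cube_average lebesgue_cube//.
  have m0 : (0 < l ^+ d)%R by rewrite exprn_gt0.
  rewrite inver gt_eqF// muleA poweR_EFin -EFinM -(powR_inv1 (ltW m0)) -powRD//.
  by apply/implyP => _; rewrite gt_eqF.
have I0 Q : 0 <= \int[mu]_(y in Q) (abse \o f) y.
  by apply: integral_ge0 => y _; exact: abse_ge0.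
have t0 n : 0 <= mu (rat_cube n) `^ e * \int[mu]_(y in rat_cube n) (abse \o f) y.
  by rewrite mule_ge0 ?poweR_ge0.
apply/eqP; rewrite eq_le; apply/andP; split.
  apply: ge_ereal_sup => _ [Q [[c [l [l0 ->]]] Qx] <-]; rewrite valE//.
  apply/lee_mul01Pr => [|rho /andP[rho0 rho1]].
    by rewrite mule_ge0 ?I0// lee_fin powR_ge0.
  (* Dilating the side by [k] multiplies the volume power by exactly $k^{de} = \rho$; as $e < 0$ and
     $\rho < 1$, this is a genuine enlargement. *)
  pose k : R := (rho `^ (d%:R * e)^-1)%R.
  have de0 : (d%:R * e < 0)%R by rewrite pmulr_rlt0.
  have k1 : (1 < k)%R.
    by rewrite /k /powR gt_eqF// expR_gt1 nmulr_rgt0 ?invr_lt0// ln_lt0// rho0.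
  have [|n sub side] := @rat_cube_approx R d c l (l * (k - 1))%R l0.
    by rewrite mulr_gt0// subr_gt0.
  apply: le_trans (@le_csup _ _ _ _ _ n _ (sub _ Qx)).
  rewrite /rat_cube lebesgue_cube ?rat_side_gt0// muleA -EFinM.
  apply: lee_pmul => //; first by rewrite lee_fin mulr_ge0 ?powR_ge0 ?ltW.
    rewrite lee_fin; have rs0 := @rat_side_gt0 R d n.
    have kl0 : (0 < l * k)%R by rewrite mulr_gt0// (lt_trans _ k1).
    have H : (rat_side d n ^+ d <= (l * k) ^+ d)%R.
      rewrite lerXn2r ?nnegrE ?(ltW rs0) ?(ltW kl0)//.
      by rewrite (le_trans side)// mulrBr mulr1 addrC subrK.
    apply: (@le_trans _ _ (((l * k) ^+ d) `^ e)%R); last first.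
      have pe y : (y `^ e = (y `^ (- e))^-1)%R by rewrite powRN invrK.
      rewrite 2!pe lef_pV2 ?posrE ?powR_gt0 ?exprn_gt0//.
      by rewrite ge0_ler_powR ?nnegrE ?exprn_ge0 ?oppr_ge0 ?(ltW e0) ?(ltW rs0) ?(ltW kl0).
    rewrite exprMn powRM ?exprn_ge0 ?(ltW l0) ?powR_ge0// mulrC ler_pM2l ?powR_gt0 ?exprn_gt0//.
    rewrite /k -powR_mulrn ?powR_ge0// -!powRrM mulVf ?powRr1 ?(ltW rho0)//.
    by rewrite lt_eqF.
  apply: le_integral_nonneg => // y _; last exact: abse_ge0.
  by rewrite lexx abse_ge0.
apply: csup_le => [|n Qx].
  (* Any cube containing [x] shows that the left supremum is nonnegative, which covers the value 0
     that [csup] assigns to cubes missing [x]. *)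
  apply: (@le_trans _ _ (mu (cube x 1) `^ (alpha / d%:R) *
      cube_average (cube x 1) (abse \o f))).
    by rewrite valE// mule_ge0 ?I0// lee_fin powR_ge0.
  apply: ereal_sup_ubound; exists (cube x 1) => //; split; first by exists x, 1%R.
  by move=> i; apply/andP; split; [exact: lexx|rewrite lerDl ler01].
apply: ereal_sup_ubound; exists (rat_cube n).
  by split => //; exact: is_cube_rat_cube.
by rewrite /rat_cube valE ?rat_side_gt0// lebesgue_cube ?rat_side_gt0.
Qed.

Lemma measurable_off_diag_maxop (e : R) f : measurable_fun setT (off_diag_maxop e f).
Proof.
by apply: measurable_csup => n; apply: is_cube_measurable; exact: is_cube_rat_cube.
Qed.

Lemma off_diag_maxop_ge0 (e : R) f x : (forall y, 0 <= f y) ->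
  0 <= off_diag_maxop e f x.
Proof.
move=> f0; apply: csup_ge0 => n; apply: mule_ge0; first exact: poweR_ge0.
by apply: integral_ge0 => y _.
Qed.

Lemma off_diag_maxop_add (e : R) f g x : measurable_fun setT f ->
  measurable_fun setT g -> (forall y, 0 <= f y) -> (forall y, 0 <= g y) ->
  off_diag_maxop e (fun y => f y + g y) x <=
  off_diag_maxop e f x + off_diag_maxop e g x.
Proof.
move=> mf mg f0 g0; apply: csup_le => [|n Qx].
  by apply: adde_ge0; exact: off_diag_maxop_ge0.
have mQ : measurable (@rat_cube R d n) by apply: is_cube_measurable; exact: is_cube_rat_cube.
have If0 : 0 <= \int[mu]_(y in rat_cube n) f y by apply: integral_ge0.
have Ig0 : 0 <= \int[mu]_(y in rat_cube n) g y by apply: integral_ge0.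
rewrite (ge0_integralD mu mQ (fun y _ => f0 y) (measurable_funTS mf)
  (fun y _ => g0 y) (measurable_funTS mg)).
rewrite ge0_muleDr//; apply: leeD.
  exact: (@le_csup _ _ _ (fun n => mu (rat_cube n) `^ e * \int[mu]_(y in rat_cube n) f y)).
exact: (@le_csup _ _ _ (fun n => mu (rat_cube n) `^ e * \int[mu]_(y in rat_cube n) g y)).
Qed.

(** Conjugation by the weight moves it from the spaces into the operator: both endpoint estimates
    then live on unweighted spaces over Lebesgue measure, where interpolation applies directly. *)
Definition weighted_maxop (e : R) W F x : \bar R :=
  off_diag_maxop e (fun y => F y * ((W y)^-1)%:E) x * (W x)%:E.

Section positive_weight.
Variable W : T -> R.
Hypotheses (mW : measurable_fun setT W) (W0 : forall x, (0 < W x)%R).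

Let mWV : measurable_fun setT (fun x => (W x)^-1)%R.
Proof.
rewrite (_ : (fun x => (W x)^-1)%R = (fun x => W x `^ (-1))%R).
  exact: (measurableT_comp (measurable_powR _) mW).
by apply/funext => x; rewrite powR_inv1// ltW.
Qed.

Let mFW F : measurable_fun setT F -> measurable_fun setT (fun y => F y * ((W y)^-1)%:E).
Proof. by move=> mF; apply: (emeasurable_funM mF); exact/measurable_EFinP. Qed.

Let FW0 F : (forall x, 0 <= F x) -> forall y, 0 <= F y * ((W y)^-1)%:E.
Proof. by move=> F0 y; apply: (mule_ge0 (F0 y)); rewrite lee_fin invr_ge0; exact: ltW. Qed.

Lemma measurable_weighted_maxop (e : R) F : measurable_fun setT (weighted_maxop e W F).
Proof.
apply: emeasurable_funM; [exact: measurable_off_diag_maxop|exact/measurable_EFinP].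
Qed.

Lemma weighted_maxop_ge0 (e : R) F : (forall x, 0 <= F x) ->
  forall x, 0 <= weighted_maxop e W F x.
Proof.
move=> F0 x; apply: mule_ge0; last by rewrite lee_fin (ltW (W0 x)).
by apply: off_diag_maxop_ge0; exact: FW0.
Qed.

Lemma weighted_maxop_add (e : R) F g : measurable_fun setT F -> (forall x, 0 <= F x) ->
  measurable_fun setT g -> (forall x, 0 <= g x) ->
  forall x, weighted_maxop e W (fun x => F x + g x) x <=
    weighted_maxop e W F x + weighted_maxop e W g x.
Proof.
move=> mF F0 mg g0 x; rewrite /weighted_maxop.
rewrite -ge0_muleDl; [|by apply: off_diag_maxop_ge0; exact: FW0..].
apply: lee_wpmul2r; first by rewrite lee_fin (ltW (W0 x)).
rewrite (_ : (fun y => (F y + g y) * ((W y)^-1)%:E) =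
  (fun y => F y * ((W y)^-1)%:E + g y * ((W y)^-1)%:E)).
  by apply: off_diag_maxop_add; [exact: mFW|exact: mFW|exact: FW0|exact: FW0].
by apply/funext => y; rewrite (ge0_muleDl _ (F0 y) (g0 y)).
Qed.

(** [off_diag_strong_type] with $u = W^q$ and $\sigma = W^{-p'}$, the function $g$ being chosen so
    that $g\sigma = F/W$; then $g^p\sigma = F^p$. *)
Lemma weighted_maxop_strong_type p q K : (1 < p)%R -> (p <= q)%R -> (0 < K)%R ->
  muckenhoupt_bound q (1 - p^-1)^-1 W K ->
  exists2 C : R, (0 < C)%R & forall F, measurable_fun setT F -> (forall x, 0 <= F x) ->
    (\int[mu]_x weighted_maxop (p^-1 - q^-1 - 1) W F x `^ q) `^ q^-1 <=
    C%:E * (\int[mu]_x F x `^ p) `^ p^-1.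
Proof.
move=> p1 pq K0 HK.
have p0 : (0 < p)%R by exact: lt_trans p1.
have q0 : (0 < q)%R by exact: lt_le_trans pq.
have pV : (0 < 1 - p^-1)%R by rewrite subr_gt0 invf_lt1.
pose p' : R := ((1 - p^-1)^-1)%R; have p'0 : (0 < p')%R by rewrite invr_gt0.
have WP := muckenhoupt_weight_pair mW W0 q0 p'0 K0 HK.
have aE : ((p' / (p' + q))^-1 = 1 + q * (1 - p^-1))%R.
  have -> : (1 - p^-1 = p'^-1)%R by rewrite invrK.
  by field; rewrite !gt_eqF// addr_gt0.
have [C C0 HC] := off_diag_strong_type WP p1 pq aE.
exists (C `^ q^-1)%R; first exact: powR_gt0.
move=> F mF F0.
pose g x := F x * ((W x)^-1 * ((W x)^-1 `^ p')^-1)%:E.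
have mg : measurable_fun setT g.
  apply: (emeasurable_funM mF); apply/measurable_EFinP; apply: (measurable_funM mWV).
  rewrite (_ : (fun x => ((W x)^-1 `^ p')^-1)%R = (fun x => (W x) `^ p')%R).
    exact: (measurableT_comp (measurable_powR _) mW).
  apply/funext => x; rewrite -(powR_inv1 (ltW (W0 x))) -powRrM mulN1r.
  by rewrite powRN invrK.
have g0 x : 0 <= g x.
  apply: (mule_ge0 (F0 x)); rewrite lee_fin.
  by rewrite mulr_ge0 ?invr_ge0 ?powR_ge0 ?(ltW (W0 x)).
have := HC g mg g0.
have -> : (- ((p' / (p' + q))^-1 / q) = p^-1 - q^-1 - 1)%R.
  by rewrite aE; field; rewrite !gt_eqF.
have -> : (fun x => g x * ((W x)^-1 `^ p')%:E) = (fun x => F x * ((W x)^-1)%:E).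
  apply/funext => x; rewrite /g -muleA -EFinM mulfVK// gt_eqF// powR_gt0//.
  by rewrite invr_gt0.
have -> : \int[mu]_x (g x `^ p * ((W x)^-1 `^ p')%:E) = \int[mu]_x F x `^ p.
  apply: eq_integral => x _; rewrite /g poweRM//; last first.
    by rewrite lee_fin mulr_ge0 ?invr_ge0 ?powR_ge0 ?(ltW (W0 x)).
  rewrite poweR_EFin -muleA -EFinM; pose y : R := (W x)^-1%R; rewrite -/y.
  have y0 : (0 < y)%R by rewrite invr_gt0.
  rewrite powRM ?invr_ge0 ?powR_ge0 ?(ltW (W0 x))// -powRN -!powRrM.
  rewrite -!powRD; try by apply/implyP => _; rewrite gt_eqF.
  rewrite (_ : (p + - p' * p + p')%R = 0%R) ?powRr0 ?mule1//.
  by rewrite /p'; field; rewrite !gt_eqF// subr_gt0.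
set I := \int[mu]_x F x `^ p => H.
have I0 : 0 <= I by apply: integral_ge0 => x _; exact: poweR_ge0.
have qV : (0 <= q^-1)%R by rewrite invr_ge0 ltW.
apply: (@le_trans _ _ ((C%:E * I `^ (q / p)) `^ q^-1)); last first.
  rewrite poweRM ?poweR_ge0 ?lee_fin ?(ltW C0)// poweR_EFin -poweRrM.
  by rewrite (_ : (q / p / q = p^-1)%R)//; field; rewrite !gt_eqF.
apply: lee_poweR => //; first by apply: integral_ge0 => x _; exact: poweR_ge0.
apply: le_trans H; rewrite le_eqVlt; apply/orP; left; apply/eqP.
apply: eq_integral => x _; rewrite /weighted_maxop poweRM ?lee_fin ?(ltW (W0 x))//.
by apply: off_diag_maxop_ge0; exact: FW0.
Qed.

End positive_weight.
End fractional_maximal_function.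

(** * From the Muckenhoupt condition to the Lorentz conditions, and back from (i) *)

Section equivalences.
Local Open Scope ereal_scope.
Context {R : realType} {d : nat}.
Notation T := (Rd R d).
Notation mu := (@lebesgue R d).
Lemma ereal_sup_ltyP (S : set (\bar R)) :
  ereal_sup S < +oo <-> exists2 K : R, (0 < K)%R & forall x, S x -> x <= K%:E.
Proof.
split=> [|[K K0 H]]; last first.
  by apply: (@le_lt_trans _ _ K%:E); [exact: ge_ereal_sup|exact: ltry].
case E : (ereal_sup S) => [k| |]// _; last first.
  exists 1%R => // x Sx; apply: (le_trans (ereal_sup_ubound Sx)).
  by rewrite E leNye.
exists (Num.max k 1)%R; first by rewrite lt_max ltr01 orbT.
move=> x Sx; apply: (le_trans (ereal_sup_ubound Sx)).
by rewrite E lee_fin le_max lexx.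
Qed.

Variable W : T -> R.
Hypotheses (mW : measurable_fun setT W) (W0 : forall x, (0 < W x)%R).
Notation w := (EFin \o W).
Notation WV := (fun x => (W x)^-1)%R.

Let mWV : measurable_fun setT WV.
Proof.
rewrite (_ : WV = (fun x => W x `^ (-1))%R).
  exact: (measurableT_comp (measurable_powR _) mW).
by apply/funext => x; rewrite powR_inv1// ltW.
Qed.

Let WV0 x : (0 < WV x)%R. Proof. by rewrite invr_gt0. Qed.

Let W_ge0 x : (0 <= W x)%R. Proof. exact: ltW. Qed.
Let WV_ge0 x : (0 <= WV x)%R. Proof. exact: ltW. Qed.

Variables (alpha p q r s : R).
Hypotheses (alpha_ge0 : (0 <= alpha)%R) (alpha_ltd : (alpha < d%:R)%R)
  (p_gt1 : (1 < p)%R) (q_eq : (q^-1 = p^-1 - alpha / d%:R)%R)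
  (qV_gt0 : (0 < q^-1)%R)
  (p_le_r : (p <= r)%R) (r_le_s : (r <= s)%R) (s_le_q : (s <= q)%R).

Notation p' := (1 - p^-1)^-1%R.
Notation r' := (1 - r^-1)^-1%R.

Let p0 : (0 < p)%R. Proof. exact: lt_trans p_gt1. Qed.
Let q0 : (0 < q)%R. Proof. by rewrite -invr_gt0. Qed.
Let r1 : (1 < r)%R. Proof. exact: lt_le_trans p_le_r. Qed.
Let r0 : (0 < r)%R. Proof. exact: lt_le_trans p_le_r. Qed.
Let s0 : (0 < s)%R. Proof. exact: lt_le_trans r_le_s. Qed.
Let pV : (0 < 1 - p^-1)%R. Proof. by rewrite subr_gt0 invf_lt1. Qed.
Let rV : (0 < 1 - r^-1)%R. Proof. by rewrite subr_gt0 invf_lt1. Qed.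
Let p'0 : (0 < p')%R. Proof. by rewrite invr_gt0. Qed.
Let r'0 : (0 < r')%R. Proof. by rewrite invr_gt0. Qed.
Let rp' : (r' <= p')%R.
Proof. by rewrite lef_pV2 ?posrE// lerD2l lerN2 lef_pV2 ?posrE. Qed.

Lemma muckenhoupt_AP :
  muckenhoupt_A p q w <-> exists2 K : R, (0 < K)%R & muckenhoupt_bound q p' W K.
Proof.
have E Q : cube_average Q (fun x => w x `^ q) `^ q^-1 *
    cube_average Q (fun x => w x `^ (- conj_exp p)) `^ (conj_exp p)^-1 =
    cube_norm q W Q * cube_norm p' WV Q.
  have E2 : (fun x => w x `^ (- p')) = (fun x => (WV x `^ p')%:E).
    apply/funext => x; rewrite -(powR_inv1 (W_ge0 x)) -powRrM mulN1r.
    exact: poweR_EFin.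
  by rewrite (conj_expE p_gt1) E2.
rewrite /muckenhoupt_A; split.
  move=> /ereal_sup_ltyP[K K0 H]; exists K => // Q cQ.
  by rewrite -E; apply: H; exists Q.
move=> [K K0 H]; apply/ereal_sup_ltyP; exists K => // _ [Q cQ <-].
by rewrite E; exact: H.
Qed.

Let invE : (fun x => (w x)^-1) = EFin \o WV.
Proof. by apply/funext => x; rewrite /= inver gt_eqF. Qed.

Let lorentz_AE Q : cube_lorentz_norm q s%:E Q w *
    cube_lorentz_norm (conj_exp p) (hoelder_conjugate r%:E) Q (fun x => (w x)^-1) =
    cube_lorentz_norm q s%:E Q w * cube_lorentz_norm p' r'%:E Q (EFin \o WV).
Proof. by rewrite (conj_expE p_gt1) (hoelder_conjugate_EFin r1) invE. Qed.

(** The embedding applies to both factors because $s \le q$ and, by duality from $p \le r$, also $r'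
    \le p'$. *)
Lemma lorentz_A_muckenhoupt : lorentz_A p r%:E q s%:E w -> muckenhoupt_A p q w.
Proof.
rewrite /lorentz_A => /ereal_sup_ltyP[K K0 H]; apply/muckenhoupt_AP.
have [C1 C10 H1] := @lorentz_norm_embedding R d q s q q0 s0 s_le_q.
have [C2 C20 H2] := @lorentz_norm_embedding R d p' r' p' p'0 r'0 rp'.
exists (C1 * C2 * K)%R; first by rewrite !mulr_gt0.
move=> Q cQ; rewrite -!cube_lorentz_norm_diag//.
have HQ : cube_lorentz_norm q s%:E Q w *
    cube_lorentz_norm p' r'%:E Q (EFin \o WV) <= K%:E.
  by rewrite -lorentz_AE; apply: H; exists Q.
rewrite EFinM; apply: le_trans (lee_wpmul2l _ HQ); last first.
  by rewrite lee_fin mulr_ge0 ?(ltW C10) ?(ltW C20).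
rewrite EFinM [leRHS]muleACA.
have m0 a : 0 <= mu Q `^ a by exact: poweR_ge0.
have nn a b f : 0 <= cube_lorentz_norm a b%:E Q f.
  by apply: mule_ge0; [exact: m0|exact: lorentz_norm_ge0].
apply: lee_pmul; [exact: nn|exact: nn| |].
  by rewrite /cube_lorentz_norm muleCA; apply: lee_wpmul2l.
by rewrite /cube_lorentz_norm muleCA; apply: lee_wpmul2l.
Qed.

(** The room gained by openness in the first exponents pays for the smaller second exponents,
    through [cube_lorentz_norm_le]. *)
Lemma muckenhoupt_lorentz_A : muckenhoupt_A p q w -> lorentz_A p r%:E q s%:E w.
Proof.
move=> /muckenhoupt_AP[K0' K00 HK0].
have [e [K [e0 K0 HK]]] := muckenhoupt_bound_open mW W0 q0 p'0 K00 HK0.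
have [C1 C10 H1] := @cube_lorentz_norm_le R d q (q * (1 + e)) s q0
  (ltac:(by rewrite ltr_pMr// ltrDl)) s0.
have [C2 C20 H2] := @cube_lorentz_norm_le R d p' (p' * (1 + e)) r' p'0
  (ltac:(by rewrite ltr_pMr// ltrDl)) r'0.
apply/ereal_sup_ltyP; exists (C1 * C2 * K)%R; first by rewrite !mulr_gt0.
move=> _ [Q cQ <-]; rewrite lorentz_AE.
apply: (le_trans (lee_pmul _ _ (H1 W Q cQ mW W_ge0) (H2 WV Q cQ mWV WV_ge0))).
- by apply: mule_ge0; [exact: poweR_ge0|exact: lorentz_norm_ge0].
- by apply: mule_ge0; [exact: poweR_ge0|exact: lorentz_norm_ge0].
rewrite [leLHS]muleACA -EFinM (EFinM _ K); apply: lee_wpmul2l.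
  by rewrite lee_fin mulr_ge0 ?(ltW C10) ?(ltW C20).
exact: HK.
Qed.

(** Openness supplies strong type bounds at two exponent pairs around $(p,q)$; interpolation gives
    $L^{p,r} \to L^{q,r}$, and the embedding raises the target exponent from $r$ to $s$. *)
Lemma muckenhoupt_bounded : muckenhoupt_A p q w ->
  bounded_weighted_lorentz p r%:E q s%:E w (fractional_maximal alpha).
Proof.
move=> /muckenhoupt_AP[K0' K00 HK0].
have [e [K [e0 K0 HK]]] := muckenhoupt_bound_open mW W0 q0 p'0 K00 HK0.
pose g : R := (alpha / d%:R)%R.
(* The exponents 1/p and 1/q are both moved by de in either direction. *)
pose de : R := (e / (1 + e) / (p' + q))%R.
have e10 : (0 < 1 + e)%R by rewrite addr_gt0.
have pq0 : (0 < p' + q)%R by rewrite addr_gt0.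
have de0 : (0 < de)%R by rewrite !divr_gt0.
have dep : (de * p' < e / (1 + e))%R.
  rewrite /de mulrAC ltr_pdivrMr// ltr_pM2l ?divr_gt0// ltrDl//.
have deq : (de * q < e / (1 + e))%R.
  by rewrite /de mulrAC ltr_pdivrMr// ltr_pM2l ?divr_gt0// ltrDr.
have e1e : (e / (1 + e) = 1 - (1 + e)^-1)%R by field; rewrite gt_eqF.
have eV : (0 < (1 + e)^-1)%R by rewrite invr_gt0.
have p'V : (p'^-1 = 1 - p^-1)%R by rewrite invrK.
have dep' : (de < (1 - (1 + e)^-1) * (1 - p^-1))%R.
  by rewrite -p'V ltr_pdivlMr// -e1e.
have deq' : (de < (1 - (1 + e)^-1) * q^-1)%R.
  by rewrite ltr_pdivlMr// -e1e.
have gpq : (g = p^-1 - q^-1)%R by rewrite q_eq opprB addrC subrK.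
pose P0 : R := (p^-1 + de)^-1%R; pose P1 : R := (p^-1 - de)^-1%R.
pose Q0 : R := (q^-1 + de)^-1%R; pose Q1 : R := (q^-1 - de)^-1%R.
have g0 : (0 <= g)%R by rewrite divr_ge0.
have pVq : (q^-1 <= p^-1)%R by rewrite q_eq gerBl.
have deqV : (de < q^-1)%R.
  by apply: (lt_le_trans deq'); rewrite ler_piMl ?(ltW qV_gt0)// gerBl ltW.
have dep1 : (de < 1 - p^-1)%R.
  by apply: (lt_le_trans dep'); rewrite ler_piMl ?(ltW pV)// gerBl ltW.
have pVp : (0 < p^-1)%R by rewrite invr_gt0.
have P0V : (0 < p^-1 + de)%R by rewrite addr_gt0.
have Q0V : (0 < q^-1 + de)%R by rewrite addr_gt0.
have Q1V : (0 < q^-1 - de)%R by rewrite subr_gt0.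
have P1V : (0 < p^-1 - de)%R by rewrite subr_gt0 (lt_le_trans deqV).
(* Shifting $1/p$ and $1/q$ by the same [dd] preserves their difference, hence the operator. By the
   smallness of [de], the shifted $q$ and the shifted conjugate exponent stay below $q(1+e)$ and
   $p'(1+e)$, so [muckenhoupt_bound_le] provides the condition. *)
have strong (dd : R) : (0 < p^-1 + dd)%R -> (p^-1 + dd < 1)%R -> (0 < q^-1 + dd)%R ->
    (- de <= dd <= de)%R ->
    exists2 C : R, (0 < C)%R & forall F, measurable_fun setT F -> (forall x, 0 <= F x) ->
    (\int[mu]_x weighted_maxop (g - 1) W F x `^ (q^-1 + dd)^-1) `^ (q^-1 + dd)^-1^-1 <=
    C%:E * (\int[mu]_x F x `^ (p^-1 + dd)^-1) `^ (p^-1 + dd)^-1^-1.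
  move=> pd0 pd1 qd0 /andP[dd1 dd2].
  have -> : (g - 1 = (p^-1 + dd)^-1^-1 - (q^-1 + dd)^-1^-1 - 1)%R.
    by rewrite !invrK gpq; ring.
  apply: (@weighted_maxop_strong_type _ _ W mW W0 _ _ K) => //.
  - by rewrite invf_gt1.
  - by rewrite lef_pV2 ?posrE// lerD2r.
  rewrite invrK.
  have b1 : (0 < 1 - (p^-1 + dd))%R by rewrite subr_gt0.
  apply: (muckenhoupt_bound_le mW W0 HK); rewrite ?invr_gt0//.
    rewrite -[leRHS]invrK lef_pV2 ?posrE ?invr_gt0 ?mulr_gt0//.
    by rewrite invfM; nra.
  rewrite -[leRHS]invrK lef_pV2 ?posrE ?invr_gt0 ?mulr_gt0//.
  by rewrite invfM invrK; nra.
have [||||C0 C00 S0] := strong de => //; first by lra.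
  by rewrite lexx andbT; lra.
have [||||C1 C10 S1] := strong (- de)%R => //; first by lra.
  by rewrite lexx /=; lra.
have P0p : (P0 < p)%R by rewrite /P0 -[ltRHS]invrK ltf_pV2 ?posrE// ltrDl.
have pP1 : (p < P1)%R by rewrite /P1 -[ltLHS]invrK ltf_pV2 ?posrE// gtrBl.
have [C C_gt0 HC] := @lorentz_interpolation R _ T mu (weighted_maxop (g - 1) W)
  (fun F _ _ => measurable_weighted_maxop mW (g - 1) F)
  (fun F _ F0 => weighted_maxop_ge0 W0 (g - 1) F0)
  (fun F G mF F0 mG G0 => weighted_maxop_add mW W0 (g - 1) mF F0 mG G0)
  p q P0 Q0 P1 Q1 C0 C1 (ltac:(by rewrite invr_gt0)) P0p pP1
  (ltac:(by rewrite invr_gt0)) (ltac:(by rewrite invr_gt0))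
  (ltac:(by rewrite !invrK; ring)) (ltac:(by rewrite !invrK; ring)) C00 C10 S0 S1 r r0.
have [D D0 HD] := @lorentz_norm_embedding R d q r s q0 r0 r_le_s.
pose k : R := (D * ((p / q) * C) `^ r^-1)%R.
exists k => f [mf fin].
pose F x := `|f x| * (W x)%:E.
have mF : measurable_fun setT F.
  apply: emeasurable_funM; last exact/measurable_EFinP.
  exact: measurableT_comp.
have F0 x : 0 <= F x by rewrite mule_ge0 ?lee_fin.
have SF : fractional_maximal alpha f \* w = weighted_maxop (g - 1) W F.
  have FE : (fun y => F y * ((W y)^-1)%:E) = abse \o f.
    apply/funext => y; rewrite /F -muleA -EFinM mulfV ?gt_eqF//.
    exact: mule1.
  rewrite (fractional_maximal_countable _ alpha_ge0 alpha_ltd).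
  by apply/funext => x; rewrite /weighted_maxop FE.
have mfw : measurable_fun setT (f \* w).
  by apply: (emeasurable_funM mf); exact/measurable_EFinP.
have FN : lorentz_norm p r%:E F <= weighted_lorentz_norm p r%:E w f.
  apply: (le_lorentz_norm p0 r0 mF mfw) => x.
  by rewrite /F !abseM abse_id.
have main : weighted_lorentz_norm q s%:E w (fractional_maximal alpha f) <=
    k%:E * weighted_lorentz_norm p r%:E w f.
  rewrite {1}/weighted_lorentz_norm SF.
  apply: (le_trans (HD _)); rewrite /k EFinM -muleA.
  apply: lee_wpmul2l; first by rewrite lee_fin ltW.
  apply: (@le_trans _ _ (((p / q * C) `^ r^-1)%:E * lorentz_norm p r%:E F)); last first.
    by apply: lee_wpmul2l => //; rewrite lee_fin powR_ge0.
  have LF : 0 <= lorentz_int p r (rearr mu F) by exact: lorentz_int_ge0.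
  have rp0 : 0 <= (r / p)%:E by rewrite lee_fin divr_ge0 ?ltW.
  have rq0 : 0 <= (r / q)%:E by rewrite lee_fin divr_ge0 ?ltW.
  rewrite !lorentz_normE -poweR_EFin -poweRM; last 2 first.
  - by rewrite lee_fin !mulr_ge0 ?invr_ge0 ?ltW.
  - by apply: mule_ge0; [exact: rp0|exact: LF].
  apply: lee_poweR; first by rewrite invr_ge0 ltW.
    by apply: mule_ge0; [exact: rq0|exact: lorentz_int_ge0].
  apply: (le_trans (lee_wpmul2l rq0 (HC F mF F0))).
  rewrite !muleA -!EFinM le_eqVlt; apply/orP; left; apply/eqP.
  by congr (_%:E * _); field; rewrite !gt_eqF.
split => //; split.
  rewrite (fractional_maximal_countable _ alpha_ge0 alpha_ltd).
  exact: measurable_off_diag_maxop.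
apply: (le_lt_trans main).
have N0 : 0 <= weighted_lorentz_norm p r%:E w f by exact: lorentz_norm_ge0.
move: fin N0; case: weighted_lorentz_norm => [y| |]// _ _.
by rewrite -EFinM ltry.
Qed.

End equivalences.

(** * Necessity of the Muckenhoupt condition *)

Section necessity.
Local Open Scope ereal_scope.
Context {R : realType} {d : nat}.
Notation T := (Rd R d).
Notation mu := (@lebesgue R d).
Variable W : T -> R.
Hypotheses (mW : measurable_fun setT W) (W0 : forall x, (0 < W x)%R).
Notation w := (EFin \o W).
Notation WV := (fun x => (W x)^-1)%R.
Variables (alpha p q r s : R).
Hypotheses (p_gt1 : (1 < p)%R) (q_eq : (q^-1 = p^-1 - alpha / d%:R)%R)
  (qV_gt0 : (0 < q^-1)%R)
  (p_le_r : (p <= r)%R) (r_le_s : (r <= s)%R) (s_le_q : (s <= q)%R).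
Notation p' := (1 - p^-1)^-1%R.

Let p0 : (0 < p)%R. Proof. exact: lt_trans p_gt1. Qed.
Let q0 : (0 < q)%R. Proof. by rewrite -invr_gt0. Qed.
Let r0 : (0 < r)%R. Proof. exact: lt_le_trans p_le_r. Qed.
Let s0 : (0 < s)%R. Proof. exact: lt_le_trans r_le_s. Qed.
Let pV : (0 < 1 - p^-1)%R. Proof. by rewrite subr_gt0 invf_lt1. Qed.
Let p'0 : (0 < p')%R. Proof. by rewrite invr_gt0. Qed.

Let sg x : R := (WV x `^ p')%R.

Let sg0 x : (0 < sg x)%R. Proof. by rewrite powR_gt0// invr_gt0. Qed.

Let sg_ge0 x : (0 <= sg x)%R. Proof. exact: ltW. Qed.

Let msg : measurable_fun setT sg.
Proof.
rewrite (_ : sg = (fun x => W x `^ (- p'))%R).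
  exact: (measurableT_comp (measurable_powR _) mW).
apply/funext => x.
by rewrite /sg -(powR_inv1 (ltW (W0 x))) -powRrM mulN1r.
Qed.

(** Since $(1 - p')p = -p'$: the $p$-th power of the weighted $L^p$ norm of $\sigma 1_E$ is
    therefore $\sigma(E)$ itself. *)
Let sgW x : ((sg x * W x) `^ p = sg x)%R.
Proof.
rewrite /sg -{2}[W x]invrK -[((W x)^-1)^-1%R]powR_inv1 ?invr_ge0 ?(ltW (W0 x))//.
rewrite -powRD; last by apply/implyP => _; rewrite gt_eqF// invr_gt0.
rewrite -powRrM; congr (_ `^ _)%R.
by field; rewrite !gt_eqF// subr_gt0.
Qed.

(* The maximal operator is tested on sg restricted to a set where sg is bounded. *)
Let testing : bounded_weighted_lorentz p r%:E q s%:E w (fractional_maximal alpha) ->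
  exists2 K : R, (0 < K)%R & forall (c : T) l E, (0 < l)%R -> measurable E ->
    E `<=` cube c l -> \int[mu]_(x in E) (sg x)%:E < +oo ->
    ((l ^+ d) `^ (p^-1 - q^-1 - 1))%:E * (\int[mu]_(x in cube c l) (W x `^ q)%:E) `^ q^-1 *
    \int[mu]_(x in E) (sg x)%:E <= K%:E * (\int[mu]_(x in E) (sg x)%:E) `^ p^-1.
Proof.
move=> [C HC].
have [A A0 HA] := @lorentz_norm_embedding R d p p r p0 p0 p_le_r.
have [B B0 HB] := @lorentz_norm_embedding R d q s q q0 s0 s_le_q.
(* Boundedness only provides some real [C], of unknown sign; a positive constant is wanted. *)
have C10 : (0 < Num.max C 1)%R by rewrite lt_max ltr01 orbT.
exists (B * Num.max C 1 * A)%R; first by rewrite !mulr_gt0.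
move=> c l E l0 mE EQ; set Q := cube c l in EQ *.
set S := \int[mu]_(x in E) _ => Sfin.
set U := \int[mu]_(x in Q) _.
have cQ : is_cube Q by exists c, l.
have mQ : measurable Q by exact: measurable_cube.
have m0 : (0 < l ^+ d)%R by rewrite exprn_gt0.
have S0 : 0 <= S by apply: integral_ge0 => x _; rewrite lee_fin.
pose f := (EFin \o sg) \_ E.
have mf : measurable_fun setT f by exact: measurable_EFin_patch.
have mfw : measurable_fun setT (f \* w).
  by apply: (emeasurable_funM mf); exact/measurable_EFinP.
have fwE : lorentz_norm p p%:E (f \* w) = S `^ p^-1.
  rewrite (lorentz_norm_diag p0 mfw) /S [in RHS]integral_mkcond.
  congr (_ `^ _); apply: eq_integral => x _; rewrite /f /= !patchE.
  case: ifPn => _; last by rewrite mul0e abse0 poweR0r// gt_eqF.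
  rewrite -EFinM abse_EFin ger0_norm; last by rewrite mulr_ge0// ltW.
  by rewrite poweR_EFin sgW.
have fin : weighted_lorentz p r%:E w f.
  split=> //; apply: (le_lt_trans (HA (f \* w))); rewrite fwE.
  have [y ->] : exists y, S = y%:E by exists (fine S); rewrite fineK// ge0_fin_numE.
  by rewrite poweR_EFin -EFinM ltry.
have [[mMf _] Mf] := HC f fin.
have mMw : measurable_fun setT (fractional_maximal alpha f \* w).
  by apply: (emeasurable_funM mMf); exact/measurable_EFinP.
have up : lorentz_norm q q%:E (fractional_maximal alpha f \* w) <=
    (B * Num.max C 1 * A)%:E * S `^ p^-1.
  apply: (le_trans (HB _)); rewrite -mulrA EFinM -[leRHS]muleA.
  apply: lee_wpmul2l; first by rewrite lee_fin ltW.
  apply: (le_trans Mf).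
  apply: (@le_trans _ _ ((Num.max C 1)%:E * weighted_lorentz_norm p r%:E w f)).
    apply: lee_wpmul2r; first exact: lorentz_norm_ge0.
    by rewrite lee_fin le_max lexx.
  rewrite EFinM -muleA; apply: lee_wpmul2l; first by rewrite lee_fin ltW.
  by rewrite -fwE; exact: HA.
apply: le_trans up; rewrite (lorentz_norm_diag q0 mMw).
pose k : R := ((l ^+ d) `^ (p^-1 - q^-1 - 1))%R.
have k0 : 0 <= k%:E by rewrite lee_fin powR_ge0.
have kS0 : 0 <= k%:E * S by exact: mule_ge0.
rewrite -/k muleAC -[X in X * _](@poweRK _ q) ?gt_eqF//.
have Uge0 : 0 <= U by apply: integral_ge0 => x _; rewrite lee_fin powR_ge0.
rewrite -(poweRM _ (poweR_ge0 _ _) Uge0); apply: lee_poweR; first exact: ltW.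
  by apply: mule_ge0; [exact: poweR_ge0|exact: Uge0].
have mU : measurable_fun Q (fun x => (W x `^ q)%:E).
  apply/measurable_EFinP/measurable_funTS.
  exact: (measurableT_comp (measurable_powR q) mW).
have U0 x : Q x -> 0 <= (W x `^ q)%:E by rewrite lee_fin powR_ge0.
rewrite -(ge0_integralZl mu mQ mU U0 (poweR_ge0 _ _)).
apply: le_integral_nonneg => [//|x Qx|x _]; last exact: poweR_ge0.
apply/andP; split; first by apply: mule_ge0; [exact: poweR_ge0|exact: U0].
rewrite -poweR_EFin -poweRM ?lee_fin ?(ltW (W0 x))//.
have W0x : 0 <= (W x)%:E by rewrite lee_fin ltW.
apply: lee_poweR; [exact: ltW|exact: mule_ge0|].
rewrite abseM (gee0_abs W0x); apply: lee_wpmul2r => //.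
(* At each point of [Q] the cube [Q] itself competes in the supremum, and its average is computed
   from $\sigma(E)$. *)
apply: le_trans (lee_abs _).
apply: ereal_sup_ubound; exists Q => //.
rewrite /cube_average lebesgue_cube// inver gt_eqF// muleA poweR_EFin -EFinM.
rewrite /k -(powR_inv1 (ltW m0)) -powRD; last by apply/implyP => _; rewrite gt_eqF.
congr ((_ `^ _)%:E * _); first by rewrite q_eq; ring.
rewrite /S [LHS]integral_mkcond [RHS]integral_mkcond.
apply: eq_integral => x0 _; rewrite /f !patchE /=.
case: ifPn => xQ; last first.
  case: ifPn => // /set_mem /EQ xQ'; by move/negP: xQ; rewrite mem_set.
rewrite patchE; case: ifPn => _; last by rewrite abse0.
by rewrite gee0_abs// lee_fin.
Qed.

(** The testing inequality should be divided by $\sigma(E)^{1/p}$, which requires $\sigma(E)$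
    finite. So [E] runs through the parts of the cube where $\sigma \le n$, and continuity from
    below restores the full cube. *)
Lemma bounded_muckenhoupt :
  bounded_weighted_lorentz p r%:E q s%:E w (fractional_maximal alpha) ->
  muckenhoupt_A p q w.
Proof.
move=> /testing[K K0 H]; apply/(muckenhoupt_AP W0 q p_gt1).
exists K => // _ [c [l [l0 ->]]]; rewrite !cube_normE//.
set Q := cube c l; set U := \int[mu]_(x in Q) _.
pose S := density mu msg sg_ge0.
rewrite [X in _ * _ * (_ * X `^ _)](_ : _ = S Q)//.
have mQ : measurable Q by exact: measurable_cube.
have m0 : (0 < l ^+ d)%R by rewrite exprn_gt0.
have U0 : 0 <= U by apply: integral_ge0 => x _; rewrite lee_fin powR_ge0.
pose k : R := ((l ^+ d) `^ (p^-1 - q^-1 - 1))%R.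
have k0 : (0 < k)%R by rewrite powR_gt0.
rewrite muleACA -EFinM -powRD; last by apply/implyP => _; rewrite gt_eqF.
rewrite (_ : (- q^-1 - p'^-1 = p^-1 - q^-1 - 1)%R); last by rewrite invrK; ring.
rewrite -/k muleA; set X := k%:E * U `^ q^-1.
have X0 : 0 <= X by rewrite mule_ge0 ?poweR_ge0// lee_fin ltW.
have Xgt : 0 < X.
  rewrite mule_gt0 ?lte_fin//; apply: poweR_gt0.
  apply: (@integral_pos_gt0 _ _ _ (fun x => W x `^ q)%R mQ).
  - exact: (measurableT_comp (measurable_powR q) mW).
  - by move=> x; rewrite powR_gt0.
  - by rewrite lebesgue_cube// lte_fin.
pose E n := Q `&` [set x | (sg x <= n%:R)%R].
have mE n : measurable (E n).
  apply: measurableI => //; rewrite -[X in measurable X]setTI.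
  rewrite (_ : [set x | _] = sg @^-1` `]-oo, n%:R]).
    by apply: (msg) => //; exact: measurable_itv.
  by apply/funext => x /=; apply/propext; rewrite in_itv.
have ES n : S (E n) < +oo.
  apply: (@le_lt_trans _ _ (n%:R%:E * mu (E n))).
    rewrite -integral_cst//; apply: le_integral_nonneg => [//|x [_ /= sn]|x _].
      by rewrite !lee_fin sn sg_ge0.
    by rewrite lee_fin.
  apply: (@le_lt_trans _ _ (n%:R%:E * mu Q)).
    by apply: lee_wpmul2l => //; apply: le_measure; rewrite ?inE// => x [].
  by rewrite lebesgue_cube// -EFinM ltry.
have XE n : X * S (E n) `^ p'^-1 <= K%:E.
  have : X * S (E n) <= K%:E * S (E n) `^ p^-1.
    exact: (H c l (E n) l0 (mE n) (@subIsetl _ _ _) (ES n)).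
  have SE0 : 0 <= S (E n) by exact: measure_ge0.
  case SE : (S (E n)) SE0 (ES n) => [y| |]// y0 _; rewrite lee_fin in y0.
  have [->|yN0] := eqVneq y 0%R.
    move=> _; rewrite poweR_EFin powR0; last by rewrite gt_eqF// invr_gt0.
    by rewrite mule0 lee_fin ltW.
  have yp : (0 < y)%R by rewrite lt_neqAle eq_sym yN0.
  rewrite !poweR_EFin => h.
  have y1 : (0 < y `^ p^-1)%R by rewrite powR_gt0.
  rewrite -(@lee_pmul2r _ (y `^ p^-1)%:E)// ?lte_fin// -muleA -EFinM -powRD; last first.
    by apply/implyP => _; rewrite gt_eqF.
  by rewrite invrK subrK powRr1 ?(ltW yp).
(* A bound on $\sigma(E_n)$ uniform in [n]. If [X] is infinite, every $\sigma(E_n)$ must vanish and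
   $b = 0$ works; otherwise the inequality is solved for $\sigma(E_n)$. *)
have [b b0 [Sb Xb]] : exists2 b : R, (0 <= b)%R &
    (forall n, S (E n) <= b%:E) /\ X * (b `^ p'^-1)%:E <= K%:E.
  case XX : X Xgt XE => [x| |]// x0 XE; last first.
    exists 0%R => //; split; last first.
      by rewrite powR0 ?gt_eqF ?invr_gt0// mule0 lee_fin ltW.
    move=> n; rewrite leNgt; apply/negP => S0; have := XE n.
    by rewrite gt0_mulye ?poweR_gt0// leye_eq.
  rewrite lte_fin in x0.
  exists ((K / x) `^ p')%R; first exact: powR_ge0.
  split=> [n|]; last first.
    rewrite -powRrM mulfV ?gt_eqF// powRr1 ?divr_ge0 ?(ltW K0) ?(ltW x0)//.
    by rewrite -EFinM mulrC divfK ?gt_eqF ?lexx.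
  have := XE n; rewrite -lee_pdivlMl// -EFinM mulrC => h.
  have := lee_poweR (ltW p'0) (poweR_ge0 _ _) h.
  by rewrite poweRVK ?gt_eqF// ?measure_ge0// poweR_EFin.
apply: le_trans Xb; apply: lee_wpmul2l => //; rewrite -poweR_EFin.
apply: lee_poweR; [by rewrite invr_ge0 ltW|exact: measure_ge0|].
have QE : Q = \bigcup_n E n.
  apply/seteqP; split => [x Qx|x [n _ []//]].
  exists (Num.truncn (sg x)).+1 => //; split => //=.
  exact/ltW/truncnS_gt.
have cS : S (E n) @[n --> \oo] --> S (\bigcup_n E n).
  apply: nondecreasing_cvg_mu => //; first by rewrite -QE.
  move=> m n mn; apply/subsetPset => x [Qx /= xm]; split => //=.
  by rewrite (le_trans xm)// ler_nat.
rewrite [in leLHS]QE -(cvg_lim _ cS)//; apply: lime_le; first exact: cvgP cS.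
exact: nearW.
Qed.

End necessity.

(** * Invariance under changes on null sets *)

Section ae_invariance.
Local Open Scope ereal_scope.
Context {R : realType} {d : nat}.
Notation T := (Rd R d).
Notation mu := (@lebesgue R d).
Implicit Types (f g w : T -> \bar R) (Q : set T).

(** Completeness of Lebesgue measure on its Caratheodory sigma-algebra makes every almost everywhere
    modification measurable. *)
Lemma measurable_ae_eq f g (D : set T) : measurable_fun D g ->
  {ae mu, forall x, f x = g x} -> measurable_fun D f.
Proof.
move=> mg [N [mN N0 sub]]; apply: (@ae_measurable_fun _ T R mu _ D g f) => //.
  exact: measure_is_complete_caratheodory.
by exists N; split => // x /= fg; apply: sub => /= fgx; apply: fg.
Qed.

Lemma ae_eq_lorentz_norm a (b : \bar R) f g : measurable_fun setT g ->
  {ae mu, forall x, f x = g x} -> lorentz_norm a b f = lorentz_norm a b g.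
Proof.
move=> mg fg; have mf := measurable_ae_eq mg fg.
have E : rearrangement f = rearrangement g := ae_eq_rearr mf mg fg.
by rewrite /lorentz_norm E.
Qed.

Lemma ae_eq_cube_lorentz_norm a (b : \bar R) Q f g : is_cube Q ->
  measurable_fun setT g -> {ae mu, forall x, f x = g x} ->
  cube_lorentz_norm a b Q f = cube_lorentz_norm a b Q g.
Proof.
move=> cQ mg fg; rewrite /cube_lorentz_norm.
rewrite (@ae_eq_lorentz_norm a b (f \_ Q) (g \_ Q))//.
  apply/(measurable_restrictT _ (is_cube_measurable cQ)).
  exact: measurable_funTS.
by apply: filterS fg => x; rewrite !patchE => ->.
Qed.

Lemma ae_eq_cube_average Q f g : is_cube Q ->
  measurable_fun setT g -> {ae mu, forall x, f x = g x} ->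
  cube_average Q f = cube_average Q g.
Proof.
move=> cQ mg fg; congr (_ * _); apply: ae_eq_integral.
- exact: is_cube_measurable.
- exact: measurable_ae_eq (measurable_funTS mg) fg.
- exact: measurable_funTS.
- by apply: filterS fg => x + _.
Qed.

Variables (w : T -> \bar R) (W : T -> R).
Hypotheses (mW : measurable_fun setT W) (W0 : forall x, (0 < W x)%R).
Hypothesis wW : {ae mu, forall x, w x = (W x)%:E}.

Let mw : measurable_fun setT (EFin \o W). Proof. exact/measurable_EFinP. Qed.

Lemma ae_eq_lorentz_A p r q s :
  lorentz_A p r q s w = lorentz_A p r q s (EFin \o W).
Proof.
have mV : measurable_fun setT (fun x => ((EFin \o W) x)^-1).
  rewrite (_ : (fun _ => _) = EFin \o (fun x => W x `^ (-1))%R).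
    by apply/measurable_EFinP; exact: (measurableT_comp (measurable_powR _) mW).
  by apply/funext => x; rewrite /= inver gt_eqF// powR_inv1// ltW.
have wV : {ae mu, forall x, (w x)^-1 = ((EFin \o W) x)^-1}.
  by apply: filterS wW => x ->.
have E1 Q : is_cube Q ->
    cube_lorentz_norm q s Q w = cube_lorentz_norm q s Q (EFin \o W).
  by move=> cQ; exact: ae_eq_cube_lorentz_norm cQ mw wW.
have E2 a b Q : is_cube Q -> cube_lorentz_norm a b Q (fun x => (w x)^-1) =
    cube_lorentz_norm a b Q (fun x => ((EFin \o W) x)^-1).
  by move=> cQ; exact: ae_eq_cube_lorentz_norm cQ mV wV.
rewrite /lorentz_A.
move: (cube_lorentz_norm q s) (cube_lorentz_norm (conj_exp p) (hoelder_conjugate r))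
  E1 (E2 (conj_exp p) (hoelder_conjugate r)) => A B E1' E2'.
congr (ereal_sup _ < _); apply: eq_imagel => Q cQ.
by rewrite (E1' Q cQ) (E2' Q cQ).
Qed.

Lemma ae_eq_muckenhoupt_A p q : muckenhoupt_A p q w = muckenhoupt_A p q (EFin \o W).
Proof.
have avg a Q : is_cube Q -> cube_average Q (fun x => w x `^ a) =
    cube_average Q (fun x => (EFin \o W) x `^ a).
  move=> cQ; apply: (ae_eq_cube_average cQ); first exact: measurable_fun_poweR.
  by apply: filterS wW => x ->.
have E Q : is_cube Q -> cube_average Q (fun x => w x `^ q) `^ q^-1 *
    cube_average Q (fun x => w x `^ (- conj_exp p)) `^ (conj_exp p)^-1 =
    cube_average Q (fun x => (EFin \o W) x `^ q) `^ q^-1 *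
    cube_average Q (fun x => (EFin \o W) x `^ (- conj_exp p)) `^ (conj_exp p)^-1.
  by move=> cQ; rewrite (avg q Q cQ) (avg _ Q cQ).
by rewrite /muckenhoupt_A (eq_imagel E).
Qed.

Lemma ae_eq_weighted_lorentz_norm a (b : \bar R) f : measurable_fun setT f ->
  weighted_lorentz_norm a b w f = weighted_lorentz_norm a b (EFin \o W) f.
Proof.
move=> mf; apply: ae_eq_lorentz_norm; first exact: emeasurable_funM.
by apply: filterS wW => x /= ->.
Qed.

Lemma ae_eq_bounded_weighted_lorentz p r q s F :
  bounded_weighted_lorentz p r q s w F <->
  bounded_weighted_lorentz p r q s (EFin \o W) F.
Proof.
have N a b f : measurable_fun setT f ->
    weighted_lorentz_norm a b w f = weighted_lorentz_norm a b (EFin \o W) f.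
  exact: ae_eq_weighted_lorentz_norm.
split=> -[C H]; exists C => f [mf ff].
  have := H f; rewrite /weighted_lorentz /= (N _ _ _ mf) => -[//|[mF Ff] CF].
  by rewrite (N _ _ _ mF) in Ff CF.
have := H f; rewrite /weighted_lorentz /= -(N _ _ _ mf) => -[//|[mF Ff] CF].
by rewrite -(N _ _ _ mF) in Ff CF.
Qed.

End ae_invariance.

(** [fine] sends infinite values to 0, so the single test on the sign of [V] catches all bad points;
    there the value 1 is substituted. *)
Lemma is_weight_representative (R : realType) (d : nat) (w : Rd R d -> \bar R) :
  is_weight w -> exists W : Rd R d -> R, [/\ measurable_fun setT W,
    forall x, 0 < W x & {ae @lebesgue R d, forall x, w x = (W x)%:E}].
Proof.
move=> [mw w0].
pose V x := fine (w x).
have mV : measurable_fun setT V by apply: measurableT_comp mw.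
exists (fun x => if 0 < V x then V x else 1); split.
- apply: measurable_fun_ifT (mV) _; last exact: measurable_cst.
  exact: measurable_fun_ltr (measurable_cst _) mV.
- by move=> x; case: ifP.
- apply: filterS w0 => x /andP[w0x wx].
  have wfin : w x \is a fin_num by rewrite ge0_fin_numE// ltW.
  by rewrite /V fine_gt0 ?w0x// fineK.
Qed.

Theorem theorem4p3 (R : realType) (d : nat) (alpha p q r s : R)
    (w : Rd R d -> \bar R)
    (alpha_ge0 : 0 <= alpha) (alpha_ltd : alpha < d%:R)
    (p_gt1 : 1 < p)
    (q_eq : q^-1 = p^-1 - alpha / d%:R) (qV_gt0 : 0 < q^-1)
    (p_le_r : p <= r) (r_le_s : r <= s) (s_le_q : s <= q)
    (w_weight : is_weight w) :
  (lorentz_A p r%:E q s%:E w <-> muckenhoupt_A p q w) /\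
  (muckenhoupt_A p q w <->
   bounded_weighted_lorentz p r%:E q s%:E w (fractional_maximal alpha)).
Proof.
have [W [mW W0 wW]] := is_weight_representative w_weight.
rewrite (ae_eq_lorentz_A mW W0 wW) (ae_eq_muckenhoupt_A mW wW).
have bE := ae_eq_bounded_weighted_lorentz mW wW p r%:E q s%:E (fractional_maximal alpha).
split; split.
- exact: lorentz_A_muckenhoupt.
- exact: muckenhoupt_lorentz_A.
- move=> wA; apply/bE.
  exact: (muckenhoupt_bounded mW W0 alpha_ge0 alpha_ltd p_gt1 q_eq qV_gt0
    p_le_r r_le_s wA).
- move=> /bE bw; exact: (bounded_muckenhoupt mW W0 p_gt1 q_eq qV_gt0
    p_le_r r_le_s s_le_q bw).
Qed.
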